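(* Let $p>1$ and $0<\alpha<n$, and let $f\ge0$ be a measurable function on $\mathbb{R}^n$. Then the following estimates hold. (a) If $2-\frac\alpha n<p<\infty$, $0<\alpha<\frac np$, and $f\in L^s(\mathbb{R}^n)$, where $1\le s<\frac{n}{\alpha p}$, then, for all $x\in\mathbb{R}^n$, $$\mathbf{U}_{\alpha,p}f(x)\le c\,(\mathbf{M}f(x))^{\frac{n-\alpha ps}{(p-1)n}}\,\|f\|_{L^s(\mathbb{R}^n)}^{\frac{\alpha ps}{(p-1)n}}.$$ (b) If $1<p<\infty$, $0<\alpha<\frac np$, and $f\in L^s(\mathbb{R}^n)\cap L^\infty(\mathbb{R}^n)$, where $0<s<\frac{n}{\alpha p}$, then, for all $x\in\mathbb{R}^n$, $$\mathbf{U}_{\alpha,p}f(x)\le c\,\|f\|_{L^\infty(\mathbb{R}^n)}^{\frac{n-\alpha ps}{(p-1)n}}\,\|f\|_{L^s(\mathbb{R}^n)}^{\frac{\alpha ps}{(p-1)n}}.$$ (c) If $2-\frac\alpha n<p<\infty$, $0<\alpha\le\frac np$, and $f\in L^s(\mathbb{R}^n)$, where $s=\frac{n}{\alpha p}$, then, for all $x\in\mathbb{R}^n$, $$\mathbf{V}_{\alpha,p}f(x)\le c\,\|f\|_{L^s(\mathbb{R}^n)}^{\frac1{p-1}}\left(\frac{(\mathbf{M}f(x))^{\frac1{p-1}}}{(\mathbf{M}f(x))^{\frac1{p-1}}+\|f\|_{L^s(\mathbb{R}^n)}^{\frac1{p-1}}}+\log^+\left(\frac{\mathbf{M}f(x)}{\|f\|_{L^s(\mathbb{R}^n)}}\right)\right).$$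 (d) If $1<p<\infty$, $0<\alpha\le\frac np$, and $f\in L^s(\mathbb{R}^n)\cap L^\infty(\mathbb{R}^n)$, where $s=\frac n{\alpha p}$, then, for all $x\in\mathbb{R}^n$, $$\mathbf{V}_{\alpha,p}f(x)\le c\,\|f\|_{L^s(\mathbb{R}^n)}^{\frac1{p-1}}\left(\frac{\|f\|_{L^\infty(\mathbb{R}^n)}^{\frac1{p-1}}}{\|f\|_{L^\infty(\mathbb{R}^n)}^{\frac1{p-1}}+\|f\|_{L^s(\mathbb{R}^n)}^{\frac1{p-1}}}+\log^+\left(\frac{\|f\|_{L^\infty(\mathbb{R}^n)}}{\|f\|_{L^s(\mathbb{R}^n)}}\right)\right).$$ Here $c$ denotes positive constants which depend only on $\alpha$, $p$, and $n$.
   Context: For $0<\alpha<n$ and $f\ge0$, the Riesz potential is $\mathbf{I}_\alpha f(x)=\frac1{n-\alpha}\int_{\mathbb{R}^n}\frac{f(y)}{|x-y|^{n-\alpha}}\,dy$. The Bessel potential is $\mathbf{J}_\alpha f(x)=\int_{\mathbb{R}^n}G_\alpha(x-t)f(t)\,dt$, where $G_\alpha$ is the Bessel kernel of order $\alpha>0$ (the kernel of $(1-\Delta)^{-\alpha/2}$). For $1<p<\infty$, the Havin–Maz'ya potential is $\mathbf{U}_{\alpha,p}f(x)=\mathbf{I}_\alpha\big((\mathbf{I}_\alpha f)^{\frac1{p-1}}\big)(x)$ (for $0<\alpha<\frac np$), and its nonhomogeneous analogue is $\mathbf{V}_{\alpha,p}f(x)=\mathbf{J}_\alpha\big((\mathbf{J}_\alpha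 f)^{\frac1{p-1}}\big)(x)$ (for $0<\alpha\le\frac np$). The Hardy–Littlewood maximal function is $\mathbf{M}f(x)=\sup_{r>0}\frac1{|B_r(x)|}\int_{B_r(x)}|f(y)|\,dy$, where $B_r(x)$ is the ball of radius $r$ centered at $x$. $\log^+s:=\log s$ if $s>1$ and $\log^+s:=0$ if $s\le1$. For $0<s<\infty$ (including $0<s<1$), $\|f\|_{L^s(\mathbb{R}^n)}=\left(\int_{\mathbb{R}^n}|f|^s\,dx\right)^{1/s}$. For $f=0$ a.e. the right-hand sides in (c) and (d) are interpreted as $0$.
   Formalization: In (a) and (b) the constant c may also depend on s; a constant depending only on α, p and n is impossible, since it would have to blow up as s tends to n/(αp) (for instance when p=2). *)

(* Defs.v *)
From HB Require Import structures.
From mathcomp Require Import all_boot all_order all_algebra.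
From mathcomp Require Import all_classical all_reals all_analysis.
From mathcomp Require Import measurable_realfun.
Set Implicit Arguments.
Unset Strict Implicit.
Unset Printing Implicit Defensive.
Import Order.TTheory GRing.Theory Num.Theory.
Import numFieldNormedType.Exports.
Local Open Scope classical_set_scope.
Local Open Scope ring_scope.

(* R^n is the type n.-tuple R with the sigma-algebra generated by the
   coordinates, i.e. the Borel sigma-algebra. *)
Section lebesgue_measure_on_tuples.
Context {R : realType}.
Local Open Scope ereal_scope.

Definition cons_pair n (z : R * n.-tuple R) : n.+1.-tuple R :=
  [tuple of z.1 :: z.2].

Lemma measurable_cons_pair n : measurable_fun [set: R * n.-tuple R]
  (@cons_pair n).
Proof. exact: measurable_cons. Qed.

Section step.
Variables (n : nat) (m : {sigma_finite_measure set (n.-tuple R) -> \bar R}).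

Definition lebn_step : set (n.+1.-tuple R) -> \bar R :=
  pushforward (lebesgue_measure \x m) (@cons_pair n).

Let step0 : lebn_step set0 = 0.
Proof. by rewrite /lebn_step /pushforward preimage_set0 [LHS]measure0. Qed.

Let step_ge0 A : 0 <= lebn_step A.
Proof. exact: (measure_ge0 (lebesgue_measure \x m)%E). Qed.

Let step_sigma_additive : semi_sigma_additive lebn_step.
Proof.
move=> F mF tF mUF; rewrite /lebn_step /pushforward preimage_bigcup.
apply: measure_semi_sigma_additive.
- by move=> k; rewrite -[X in measurable X]setTI; exact: measurable_cons_pair.
- apply/trivIsetP => /= i j _ _ ij; rewrite -preimage_setI.
  by move/trivIsetP : tF => /(_ _ _ _ _ ij) ->//; rewrite preimage_set0.
- by rewrite -preimage_bigcup -[X in measurable X]setTI;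
    exact: measurable_cons_pair.
Qed.

HB.instance Definition _ := isMeasure.Build _ _ _ lebn_step
  step0 step_ge0 step_sigma_additive.

Let uncons (t : n.+1.-tuple R) : R * n.-tuple R := (thead t, [tuple of behead t]).

Let measurable_uncons : measurable_fun setT uncons.
Proof.
apply: measurable_fun_pair; first exact: (measurable_tnth ord0).
exact: measurable_behead.
Qed.

Let step_sigma_finite : sigma_finite setT lebn_step.
Proof.
have /sigma_finiteP[F [TF ndF Foo]] := sigma_finiteT (@lebesgue_measure R).
have /sigma_finiteP[G [TG ndG Goo]] := sigma_finiteT m.
exists (fun k => uncons @^-1` (F k `*` G k)).
  rewrite -preimage_bigcup -(preimage_setT uncons); congr (_ @^-1` _).
  apply/seteqP; split=> [[x t] _|//].
  have [i _ Fx] : (\bigcup_i F i) x by rewrite -TF.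
  have [j _ Gt] : (\bigcup_j G j) t by rewrite -TG.
  exists (maxn i j) => //; split => /=.
    by move: x Fx; exact/subsetPset/ndF/leq_maxl.
  by move: t Gt; exact/subsetPset/ndG/leq_maxr.
move=> k; have [mF Fk] := Foo k; have [mG Gk] := Goo k; split.
  rewrite -[X in measurable X]setTI.
  by apply: measurable_uncons => //; exact: measurableX.
rewrite /lebn_step /pushforward.
rewrite (_ : _ @^-1` _ = F k `*` G k); last first.
  rewrite -comp_preimage (_ : uncons \o _ = id)//.
  by apply/funext => -[x t]; congr pair; exact/val_inj.
by rewrite [ltLHS]product_measure1E// lte_mul_pinfty// ge0_fin_numE.
Qed.

HB.instance Definition _ := Measure_isSigmaFinite.Build _ _ _ lebn_step
  step_sigma_finite.

End step.

Definition lebn0 : set (0.-tuple R) -> \bar R := dirac [tuple].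
HB.instance Definition _ := Measure.on lebn0.
Let lebn0_sigma_finite : sigma_finite setT lebn0.
Proof.
by apply: fin_num_fun_sigma_finite; [rewrite measure0|exact: fin_num_measure].
Qed.
HB.instance Definition _ := Measure_isSigmaFinite.Build _ _ _ lebn0
  lebn0_sigma_finite.

(* n-dimensional Lebesgue measure, as an iterated product measure *)
Fixpoint lebn n : {sigma_finite_measure set (n.-tuple R) -> \bar R} :=
  match n with
  | 0 => lebn0
  | n'.+1 => lebn_step (lebn n')
  end.

Lemma lebn_box n (A : 'I_n -> set R) : (forall i, measurable (A i)) ->
  lebn n [set t | forall i, A i (tnth t i)] =
  \prod_(i < n) (lebesgue_measure (A i) : \bar R).
Proof.
elim: n A => [|n IH] A mA.
  rewrite big_ord0 /= /lebn0 diracE mem_set//=; by case.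
rewrite big_ord_recl -IH// /= /lebn_step /pushforward.
have mB : measurable [set t : n.-tuple R | forall i, A (lift ord0 i) (tnth t i)].
  rewrite (_ : [set _ | _] = \bigcap_(i in [set: 'I_n])
     ((fun t => tnth t i) @^-1` A (lift ord0 i))).
    apply: fin_bigcap_measurable => // i _.
    by rewrite -[X in measurable X]setTI; exact: measurable_tnth.
  by apply/seteqP; split => [t h i _|t h i]; [exact: h|exact: (h i)].
apply: etrans (product_measure1E lebesgue_measure (lebn n) (mA ord0) mB).
congr (product_measure1 _ _ _).
apply/seteqP; split => [[x t] /= h|[x t] /= [hx ht] i].
  by split; [exact: (h ord0)|move=> i; have := h (lift ord0 i); rewrite tnthS].
by case: (unliftP ord0 i) => [j ->|->//]; rewrite tnthS; exact: ht.
Qed.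

End lebesgue_measure_on_tuples.

Arguments lebn {R} n.

Section potentials.
Context {R : realType} (n : nat).
Local Notation Rn := (n.-tuple R).
Local Notation mu := (@lebn R n).
Implicit Types (x y t : Rn) (f : Rn -> \bar R).

(* the Euclidean norm, not the sup norm *)
Definition enorm x : R := Num.sqrt (\sum_(i < n) tnth x i ^+ 2).

Definition esub x y : Rn := [tuple tnth x i - tnth y i | i < n].

Definition eball x (r : R) : set Rn := [set y | enorm (esub x y) < r].

(* measurability with respect to the completion of the Borel sigma-algebra *)
Definition lebesgue_measurable_fun f : Prop :=
  forall B : set (\bar R), measurable B -> completed_algebra_gen mu (f @^-1` B).

Local Open Scope ereal_scope.

Definition riesz (alpha : R) f x : \bar R :=
  ((n%:R - alpha)^-1)%:E *
  \int[mu]_y (f y / (enorm (esub x y) `^ (n%:R - alpha))%:E).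

Definition heat_kernel (s : R) x : R :=
  ((4 * pi * s) `^ (- (n%:R / 2)) * expR (- (enorm x ^+ 2 / (4 * s))))%R.

Definition gamma_fun (a : R) : R :=
  (\int[lebesgue_measure]_(s in `]0%R, +oo[) (s `^ (a - 1) * expR (- s)))%R.

(* The kernel of (1 - Laplacian)^(-alpha/2), from
     (1 - Laplacian)^(-alpha/2) =
       1/Gamma(alpha/2) int_0^oo s^(alpha/2-1) e^(-s) e^(s Laplacian) ds,
   where e^(s Laplacian) is the convolution with heat_kernel s.  Its Fourier
   transform is (1 + |xi|^2)^(-alpha/2). *)
Definition bessel_kernel (alpha : R) x : \bar R :=
  ((gamma_fun (alpha / 2))^-1)%:E *
  \int[lebesgue_measure]_(s in `]0%R, +oo[)
     (s `^ (alpha / 2 - 1) * expR (- s) * heat_kernel s x)%:E.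

Definition bessel (alpha : R) f x : \bar R :=
  \int[mu]_t (bessel_kernel alpha (esub x t) * f t).

Definition havin_mazya (alpha p : R) f : Rn -> \bar R :=
  riesz alpha (fun y => riesz alpha f y `^ (p - 1)^-1).

Definition havin_mazya_nonhom (alpha p : R) f : Rn -> \bar R :=
  bessel alpha (fun y => bessel alpha f y `^ (p - 1)^-1).

Definition maximal f x : \bar R :=
  ereal_sup [set (mu (eball x r))^-1 * \int[mu]_(y in eball x r) `|f y|
            | r in `]0%R, +oo[].

Definition lne_plus (s : \bar R) : \bar R := if 1 < s then lne s else 0.

(* N^(1/(p-1)) (A^(1/(p-1)) / (A^(1/(p-1)) + N^(1/(p-1))) + log+ (A / N)).
   In \bar R, 0 * u = 0 for every u, so this is 0 when N = 0; and it is +oo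
   when A = +oo and 0 < N < +oo, thanks to log+. *)
Definition log_bound (p : R) (A N : \bar R) : \bar R :=
  let q := ((p - 1)^-1)%R in
  N `^ q * (A `^ q / (A `^ q + N `^ q) + lne_plus (A / N)).

End potentials.

(* Main.v *)
Require Import Defs.
From mathcomp Require Import all_boot all_order all_algebra.
From mathcomp Require Import all_classical all_reals all_analysis.
From mathcomp Require Import measurable_realfun ess_sup_inf ring lra.
Set Implicit Arguments.
Unset Strict Implicit.
Unset Printing Implicit Defensive.
Import Order.TTheory GRing.Theory Num.Theory.
Import numFieldNormedType.Exports.
Local Open Scope classical_set_scope.
Local Open Scope ring_scope.

(** Write q = 1/(p-1), B(x,r) for the Euclidean balls and F(x,t) for the integral
of f over B(x,t). All four estimates come from one dyadic analysis at a fixed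
point x, in which f enters only through two families of numbers.

Both potentials are dominated by the potential P f with the kernel |x|^(alpha-n)
max(1,|x|)^(-K): the Riesz kernel is the case K = 0, and the Bessel kernel is
bounded by such a kernel for every K > 0 ([bessel_kernel_le]). For every scale r >
0 the kernel is at most a sum of multiples of indicators of the balls of radii r
2^(-j) and r 2^j ([kpot_dyadic]), so that P f (y) is bounded by a near sum, made
of the F(y, r 2^(-j)), and a far sum, made of the F(y, r 2^j). If y is in B(x,r),
the far sum is controlled by the masses F(x, r 2^(j+2)) at x itself. Only the near
sum still depends on y, and it is estimated in the mean over B(x,r). This gives
the growth of the integral of (P f)^q over B(x,r) ([ball_bound]), and a second use
of the dyadic bound, now for the function (P f)^q at x, bounds P ((P f)^q) (x) by
geometric series.

Let M be the maximal function at x in (a) and (c), the essential supremum of f in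
(b) and (d), let N be the L^s norm and let delta = (N / M)^(s/n) be the scale at
which the two bounds F(x,t) <= C M t^n and F(x,t) <= C N t^(n - n/s) agree. (The
second one needs s >= 1; in (b), s is first raised to a value close to n/(alpha
p), which changes neither M nor delta.) The input is that, for suitable exponents
e in [0, n/s], F(x,t) is at most C t^n M (delta/t)^e ([mass_bound]), and the near
sum at scale t is at most t^alpha M (delta/t)^e in the sense of q-th power means
over B(x,t) ([near_bound]). Taking e slightly larger than alpha below the scale
delta and e = n/s above it makes all series converge. For s < n/(alpha p) both
ranges add up to M^q delta^(alpha p q), which is the right-hand side of (a) and
(b). For s = n/(alpha p) each dyadic annulus between delta and 1 contributes the
same amount N^q; there are about log (M/N) of them, and the factor max(1,|x|)^(-K)
takes care of the scales above 1. If delta > 1 only the bound by M is used, at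
unit scale ([iterated_unit_scale]).

The mean bound of the near sum is where the hypotheses on p enter. When q (n -
alpha) < n, that is p > 2 - alpha/n, the kernel is locally q-integrable and the
mean is controlled by the mass of f alone ([near_sum_Lq]); this settles (a) and
(c). For bounded f and any p > 1, f is split at each scale into a bounded part and
a multiple of f^s, and near sums of f^s with a less singular kernel are used
instead ([near_bound_bounded]). *)

(** * Lower integrals of non-negative functions *)
Section integrals.
Context d (T : measurableType d) (R : realType).
Variable m : {measure set T -> \bar R}.
Local Open Scope ereal_scope.
Import HBNNSimple.

(** The integral of a non-negative function is a supremum over the simple functions
below it, so monotonicity extends to functions that are not known to be measurable,
such as the kernels and the potentials below. *)
Lemma ge0_le_integralT (f g : T -> \bar R) : (forall x, 0 <= f x) ->
  (forall x, f x <= g x) -> \int[m]_x f x <= \int[m]_x g x.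
Proof.
move=> f0 fg; have g0 x : 0 <= g x by exact: le_trans (f0 x) (fg x).
rewrite !ge0_integralTE//; apply: ereal_sup_le => _ [h hf <-].
by exists h => // x; exact: le_trans (hf x) (fg x).
Qed.

Lemma ge0_le_integral_on (D : set T) (f g : T -> \bar R) :
  (forall x, D x -> 0 <= f x) ->
  (forall x, D x -> f x <= g x) -> \int[m]_(x in D) f x <= \int[m]_(x in D) g x.
Proof.
move=> f0 fg; rewrite integral_mkcond [leRHS]integral_mkcond.
apply: ge0_le_integralT => x; first exact: erestrict_ge0.
by rewrite /patch; case: ifPn => //; rewrite inE => Dx; exact: fg.
Qed.
End integrals.

(** * Euclidean balls and their Lebesgue measure *)
Section geometry.
Context {R : realType} (n : nat).
Local Notation Rn := (n.-tuple R).
Local Notation mu := (@lebn R n).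
Implicit Types (x y z : Rn) (r : R).

Lemma enorm_ge0 x : 0 <= enorm x.
Proof. exact: sqrtr_ge0. Qed.

Lemma enorm_esubC x y : enorm (esub x y) = enorm (esub y x).
Proof.
rewrite /enorm; congr Num.sqrt; apply: eq_bigr => i _.
by rewrite !tnth_mktuple -sqrrN opprB.
Qed.

Lemma eballC x y r : eball x r y -> eball y r x.
Proof. by rewrite /eball/= enorm_esubC. Qed.

Lemma sub_eball x r s : r <= s -> eball x r `<=` eball x s.
Proof. by move=> rs y /= /lt_le_trans; exact. Qed.

(** A substitute for the triangle inequality: |u + v|^2 <= 2|u|^2 + 2|v|^2 already
gives it for two balls of the same radius, the only case that the dyadic arguments
need. *)
Lemma eball_trans x y z r : eball x r y -> eball y r z -> eball x (2 * r) z.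
Proof.
rewrite /eball/= => xy yz.
have r0 : 0 < r by apply: le_lt_trans xy; exact: enorm_ge0.
have sq (u : Rn) t : 0 < t -> (enorm u < t) = (\sum_(i < n) tnth u i ^+ 2 < t ^+ 2).
  move=> t0; rewrite -[in RHS](@sqr_sqrtr _ (\sum_(i < n) tnth u i ^+ 2)).
    by rewrite ltr_pXn2r ?nnegrE ?sqrtr_ge0 ?ltW.
  by apply: sumr_ge0 => i _; exact: sqr_ge0.
move: xy yz; rewrite !sq ?mulr_gt0// => xy yz.
apply: (@le_lt_trans _ _ (2 * (\sum_(i < n) tnth (esub x y) i ^+ 2) +
    2 * (\sum_(i < n) tnth (esub y z) i ^+ 2))).
  rewrite !mulr_sumr -big_split/=; apply: ler_sum => i _.
  rewrite !tnth_mktuple.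
  have := sqr_ge0 ((tnth x i - tnth y i) - (tnth y i - tnth z i)); nra.
by rewrite exprMn; nra.
Qed.

Lemma measurable_enorm_esub :
  measurable_fun setT (fun u : Rn * Rn => enorm (esub u.1 u.2)).
Proof.
rewrite /enorm; apply: (@measurableT_comp _ _ _ _ _ _ (@Num.sqrt R)).
  by apply: continuous_measurable_fun; exact: sqrt_continuous.
apply: measurable_sum => i; apply: measurable_funX.
rewrite (_ : (fun _ => _) = (fun u => tnth u.1 i - tnth u.2 i)); last first.
  by apply/funext => u; rewrite tnth_mktuple.
apply: measurable_funB.
- exact: (measurableT_comp (measurable_tnth i)).
- exact: (measurableT_comp (measurable_tnth i)).
Qed.

Lemma measurable_eball2 r : measurable [set u : Rn * Rn | eball u.1 r u.2].
Proof.
rewrite -[X in measurable X]setTI.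
exact: (measurable_enorm_esub measurableT (measurable_itv `]-oo, r[)).
Qed.

Lemma measurable_eball x r : measurable (eball x r).
Proof.
rewrite (_ : eball x r = xsection [set u : Rn * Rn | eball u.1 r u.2] x).
  exact: measurable_xsection (measurable_eball2 r).
by apply/seteqP; split => y; rewrite /xsection/= inE.
Qed.

Lemma enorm_coord x i : `|tnth x i| <= enorm x.
Proof.
rewrite -sqrtr_sqr; apply: ler_wsqrtr.
rewrite (bigD1 i)//= lerDl; apply: sumr_ge0 => j _; exact: sqr_ge0.
Qed.

(** The ball lies in a cube of side 2r.  This bound is the only information on the
size of balls that enters the estimates. *)
Lemma lebn_eball x r : 0 <= r -> (mu (eball x r) <= ((2 * r) ^+ n)%:E)%E.
Proof.
move=> r0; pose A i : set R := `[tnth x i - r, tnth x i + r]%classic.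
have mA i : measurable (A i) by exact: measurable_itv.
have lA i : lebesgue_measure (A i) = (2 * r)%:E.
  rewrite lebesgue_measure_itv/= lte_fin -EFinD.
  case: ifPn => [_|]; first by congr EFin; ring.
  rewrite -leNgt => ?; have -> : r = 0 by lra.
  by rewrite mulr0.
have mB : measurable [set t : Rn | forall i, A i (tnth t i)].
  rewrite (_ : [set _ | _] = \bigcap_(i in [set: 'I_n])
     ((fun t => tnth t i) @^-1` A i)).
    apply: fin_bigcap_measurable => // i _.
    by rewrite -[X in measurable X]setTI; exact: measurable_tnth.
  by apply/seteqP; split => [t h i _|t h i]; [exact: h|exact: (h i)].
apply: (@le_trans _ _ (mu [set t : Rn | forall i, A i (tnth t i)])).
  apply: le_measure; rewrite ?inE//; first exact: measurable_eball.
  move=> y /= xy i; have /ltW/(le_trans (enorm_coord _ i)) := xy.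
  by rewrite tnth_mktuple ler_norml /A/= in_itv/= => ?; lra.
rewrite lebn_box//; under eq_bigr do rewrite lA.
by rewrite prodEFin prodr_const card_ord.
Qed.

End geometry.

Section null.
Context d (T : measurableType d) (R : realType).
Variable m : {measure set T -> \bar R}.
Local Open Scope ereal_scope.
Import HBNNSimple.

(** Restricting a simple function below f to the complement of N does not change its
integral, whatever f is.  This lets the singular point of a kernel, or the null set on
which a Lebesgue measurable function differs from a Borel one, be ignored. *)
Lemma le_integral_off_null (f g : T -> \bar R) (N : set T) :
  (forall x, 0 <= f x) -> (forall x, 0 <= g x) ->
  measurable N -> m N = 0 -> (forall x, ~ N x -> f x <= g x) ->
  \int[m]_x f x <= \int[m]_x g x.
Proof.
move=> f0 g0 mN N0 fg; rewrite ge0_integralTE//.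
apply: ge_ereal_sup => _ [h hf <-].
rewrite -integralT_nnsfun (ge0_negligible_integral mN)//; last 2 first.
  exact/measurable_EFinP.
  by move=> x _; rewrite lee_fin.
rewrite setTD integral_mkcond; apply: ge0_le_integralT => x.
  by apply: erestrict_ge0 => y _; rewrite lee_fin.
rewrite /patch; case: ifPn => [|_]; last exact: g0.
by rewrite inE => /fg; apply: le_trans; exact: hf.
Qed.

End null.

(** * Mass of balls *)
Section ballint.
Context {R : realType} (n : nat).
Local Notation Rn := (n.-tuple R).
Local Notation mu := (@lebn R n).
Local Open Scope ereal_scope.

Definition ballint (f : Rn -> \bar R) (x : Rn) (t : R) : \bar R :=
  \int[mu]_(y in eball x t) f y.

Variables (f : Rn -> \bar R) (f0 : forall y, 0 <= f y).
Hypothesis mf : measurable_fun setT f.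
Implicit Types (x y z : Rn) (r t : R).

Lemma ballint_ge0 x t : 0 <= ballint f x t.
Proof. exact: integral_ge0. Qed.

Lemma ballintE x t : ballint f x t = \int[mu]_y (f \_ (eball x t)) y.
Proof. exact: integral_mkcond. Qed.

Lemma measurable_restr_eball x t : measurable_fun setT (f \_ (eball x t)).
Proof.
apply/(measurable_restrictT _ _).1; first exact: measurable_eball.
exact: measurable_funTS.
Qed.

Lemma le_ballint x y s t : eball y t `<=` eball x s ->
  ballint f y t <= ballint f x s.
Proof.
move=> yx; apply: ge0_subset_integral => //; try exact: measurable_eball.
exact: measurable_funTS.
Qed.

Let mball2 t : measurable_fun setT
  ((fun u : Rn * Rn => f u.2) \_ [set u | eball u.1 t u.2]).
Proof.
apply/(measurable_restrictT _ _).1; first exact: measurable_eball2.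
apply: measurable_funTS; exact: (measurableT_comp mf measurable_snd).
Qed.

Let ball2E x t z : (f \_ (eball x t)) z =
  ((fun u : Rn * Rn => f u.2) \_ [set u | eball u.1 t u.2]) (x, z).
Proof.
by rewrite /patch; congr (if _ then _ else _); apply/idP/idP; rewrite !inE.
Qed.

Lemma measurable_ballint t : measurable_fun setT (ballint f ^~ t).
Proof.
rewrite (_ : ballint f ^~ t = fubini_F mu
  ((fun u : Rn * Rn => f u.2) \_ [set u | eball u.1 t u.2])); last first.
  apply/funext => x; rewrite ballintE /fubini_F.
  by apply: eq_integral => z _; exact: ball2E.
apply: measurable_fun_fubini_tonelli_F; first exact: mball2.
by move=> u; exact: erestrict_ge0.
Qed.

(** By Tonelli, the left-hand side integrates f(z) against the measure of the points y
of B(x,r) with z in B(y,t); such z lie in B(x,2r), and such y lie in B(z,t). *)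
Lemma integral_ballint_le x r t : (0 <= t)%R -> (t <= r)%R ->
  \int[mu]_(y in eball x r) ballint f y t <=
  ((2 * t) ^+ n)%:E * ballint f x (2 * r).
Proof.
move=> t0 tr; rewrite integral_mkcond.
pose h (u : Rn * Rn) :=
  ((fun u : Rn * Rn => f u.2) \_ [set u | eball u.1 t u.2]) \_
     [set u | eball x r u.1] u.
have h0 u : 0 <= h u by do 2 (apply: erestrict_ge0 => ? _).
have mh : measurable_fun setT h.
  apply/(measurable_restrictT _ _).1.
    rewrite -[X in measurable X]setTI.
    have := @measurable_fst _ _ Rn Rn.
    move=> /(_ measurableT _ (measurable_eball x r)); exact.
  by apply: measurable_funTS; exact: mball2.
rewrite (_ : \int[mu]_y _ = \int[mu]_y \int[mu]_z h (y, z)); last first.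
  apply: eq_integral => y _; rewrite [in LHS]/patch.
  case: ifPn => [|] xy.
    rewrite ballintE; apply: eq_integral => z _; rewrite ball2E /h.
    by rewrite [in RHS]/patch ifT// inE/=; rewrite inE in xy.
  rewrite integral0_eq// => z _; rewrite /h /patch ifF//.
  by apply/negbTE; apply: contra xy; rewrite !inE.
rewrite fubini_tonelli// ballintE -ge0_integralZl//; last 3 first.
- exact: measurable_restr_eball.
- by move=> y _; exact: erestrict_ge0.
- by rewrite lee_fin exprn_ge0// mulr_ge0.
apply: ge0_le_integralT => z; first by apply: integral_ge0 => y _.
apply: (@le_trans _ _ (\int[mu]_(y in eball z t) (f \_ (eball x (2 * r))) z)).
  rewrite [leRHS]integral_mkcond; apply: ge0_le_integralT => y //.
  rewrite /h /patch/=; case: ifPn => [|_]; last first.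
    by case: ifPn => // _; case: ifPn.
  rewrite inE/= => xy; case: ifPn; last by do 2 case: ifPn => //.
  rewrite inE/= => yz; rewrite !ifT// inE; last exact: eballC.
  by apply: eball_trans xy _; exact: sub_eball yz.
rewrite (integral_cst mu (measurable_eball z t)) muleC.
apply: lee_wpmul2r; first exact: erestrict_ge0.
exact: lebn_eball.
Qed.

End ballint.

Section ballint_le.
Context {R : realType} (n : nat).
Local Notation Rn := (n.-tuple R).
Local Notation mu := (@lebn R n).
Local Open Scope ereal_scope.

Lemma lebn_null_center (x : Rn) : (0 < n)%N ->
  exists N, [/\ measurable N, mu N = 0 &
    forall y, ~ N y -> (0 < enorm (esub x y))%R].
Proof.
move=> n0; exists [set y | (enorm (esub x y) <= 0)%R].
have mN : measurable [set y : Rn | (enorm (esub x y) <= 0)%R].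
  rewrite (_ : [set y | _] =
      xsection [set u : Rn * Rn | (enorm (esub u.1 u.2) <= 0)%R] x).
    apply: measurable_xsection; rewrite -[X in measurable X]setTI.
    exact: (measurable_enorm_esub measurableT (measurable_itv `]-oo, 0%R])).
  by apply/seteqP; split => y; rewrite /xsection/= inE.
split => // [|y /= /negP]; last by rewrite -ltNge.
apply/eqP; rewrite eq_le measure_ge0 andbT.
apply/lee_addgt0Pr => e e0; rewrite add0e.
pose t := (Num.min 2^-1 (e / 2))%R.
have t0 : (0 < t)%R by rewrite lt_min invr_gt0 ltr0n/= divr_gt0.
have t1 : (t <= 2^-1)%R by rewrite ge_min lexx.
have te : (t <= e / 2)%R by rewrite ge_min lexx orbT.
apply: (@le_trans _ _ (mu (eball x t))).
  apply: le_measure; rewrite ?inE//; first exact: measurable_eball.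
  by move=> y /= /le_lt_trans; apply.
apply: le_trans (lebn_eball x (ltW t0)) _; rewrite lee_fin.
rewrite -(prednK n0) exprS -[leRHS]mulr1.
apply: ler_pM; rewrite ?exprn_ge0 ?mulr_ge0 ?(ltW t0)//; [lra|apply: exprn_ile1; lra].
Qed.

Lemma ballint_le_cst (f : Rn -> \bar R) (c : R) x t : (0 <= c)%R -> (0 <= t)%R ->
  (forall y, 0 <= f y) -> measurable_fun setT f ->
  {ae mu, forall y, f y <= c%:E} ->
  ballint f x t <= (c * (2 * t) ^+ n)%:E.
Proof.
move=> c0 t0 f0 mf fc.
apply: (@le_trans _ _ (\int[mu]_(y in eball x t) c%:E)).
  apply: ae_ge0_le_integral => //; first exact: measurable_eball.
  - exact: measurable_funTS.
  - exact: filterS fc.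
rewrite (integral_cst mu (measurable_eball x t)) EFinM.
by apply: lee_wpmul2l; [rewrite lee_fin|exact: lebn_eball].
Qed.

Lemma ballint_affine (f g : Rn -> \bar R) (c k : R) x t :
  (0 <= c)%R -> (0 <= k)%R -> (0 <= t)%R ->
  (forall y, 0 <= f y) ->
  (forall y, 0 <= g y) -> measurable_fun setT g ->
  (forall y, f y <= c%:E + k%:E * g y) ->
  ballint f x t <= (c * (2 * t) ^+ n)%:E + k%:E * ballint g x t.
Proof.
move=> c0 k0 t0 f0 g0 mg fg.
have mB := measurable_eball x t.
apply: (@le_trans _ _ (\int[mu]_(y in eball x t) (c%:E + k%:E * g y))).
  exact: ge0_le_integral_on.
have mkg : measurable_fun (eball x t) (fun y => k%:E * g y).
  by apply: measurable_funTS; exact: measurable_funeM.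
rewrite ge0_integralD//; last first.
  by move=> y _; rewrite mule_ge0.
rewrite ge0_integralZl//; last exact: measurable_funTS.
apply: leeD => //.
rewrite (integral_cst mu mB) EFinM.
by apply: lee_wpmul2l; [rewrite lee_fin|exact: lebn_eball].
Qed.

End ballint_le.

(** * Dyadic scales and geometric series *)
Section series.
Context {R : realType}.
Implicit Types (r c z a rho : R) (j : nat).

Lemma nneseries_ge_term (u : nat -> \bar R) k : (forall j, 0 <= u j)%E ->
  (u k <= \sum_(j <oo) u j)%E.
Proof.
move=> u0; apply: (@le_trans _ _ (\sum_(0 <= j < k.+1) u j)%E).
  by rewrite big_nat_recr//= leeDr// sume_ge0.
exact: (@nneseries_lim_ge _ _ xpredT).
Qed.

Lemma nneseries_geometric c z : 0 <= z < 1 ->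
  (\sum_(j <oo) (c * z ^+ j)%:E = (c / (1 - z))%:E)%E.
Proof.
move=> /andP[z0 z1]; apply/cvg_lim => //.
rewrite (_ : (fun _ => _) = EFin \o series (geometric c z)); last first.
  by apply/funext => n; rewrite /= /series/= sumEFin.
apply: cvg_EFin; first exact: nearW.
by apply: cvg_geometric_series; rewrite ger0_norm.
Qed.

Lemma powR_exp (x a : R) j : 0 <= x -> (x ^+ j) `^ a = (x `^ a) ^+ j.
Proof. by move=> x0; rewrite -!powR_mulrn ?powR_ge0// powRAC. Qed.

Lemma powR_dn r a j : 0 < r -> (r / 2 ^+ j) `^ a = r `^ a * (2 `^ (- a)) ^+ j.
Proof.
move=> r0; rewrite -exprVn powRM ?exprn_ge0 ?ltW// powR_exp ?invr_ge0//.
by rewrite -(@powR_inv1 _ 2)// -powRrM mulN1r.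
Qed.

Lemma powR2_lt1 a : 0 < a -> 0 <= (2 : R) `^ (- a) < 1.
Proof.
move=> a0; rewrite powR_ge0/= powRN invf_lt1 ?powR_gt0//.
rewrite -[ltLHS](@powRr0 _ 2) /powR pnatr_eq0/= ltr_expR.
by rewrite mul0r mulr_gt0// ln_gt0// ltr1n.
Qed.

Lemma exp2_gt (x : R) : exists j, x < 2 ^+ j.
Proof.
exists (Num.bound `|x|); apply: (@le_lt_trans _ _ `|x|); first exact: ler_norm.
apply: (lt_trans (archi_boundP (normr_ge0 x))).
rewrite -[2]/(2%:R) -natrX ltr_nat; exact: ltn_expl.
Qed.

Lemma dyadic_dn rho r : 0 < rho -> rho < r ->
  exists j, r / 2 ^+ j.+1 <= rho < r / 2 ^+ j.
Proof.
move=> rho0 rhor.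
have ex : exists j, r / 2 ^+ j.+1 <= rho.
  have [j rj] := exp2_gt (r / rho); exists j.
  rewrite ler_pdivrMr ?exprn_gt0// mulrC -ler_pdivrMr// (le_trans (ltW rj))//.
  by rewrite ler_eXn2l ?ltr1n.
exists (ex_minn ex); case: ex_minnP => -[|m] -> h/=.
  by rewrite expr0 divr1.
by rewrite ltNge; apply/negP => /h; rewrite ltnn.
Qed.

Lemma dyadic_up rho r : 0 < r -> r <= rho ->
  exists j, r * 2 ^+ j <= rho < r * 2 ^+ j.+1.
Proof.
move=> r0 rrho.
have ex : exists j, rho < r * 2 ^+ j.+1.
  have [j rj] := exp2_gt (rho / r); exists j.
  rewrite mulrC -ltr_pdivrMr// (lt_le_trans rj)//.
  by rewrite ler_eXn2l ?ltr1n.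
exists (ex_minn ex); case: ex_minnP => -[|m] -> h/=; rewrite andbT.
  by rewrite expr0 mulr1.
by rewrite leNgt; apply/negP => /h; rewrite ltnn.
Qed.

End series.

(** * The damped Riesz kernel *)
Section weight.
Context {R : realType}.
Implicit Types (K t a rho : R).

Definition decay K t : R := (Num.max 1 t) `^ (- K).

Lemma ler_powRN a (x y : R) : 0 <= a -> 0 < x -> x <= y -> y `^ (- a) <= x `^ (- a).
Proof.
move=> a0 x0 xy; have y0 := lt_le_trans x0 xy.
rewrite !powRN lef_pV2 ?posrE ?powR_gt0//.
by apply: ge0_ler_powR; rewrite ?nnegrE ?(ltW x0) ?(ltW y0).
Qed.

Lemma decay_le_powR K t k : 0 < t -> 0 <= k <= K -> decay K t <= t `^ (- k).
Proof.
move=> t0 /andP[k0 kK]; rewrite /decay.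
apply: (@le_trans _ _ (Num.max 1 t `^ (- k))).
  by apply: ler_powR; rewrite ?lerN2// le_max lexx.
by apply: ler_powRN => //; rewrite le_max lexx orbT.
Qed.

Lemma decay_le1 K t : 0 <= K -> decay K t <= 1.
Proof.
by move=> K0; rewrite -[leRHS](@powRr0 _ (Num.max 1 t)); apply: ler_powR;
  rewrite ?le_max ?lexx// oppr_le0.
Qed.

Lemma decay_ni K t u : 0 <= K -> t <= u -> decay K u <= decay K t.
Proof.
move=> K0 tu; apply: ler_powRN => //; first by rewrite lt_max ltr01.
by rewrite ge_max !le_max lexx/= tu orbT.
Qed.

Lemma decay0 t : decay 0 t = 1. Proof. by rewrite /decay oppr0 powRr0. Qed.

Lemma decay_small K t : t <= 1 -> decay K t = 1.
Proof. by move=> t1; rewrite /decay (max_idPl t1) powR1. Qed.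

Lemma decay_large K t : 1 <= t -> decay K t = t `^ (- K).
Proof. by move=> t1; rewrite /decay (max_idPr t1). Qed.

(** The Riesz kernel |x|^(-a), damped at infinity by the factor max(1,|x|)^(-K).  As
[0 `^ (- a)] is [0], it vanishes at the origin instead of being infinite there,
which changes no integral. *)
Definition rkern a K rho : R := rho `^ (- a) * decay K rho.

Lemma rkern_ge0 a K rho : 0 <= rkern a K rho.
Proof. by rewrite mulr_ge0 ?powR_ge0. Qed.

Lemma measurable_rkern a K : measurable_fun setT (rkern a K).
Proof.
apply: measurable_funM; first exact: measurable_powR.
apply: (@measurableT_comp _ _ _ _ _ _ (fun t : R => t `^ (- K))).
  exact: measurable_powR.
exact: measurable_maxr.
Qed.

End weight.

(** * Dyadic decomposition of the potential *)
Section kernel_potential.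
Context {R : realType} (n : nat).
Local Notation Rn := (n.-tuple R).
Local Notation mu := (@lebn R n).
Local Open Scope ereal_scope.

Definition kpot (a K : R) (f : Rn -> \bar R) (x : Rn) : \bar R :=
  \int[mu]_y (f y * (rkern a K (enorm (esub x y)))%:E).

Definition near_sum (a : R) (f : Rn -> \bar R) (r : R) (y : Rn) : \bar R :=
  \sum_(j <oo) (((r / 2 ^+ j.+1) `^ (- a))%:E * ballint f y (r / 2 ^+ j)).

Definition far_sum (a K : R) (f : Rn -> \bar R) (r : R) (y : Rn) : \bar R :=
  \sum_(j <oo) (((r * 2 ^+ j) `^ (- a) * decay K (r * 2 ^+ j))%:E *
                ballint f y (r * 2 ^+ j.+1)).

Variables (a K : R) (a0 : (0 < a)%R) (K0 : (0 <= K)%R).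
Variables (f : Rn -> \bar R) (f0 : forall y, 0 <= f y).
Hypothesis mf : measurable_fun setT f.

Let gf0 (u : Rn * Rn) : 0 <= f u.2 * (rkern a K (enorm (esub u.1 u.2)))%:E.
Proof. by rewrite mule_ge0// lee_fin rkern_ge0. Qed.

Let mk : measurable_fun setT
  (fun u : Rn * Rn => (rkern a K (enorm (esub u.1 u.2)))%:E).
Proof.
apply/measurable_EFinP; apply: (measurableT_comp (measurable_rkern a K)).
exact: measurable_enorm_esub.
Qed.

Lemma kpot_ge0 x : 0 <= kpot a K f x.
Proof. by apply: integral_ge0 => y _; exact: (gf0 (x, y)). Qed.

Lemma measurable_kpot : measurable_fun setT (kpot a K f).
Proof.
apply: (@measurable_fun_fubini_tonelli_F _ _ _ _ _ mu
  (fun u => f u.2 * (rkern a K (enorm (esub u.1 u.2)))%:E)) => //.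
apply: emeasurable_funM => //.
exact: (measurableT_comp mf measurable_snd).
Qed.

Lemma kpotZ c x : (0 <= c)%R ->
  kpot a K (fun y => c%:E * f y) x = c%:E * kpot a K f x.
Proof.
move=> c0; rewrite /kpot.
under eq_integral => y _ do rewrite -muleA.
rewrite ge0_integralZl_EFin// => [y _|]; first exact: (gf0 (x, y)).
apply: emeasurable_funM => //.
exact: (measurableT_comp mk (pair1_measurable x)).
Qed.

Lemma near_sum_ge0 r y : 0 <= near_sum a f r y.
Proof.
by apply: nneseries_ge0 => j _ _; rewrite mule_ge0 ?ballint_ge0// lee_fin powR_ge0.
Qed.

Lemma integral_dyadic (c t : nat -> R) x : (forall j, (0 <= c j)%R) ->
  \sum_(j <oo) ((c j)%:E * ballint f x (t j)) =
  \int[mu]_y \sum_(j <oo) ((c j)%:E * (f \_ (eball x (t j))) y).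
Proof.
move=> c0; rewrite integral_nneseries//.
- apply: eq_eseriesr => j _; rewrite ge0_integralZl_EFin//.
  + by rewrite ballintE.
  + by move=> y _; exact: erestrict_ge0.
  + exact: measurable_restr_eball.
- by move=> j; apply: measurable_funeM; exact: measurable_restr_eball.
- by move=> j y _; rewrite mule_ge0// ?lee_fin// erestrict_ge0.
Qed.

Lemma measurable_dyadic (c t : nat -> R) : (forall j, (0 <= c j)%R) ->
  measurable_fun setT (fun x => \sum_(j <oo) ((c j)%:E * ballint f x (t j))).
Proof.
move=> c0; apply: ge0_emeasurable_sum => // j.
  by move=> x _ _; rewrite mule_ge0// ?lee_fin// ballint_ge0.
by move=> _; apply: measurable_funeM; exact: measurable_ballint.
Qed.

Lemma measurable_near_sum r : measurable_fun setT (near_sum a f r).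
Proof. by apply: measurable_dyadic => j; rewrite powR_ge0. Qed.

(** A single term of the two sums already bounds the kernel at distance rho from x:
the one for the dyadic interval that contains rho. *)
Lemma kpot_dyadic r x : (0 < n)%N -> (0 < r)%R ->
  kpot a K f x <= near_sum a f r x + far_sum a K f r x.
Proof.
move=> n0 r0; rewrite /near_sum /far_sum !integral_dyadic; last 2 first.
- by move=> j; rewrite mulr_ge0 ?powR_ge0.
- by move=> j; rewrite powR_ge0.
have c1 j y : 0 <= ((r / 2 ^+ j.+1) `^ (- a))%:E * (f \_ (eball x (r / 2 ^+ j))) y.
  by rewrite mule_ge0// ?lee_fin ?powR_ge0// erestrict_ge0.
have c2 j y : 0 <= ((r * 2 ^+ j) `^ (- a) * decay K (r * 2 ^+ j))%:E *
                      (f \_ (eball x (r * 2 ^+ j.+1))) y.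
  by rewrite mule_ge0// ?lee_fin ?mulr_ge0 ?powR_ge0// erestrict_ge0.
rewrite -ge0_integralD//; first last.
- apply: ge0_emeasurable_sum => // j _.
  by apply: measurable_funeM; exact: measurable_restr_eball.
- by move=> y _; exact: nneseries_ge0.
- apply: ge0_emeasurable_sum => // j _.
  by apply: measurable_funeM; exact: measurable_restr_eball.
- by move=> y _; exact: nneseries_ge0.
have [N [mN N0 Npos]] := lebn_null_center x n0.
apply: (le_integral_off_null _ _ mN N0) => [y|y|y /Npos].
- exact: (gf0 (x, y)).
- by rewrite adde_ge0// nneseries_ge0.
set rho := enorm _ => rho0.
have [rr|rr] := ltP rho r.
  have [j /andP[j1 j2]] := dyadic_dn rho0 rr.
  apply: (@le_trans _ _ (\sum_(j <oo) (((r / 2 ^+ j.+1) `^ (- a))%:E *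
      (f \_ (eball x (r / 2 ^+ j))) y))); last by rewrite leeDl// nneseries_ge0.
  apply: le_trans (nneseries_ge_term j _) => //.
  rewrite [X in _ <= _ * X]/patch ifT ?inE// muleC; apply: lee_wpmul2r => //.
  rewrite lee_fin /rkern -[leRHS]mulr1; apply: ler_pM; rewrite ?powR_ge0//.
    by apply: ler_powRN; rewrite ?(ltW a0)// divr_gt0// exprn_gt0.
  exact: decay_le1.
have [j /andP[j1 j2]] := dyadic_up r0 rr.
apply: (@le_trans _ _ (\sum_(j <oo) (((r * 2 ^+ j) `^ (- a) * decay K (r * 2 ^+ j))%:E *
      (f \_ (eball x (r * 2 ^+ j.+1))) y))); last by rewrite leeDr// nneseries_ge0.
apply: le_trans (nneseries_ge_term j _) => //.
rewrite [X in _ <= _ * X]/patch ifT ?inE// muleC; apply: lee_wpmul2r => //.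
rewrite lee_fin /rkern; apply: ler_pM; rewrite ?powR_ge0//.
  by apply: ler_powRN; rewrite ?(ltW a0)// mulr_gt0// exprn_gt0.
exact: decay_ni.
Qed.

End kernel_potential.

(** * Means of near sums *)
Section ereal_powers.
Context {R : realType}.
Local Open Scope ereal_scope.
Implicit Types (x y : \bar R) (q : R).

Lemma lee_poweR q x y : (0 <= q)%R -> 0 <= x -> x <= y -> x `^ q <= y `^ q.
Proof.
move=> q0 x0 xy; apply: gt0_ler_poweR => //; rewrite in_itv/= ?leey ?andbT//.
exact: le_trans xy.
Qed.

Lemma poweRK q x : (q != 0)%R -> 0 <= x -> (x `^ q) `^ q^-1 = x.
Proof. by move=> q0 x0; rewrite -poweRrM divff// poweRe1. Qed.

Lemma poweRVK q x : (q != 0)%R -> 0 <= x -> (x `^ q^-1) `^ q = x.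
Proof. by move=> q0 x0; rewrite -poweRrM mulVf// poweRe1. Qed.

(** A substitute for Minkowski's inequality, valid for every q > 0: each u_j is at most
the q-th root of the sum of the u_i^q, and the weights z^j are summable. *)
Lemma poweR_geometric_series (q z : R) (u : nat -> \bar R) :
  (0 < q)%R -> (0 <= z < 1)%R -> (forall j, 0 <= u j) ->
  (\sum_(j <oo) ((z ^+ j)%:E * u j)) `^ q <=
  (((1 - z)^-1) `^ q)%:E * \sum_(j <oo) (u j `^ q).
Proof.
move=> q0 z01 u0; set S := \sum_(j <oo) (u j `^ q).
have S0 : 0 <= S by apply: nneseries_ge0 => j _ _; exact: poweR_ge0.
have z1 : (0 < (1 - z)^-1)%R by rewrite invr_gt0 subr_gt0; case/andP: z01.
have zj0 j : (0 <= z ^+ j)%R by rewrite exprn_ge0//; case/andP: z01.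
have uS j : u j <= S `^ q^-1.
  rewrite -(@poweRK q (u j)) ?gt_eqF//; apply: lee_poweR => //.
  - by rewrite invr_ge0 ltW.
  - exact: poweR_ge0.
  - by apply: (@nneseries_ge_term _ (fun j => u j `^ q)) => i; exact: poweR_ge0.
rewrite -poweR_EFin -[X in _ <= _ * X](@poweRVK q) ?gt_eqF//.
rewrite -poweRM ?lee_fin ?poweR_ge0 ?(ltW z1)//.
apply: lee_poweR; first exact: ltW.
  by apply: nneseries_ge0 => j _ _; rewrite mule_ge0// lee_fin.
move: uS; set s := S `^ q^-1; have : 0 <= s by exact: poweR_ge0.
case: s => [s s0 us|_ _|//]; last by rewrite gt0_muley ?lte_fin// leey.
apply: (@le_trans _ _ (\sum_(j <oo) (s * z ^+ j)%:E)).
  apply: lee_nneseries => j _; first by move=> _; rewrite mule_ge0// lee_fin.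
  by rewrite mulrC EFinM; apply: lee_wpmul2l => //; rewrite lee_fin.
by rewrite nneseries_geometric// mulrC.
Qed.

Lemma powR_expR (x a : R) : (0 < x)%R -> (x `^ a = expR (a * ln x))%R.
Proof. by move=> x0; rewrite /powR gt_eqF. Qed.

Lemma exprn_expR (x : R) k : (0 < x)%R -> (x ^+ k = expR (k%:R * ln x))%R.
Proof. by move=> x0; rewrite -powR_mulrn ?(ltW x0)// powR_expR. Qed.

End ereal_powers.

Section near.
Context {R : realType} (n : nat).
Local Notation Rn := (n.-tuple R).
Local Notation mu := (@lebn R n).
Local Open Scope ereal_scope.
Variables (a q : R) (q0 : (0 < q)%R).

(** The q-th power of the near sum is bounded termwise at the price of a small
geometric factor z^j.  In F(y,t)^q, q - 1 factors are estimated by the mass of the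
large ball B(x,2r), and the remaining one is averaged in y by
[integral_ballint_le]. *)
Lemma near_sum_Lq_ge1 : (1 <= q)%R -> (q * a < n%:R)%R ->
  exists2 C : R, (0 < C)%R & forall (f : Rn -> \bar R) (x : Rn) (r : R),
  (forall y, 0 <= f y) -> measurable_fun setT f -> (0 < r)%R ->
  \int[mu]_(y in eball x r) (near_sum a f r y `^ q) <=
  (C * r ^+ n * (r `^ (- a)) `^ q)%:E * ballint f x (2 * r) `^ q.
Proof.
move=> q1 qan.
(* q * a < n leaves room for the factors z^-j: with this e the j-th term decays
   like 2^(- e q j) *)
pose e : R := ((n%:R - q * a) / (2 * q))%R.
have e0 : (0 < e)%R by rewrite divr_gt0 ?subr_gt0 ?mulr_gt0.
have z01 := powR2_lt1 e0; set z := (2 `^ (- e))%R in z01.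
have z0 : (0 < z)%R by exact: powR_gt0.
have eq2 : (n%:R - (a + e) * q = e * q)%R.
  by rewrite /e; field; rewrite gt_eqF.
have w01 := @powR2_lt1 R (e * q) (mulr_gt0 e0 q0).
set w := (2 `^ (- (e * q)))%R in w01.
have w1 : (0 < (1 - w)^-1)%R by rewrite invr_gt0 subr_gt0; case/andP: w01.
have z1 : (0 < (1 - z)^-1)%R by rewrite invr_gt0 subr_gt0; case/andP: z01.
exists (((1 - z)^-1) `^ q * ((2 `^ a) `^ q * 2 ^+ n / (1 - w)))%R.
  by rewrite !mulr_gt0 ?exprn_gt0 ?powR_gt0.
move=> f x r f0 mf r0.
have : 0 <= ballint f x (2 * r) by exact: ballint_ge0.
case Ephi : (ballint f x (2 * r)) => [phi| |] phi0 //; last first.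
  rewrite poweRyr ?gt_eqF// gt0_muley ?leey// lte_fin.
  by rewrite !mulr_gt0 ?exprn_gt0 ?powR_gt0 ?mulr_gt0 ?exprn_gt0 ?powR_gt0.
rewrite lee_fin in phi0.
pose k j : R := (r `^ (- a) * 2 `^ a * (2 `^ (a + e)) ^+ j)%R.
have k0 j : (0 <= k j)%R by rewrite !mulr_ge0 ?exprn_ge0 ?powR_ge0.
have ckz j : ((r / 2 ^+ j.+1) `^ (- a) = z ^+ j * k j)%R.
  have z2 : ((2 `^ a) ^+ j = z ^+ j * (2 `^ (a + e)) ^+ j :> R)%R.
    by rewrite -exprMn /z -powRD ?pnatr_eq0 ?implybT//; congr (_ `^ _ ^+ _)%R; lra.
  by rewrite powR_dn// opprK /k exprS z2; ring.
have Fphi y j : eball x r y -> ballint f y (r / 2 ^+ j) <= phi%:E.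
  move=> xy; rewrite -Ephi; apply: le_ballint => // u yu.
  apply: eball_trans xy _; apply: sub_eball yu.
  by rewrite ler_pdivrMr ?exprn_gt0// ler_peMr ?(ltW r0)// exprn_ege1// ler1n.
pose h y := \sum_(j <oo) ((((1 - z)^-1) `^ q * (k j `^ q * phi `^ (q - 1)))%:E *
  ballint f y (r / 2 ^+ j)).
have c0 j : (0 <= ((1 - z)^-1) `^ q * (k j `^ q * phi `^ (q - 1)))%R.
  by rewrite !mulr_ge0 ?powR_ge0.
apply: (@le_trans _ _ (\int[mu]_(y in eball x r) h y)).
  apply: ge0_le_integral_on => y xy; first exact: poweR_ge0.
  rewrite /near_sum.
  under eq_eseriesr => j _ do rewrite ckz EFinM -muleA.
  apply: le_trans (poweR_geometric_series q0 z01 _) _.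
    by move=> j; rewrite mule_ge0 ?lee_fin ?ballint_ge0.
  rewrite /h; under [leRHS]eq_eseriesr => j _ do rewrite EFinM -muleA.
  rewrite nneseriesZl; last first.
    by move=> j _; rewrite mule_ge0 ?ballint_ge0// lee_fin mulr_ge0 ?powR_ge0.
  apply: lee_wpmul2l; first by rewrite lee_fin powR_ge0.
  apply: lee_nneseries => j _; first by move=> _; exact: poweR_ge0.
  have := Fphi y j xy; have := ballint_ge0 f0 y (r / 2 ^+ j).
  case: (ballint f y _) => [psi psi0 psile| |] //.
  rewrite lee_fin in psi0; rewrite lee_fin in psile.
  rewrite -EFinM poweR_EFin lee_fin powRM// -[leRHS]mulrA.
  apply: ler_wpM2l; first exact: powR_ge0.
  rewrite -(mulr_powRB1 psi0 q0) mulrC; apply: ler_wpM2r => //.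
  by apply: ge0_ler_powR; rewrite ?subr_ge0 ?nnegrE.
have mh j : measurable_fun (eball x r) (fun y => ballint f y (r / 2 ^+ j)).
  by apply: measurable_funTS; exact: measurable_ballint.
rewrite /h integral_nneseries//; last 3 first.
- exact: measurable_eball.
- by move=> j; apply: measurable_funeM.
- by move=> j y _; rewrite mule_ge0 ?lee_fin ?ballint_ge0.
have -> : (((1 - z)^-1) `^ q * ((2 `^ a) `^ q * 2 ^+ n / (1 - w)) * r ^+ n *
   (r `^ (- a)) `^ q)%:E * phi%:E `^ q = \sum_(j <oo)
   (((1 - z)^-1) `^ q * (2 `^ a) `^ q * (2 * r) ^+ n * (r `^ (- a)) `^ q *
    phi `^ q * w ^+ j)%:E.
  rewrite nneseries_geometric// poweR_EFin -EFinM; congr EFin.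
  by rewrite exprMn; ring.
apply: lee_nneseries => j _.
  by move=> _; apply: integral_ge0 => y _; rewrite mule_ge0 ?lee_fin ?ballint_ge0.
rewrite ge0_integralZl_EFin//; last 2 first.
- exact: measurable_eball.
- by move=> y _; exact: ballint_ge0.
apply: (@le_trans _ _ ((((1 - z)^-1) `^ q * (k j `^ q * phi `^ (q - 1)))%:E *
   (((2 * (r / 2 ^+ j)) ^+ n)%:E * phi%:E))).
  apply: lee_wpmul2l; first by rewrite lee_fin.
  rewrite -Ephi; apply: integral_ballint_le => //.
    by rewrite divr_ge0 ?exprn_ge0 ?ltW.
  by rewrite ler_pdivrMr ?exprn_gt0// ler_peMr ?(ltW r0)// exprn_ege1// ler1n.
rewrite -!EFinM lee_fin -(mulr_powRB1 phi0 q0) le_eqVlt; apply/orP; left; apply/eqP.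
have -> : (w ^+ j = ((2 `^ (a + e)) ^+ j) `^ q * ((2 ^+ j)^-1) ^+ n)%R.
  rewrite powR_exp ?powR_ge0// -powRrM.
  have -> : ((2 ^+ j)^-1 ^+ n = (2 `^ (- n%:R)) ^+ j :> R)%R.
    by rewrite powRN powR_mulrn// !exprVn -!exprM mulnC.
  rewrite -exprMn -powRD ?pnatr_eq0 ?implybT//; congr (_ `^ _ ^+ _)%R.
  by rewrite -eq2; lra.
rewrite /k !powRM ?mulr_ge0 ?exprn_ge0 ?powR_ge0// !exprMn; ring.
Qed.

End near.

Section near_lt1.
Context {R : realType} (n : nat).
Local Notation Rn := (n.-tuple R).
Local Notation mu := (@lebn R n).
Local Open Scope ereal_scope.

(** Distinguish whether L <= Lam.  This reduces means with an exponent below 1 to the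
exponent 1. *)
Lemma poweR_le_affine (q Lam : R) (L : \bar R) : (0 < q <= 1)%R -> (0 < Lam)%R ->
  0 <= L -> L `^ q <= (Lam `^ q)%:E + (Lam `^ (q - 1))%:E * L.
Proof.
move=> /andP[q0 q1] Lam0; case: L => [L L0|_|//]; last first.
  rewrite gt0_muley ?lte_fin ?powR_gt0// addey ?leey//.
rewrite lee_fin in L0.
rewrite poweR_EFin -EFinM -EFinD lee_fin.
have [LL|LL] := leP L Lam.
  apply: (@le_trans _ _ (Lam `^ q)%R).
    by apply: ge0_ler_powR; rewrite ?nnegrE ?(ltW q0) ?(ltW Lam0).
  by rewrite lerDl mulr_ge0 ?powR_ge0.
rewrite -(mulr_powRB1 L0 q0) mulrC.
apply: (@le_trans _ _ (Lam `^ (q - 1) * L)%R); last by rewrite lerDr powR_ge0.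
apply: ler_wpM2r => //.
by rewrite -opprB; apply: ler_powRN; rewrite ?subr_ge0// ltW.
Qed.

(** The local q-integrability of the kernel |x|^(-a), in quantitative form: the mean of
the near sum over a ball is controlled by the mass of the double ball. *)
Lemma near_sum_Lq (a q : R) : (0 < a)%R -> (0 < q)%R ->
  (a < n%:R)%R -> (q * a < n%:R)%R ->
  exists2 C : R, (0 < C)%R & forall (f : Rn -> \bar R) (x : Rn) (r : R),
  (forall y, 0 <= f y) -> measurable_fun setT f -> (0 < r)%R ->
  \int[mu]_(y in eball x r) (near_sum a f r y `^ q) <=
  (C * r ^+ n * (r `^ (- a)) `^ q)%:E * ballint f x (2 * r) `^ q.
Proof.
move=> a0 q0 an qan; have [q1|q1] := leP 1%R q; first exact: near_sum_Lq_ge1.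
have [|C C0 H] := @near_sum_Lq_ge1 R n a 1 ltr01 (lexx _).
  by rewrite mul1r.
exists (2 ^+ n + C)%R; first by rewrite addr_gt0 ?exprn_gt0.
move=> f x r f0 mf r0.
have mL : measurable_fun (eball x r) (near_sum a f r).
  by apply: measurable_funTS; exact: measurable_near_sum.
have L0 y : 0 <= near_sum a f r y by exact: near_sum_ge0.
have H1 : \int[mu]_(y in eball x r) near_sum a f r y <=
    (C * r ^+ n * r `^ (- a))%:E * ballint f x (2 * r).
  have := H f x r f0 mf r0; rewrite poweRe1 ?ballint_ge0// powRr1 ?powR_ge0//.
  by under eq_integral => y _ do rewrite poweRe1 ?near_sum_ge0//.
have : 0 <= ballint f x (2 * r) by exact: ballint_ge0.
case Ephi : (ballint f x (2 * r)) => [phi| |] phi0 //; last first.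
  rewrite poweRyr ?gt_eqF// gt0_muley ?leey// lte_fin.
  by rewrite !mulr_gt0 ?addr_gt0 ?exprn_gt0 ?powR_gt0.
rewrite lee_fin le_eqVlt in phi0; case/predU1P : phi0 => [phi0|phi0].
  rewrite -phi0 poweR0r ?gt_eqF// mule0 integral0_eq// => y xy.
  rewrite /near_sum eseries0 ?poweR0r ?gt_eqF// => j _ _.
  rewrite (_ : ballint f y _ = 0) ?mule0//.
  apply/eqP; rewrite eq_le ballint_ge0// andbT.
  have -> : 0 = phi%:E :> \bar R by rewrite -phi0.
  rewrite -Ephi.
  apply: le_ballint => // u yu.
  apply: eball_trans xy _; apply: sub_eball yu.
  by rewrite ler_pdivrMr ?exprn_gt0// ler_peMr ?(ltW r0)// exprn_ege1// ler1n.
(* the size that the q-th power mean is expected to have *)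
pose Lam := (r `^ (- a) * phi)%R.
have Lam0 : (0 < Lam)%R by rewrite mulr_gt0 ?powR_gt0.
apply: (@le_trans _ _ (\int[mu]_(y in eball x r)
   ((Lam `^ q)%:E + (Lam `^ (q - 1))%:E * near_sum a f r y))).
  apply: ge0_le_integral_on => y _; first exact: poweR_ge0.
  by apply: poweR_le_affine => //; rewrite q0 ltW.
have mB := measurable_eball x r.
rewrite ge0_integralD//; last 3 first.
- by move=> y _; rewrite lee_fin powR_ge0.
- by move=> y _; rewrite mule_ge0 ?lee_fin ?powR_ge0.
- exact: measurable_funeM.
rewrite ge0_integralZl_EFin ?powR_ge0//.
rewrite (integral_cst mu mB).
apply: (@le_trans _ _ ((Lam `^ q)%:E * ((2 * r) ^+ n)%:E +
   (Lam `^ (q - 1))%:E * ((C * r ^+ n * r `^ (- a))%:E * phi%:E))).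
  apply: leeD; apply: lee_wpmul2l; rewrite ?lee_fin ?powR_ge0//.
    exact: lebn_eball (ltW r0).
  by rewrite -Ephi.
rewrite poweR_EFin -!EFinM -EFinD lee_fin le_eqVlt; apply/orP; left; apply/eqP.

have -> : (Lam `^ (q - 1) * (C * r ^+ n * r `^ (- a) * phi) = C * r ^+ n * Lam `^ q)%R.
  by rewrite -(mulr_powRB1 (ltW Lam0) q0) /Lam; ring.
have -> : ((2 ^+ n + C) * r ^+ n * (r `^ (- a)) `^ q * phi `^ q =
    (2 ^+ n + C) * r ^+ n * Lam `^ q)%R.
  by rewrite /Lam powRM ?powR_ge0 ?(ltW phi0)//; ring.
by rewrite exprMn; ring.
Qed.

End near_lt1.

(** * Identities between products of powers *)
Section exponentials.
Context {R : realType}.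
Implicit Types x y a : R.

Lemma expR_powR x a : (expR x) `^ a = expR (a * x).
Proof. by rewrite powR_expR ?expR_gt0// expRK. Qed.

Lemma expR_exprn x k : (expR x) ^+ k = expR (k%:R * x).
Proof. by rewrite exprn_expR ?expR_gt0// expRK. Qed.

Lemma expR_inv x : (expR x)^-1 = expR (- x).
Proof. by rewrite expRN. Qed.

Lemma expR_mul x y : expR x * expR y = expR (x + y).
Proof. by rewrite expRD. Qed.

(** Once every positive number is written as an exponential, these rules turn an
identity between products of powers into a linear identity between exponents, within
the reach of [ring] and [field]. *)
Definition expE := (expR_powR, expR_exprn, expR_inv, expR_mul).

Lemma pos_expR x : 0 < x -> exists y, x = expR y.
Proof. by move=> x0; exists (ln x); rewrite lnK. Qed.

End exponentials.

(** * Growth of the integral of the q-th power of a potential *)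
Section engine.
Context {R : realType} (n : nat).
Local Notation Rn := (n.-tuple R).
Local Notation mu := (@lebn R n).
Local Open Scope ereal_scope.

Lemma poweR_add_le (q : R) (x y : \bar R) : (0 < q)%R -> 0 <= x -> 0 <= y ->
  (x + y) `^ q <= (2 `^ q)%:E * (x `^ q + y `^ q).
Proof.
move=> q0; wlog xy : x y / x <= y => [H x0 y0|x0 y0].
  have [xy|/ltW yx] := leP x y; first exact: H.
  by rewrite addeC [X in _ * X]addeC; exact: H.
apply: (@le_trans _ _ ((2%:E * y) `^ q)).
  apply: lee_poweR; [exact: ltW|exact: adde_ge0|].
  by rewrite mule_natl mule2n leeD2r.
rewrite poweRM// poweR_EFin; apply: lee_wpmul2l; first by rewrite lee_fin powR_ge0.
by rewrite leeDr// poweR_ge0.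
Qed.

Variables (al K q : R) (n0 : (0 < n)%N).
Hypotheses (al0 : (0 < al)%R) (aln : (al < n%:R)%R) (K0 : (0 <= K)%R) (q0 : (0 < q)%R).
Let a := (n%:R - al)%R.
Let a0 : (0 < a)%R. Proof. by rewrite subr_gt0. Qed.

(** In terms of N = M delta^(n/s), the factor M (delta/t)^e interpolates between M
(for e = 0) and N t^(-n/s) (for e = n/s). *)
Definition mass_bound (C1 M delta e : R) (f : Rn -> \bar R) (x : Rn) :=
  forall t, (0 < t)%R ->
  ballint f x t <= (C1 * t ^+ n * (M * (delta / t) `^ e))%:E.

Definition near_bound (C2 M delta e : R) (f : Rn -> \bar R) (x : Rn) :=
  forall t, (0 < t)%R ->
  \int[mu]_(y in eball x t) (near_sum a f t y `^ q) <=
  (C2 * t ^+ n * (t `^ al * (M * (delta / t) `^ e)) `^ q)%:E.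

(** The damping is used through max(1,t)^(-K) <= t^(-k); the far sum is then a
geometric series of ratio 2^(alpha - k - e). *)
Let far_bound (e k C1 : R) : (0 <= k <= K)%R -> (al < k + e)%R -> (0 < C1)%R ->
  exists2 C : R, (0 < C)%R &
  forall (f : Rn -> \bar R) (x : Rn) (M delta : R),
  (forall y, 0 <= f y) -> measurable_fun setT f -> (0 < M)%R -> (0 < delta)%R ->
  mass_bound C1 M delta e f x ->
  forall r y, (0 < r)%R -> eball x r y -> far_sum a K f r y <=
    (C * (r `^ al * (M * (delta / r) `^ e) * r `^ (- k)))%:E.
Proof.
move=> /andP[k0 kK] alke C10.
have z01 := @powR2_lt1 R (k + e - al)%R _; have {}z01 := z01 _.
have /z01 {}z01 : (0 < k + e - al)%R by rewrite subr_gt0.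
set z := (2 `^ _)%R in z01.
have z1 : (0 < (1 - z)^-1)%R by rewrite invr_gt0 subr_gt0; case/andP: z01.
exists (C1 * 4 ^+ n * 4 `^ (- e) / (1 - z))%R.
  by rewrite !mulr_gt0 ?exprn_gt0 ?powR_gt0.
move=> f x M delta f0 mf M0 d0 H1 r y r0 xy.
rewrite /far_sum.
have -> : (C1 * 4 ^+ n * 4 `^ (- e) / (1 - z) *
      (r `^ al * (M * (delta / r) `^ e) * r `^ (- k)))%:E =
    \sum_(j <oo) ((C1 * 4 ^+ n * 4 `^ (- e) *
      (r `^ al * (M * (delta / r) `^ e) * r `^ (- k))) * z ^+ j)%:E.
  by rewrite nneseries_geometric//; congr EFin; ring.
apply: lee_nneseries => j _.
  by move=> _; rewrite mule_ge0 ?ballint_ge0// lee_fin mulr_ge0 ?powR_ge0.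
have rj0 : (0 < r * 2 ^+ j)%R by rewrite mulr_gt0 ?exprn_gt0.
have rj : (0 < r * 2 ^+ j.+2)%R by rewrite mulr_gt0 ?exprn_gt0.
apply: (@le_trans _ _ (((r * 2 ^+ j) `^ (- a) * (r * 2 ^+ j) `^ (- k))%:E *
   (C1 * (r * 2 ^+ j.+2) ^+ n * (M * (delta / (r * 2 ^+ j.+2)) `^ e))%:E)).
  apply: lee_pmul.
  - by rewrite lee_fin mulr_ge0 ?powR_ge0.
  - exact: ballint_ge0.
  - rewrite lee_fin; apply: ler_wpM2l; first exact: powR_ge0.
    by apply: decay_le_powR => //; rewrite k0.
  - apply: le_trans (H1 _ rj); apply: le_ballint => // u yu.
    rewrite exprS mulrCA; apply: eball_trans yu; apply: sub_eball xy.
    by rewrite ler_peMr ?(ltW r0)// exprn_ege1// ler1n.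
rewrite -EFinM lee_fin le_eqVlt; apply/orP; left; apply/eqP.
have [lr er] := pos_expR r0; have [ld ed] := pos_expR d0.
have [lc ec] := pos_expR C10; have [lm em] := pos_expR M0.
have [l2 e2] := @pos_expR R 2 ltac:(done).
have -> : (4 = 2 ^+ 2 :> R)%R by rewrite expr2 -natrM.
rewrite /z ec em er ed e2 !expE; congr expR; rewrite /a -!natr1; ring.
Qed.

(** On B(x,r) the far sum is a constant, and the near sum is bounded in the mean by
hypothesis.  The term r^(-k) pays for the convergence of the far sum when e <= alpha,
and k = 0 is allowed when e > alpha. *)
Lemma ball_bound (e k C1 C2 : R) : (0 <= k <= K)%R -> (al < k + e)%R ->
  (0 < C1)%R -> (0 < C2)%R ->
  exists2 C : R, (0 < C)%R &
  forall (f : Rn -> \bar R) (x : Rn) (M delta : R),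
  (forall y, 0 <= f y) -> measurable_fun setT f -> (0 < M)%R -> (0 < delta)%R ->
  mass_bound C1 M delta e f x -> near_bound C2 M delta e f x ->
  forall r, (0 < r)%R -> ballint (fun y => kpot a K f y `^ q) x r <=
   (C * r ^+ n * (r `^ al * (M * (delta / r) `^ e) * (1 + r `^ (- k))) `^ q)%:E.
Proof.
move=> kK alke C10 C20; have [C3 C30 H3] := far_bound kK alke C10.
exists (2 `^ q * (C2 + 2 ^+ n * C3 `^ q))%R.
  by rewrite mulr_gt0 ?powR_gt0// addr_gt0// mulr_gt0 ?powR_gt0 ?exprn_gt0.
move=> f x M delta f0 mf M0 d0 H1 H2 r r0; rewrite /ballint.
set X := (r `^ al * (M * (delta / r) `^ e))%R.
have X0 : (0 < X)%R by rewrite !mulr_gt0 ?powR_gt0// divr_gt0.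
set T := (C3 * (X * r `^ (- k)))%R.
have T0 : (0 <= T)%R.
  by apply: mulr_ge0; [exact: ltW|apply: mulr_ge0; [exact: ltW|exact: powR_ge0]].
have mB := measurable_eball x r.
have mL : measurable_fun (eball x r) (fun y => near_sum a f r y `^ q).
  apply: measurable_funTS; apply: (measurableT_comp (measurable_poweR q)).
  exact: measurable_near_sum.
apply: (@le_trans _ _ (\int[mu]_(y in eball x r)
   ((2 `^ q)%:E * (near_sum a f r y `^ q + (T `^ q)%:E)))).
  apply: ge0_le_integral_on => y xy; first exact: poweR_ge0.
  have kp0 : 0 <= kpot a K f y by exact: kpot_ge0.
  have ns0 : 0 <= near_sum a f r y by exact: near_sum_ge0.
  apply: (@le_trans _ _ ((near_sum a f r y + T%:E) `^ q)).
    apply: lee_poweR => //; first exact: ltW.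
    apply: le_trans (kpot_dyadic a0 K0 f0 mf y n0 r0) _.
    by rewrite leeD2l//; apply: (H3 _ _ _ _ f0 mf M0 d0 H1).
  by apply: le_trans (poweR_add_le q0 ns0 _) _; rewrite ?lee_fin// poweR_EFin.
rewrite ge0_integralZl_EFin ?powR_ge0//; last 2 first.
- by move=> y _; rewrite adde_ge0 ?poweR_ge0 ?lee_fin ?powR_ge0.
- exact: emeasurable_funD.
rewrite ge0_integralD//; last 2 first.
- by move=> y _; exact: poweR_ge0.
- by move=> y _; rewrite lee_fin powR_ge0.
rewrite (integral_cst mu mB).
apply: (@le_trans _ _ ((2 `^ q)%:E * ((C2 * r ^+ n * X `^ q)%:E +
    (T `^ q)%:E * ((2 * r) ^+ n)%:E))).
  apply: lee_wpmul2l; first by rewrite lee_fin powR_ge0.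
  apply: leeD; first exact: H2.
  by apply: lee_wpmul2l; rewrite ?lee_fin ?powR_ge0//; apply: lebn_eball; exact: ltW.
rewrite -(EFinM (T `^ q)%R) -EFinD -EFinM lee_fin.
rewrite -[leRHS]mulrA -[leRHS]mulrA; apply: ler_wpM2l; first exact: powR_ge0.
have rk0 : (0 <= r `^ (- k))%R by exact: powR_ge0.
have h1 : (X `^ q <= (X * (1 + r `^ (- k))) `^ q)%R.
  apply: ge0_ler_powR; rewrite ?nnegrE ?(ltW q0) ?(ltW X0)//.
    by rewrite mulr_ge0 ?addr_ge0 ?(ltW X0).
  by rewrite ler_peMr ?(ltW X0)// lerDl.
have h2 : (T `^ q <= C3 `^ q * (X * (1 + r `^ (- k))) `^ q)%R.
  rewrite /T powRM ?(ltW C30)//; last by rewrite mulr_ge0 ?(ltW X0).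
  apply: ler_wpM2l; first exact: powR_ge0.
  apply: ge0_ler_powR; rewrite ?nnegrE ?(ltW q0)//.
  - by rewrite mulr_ge0 ?(ltW X0).
  - by rewrite mulr_ge0 ?addr_ge0 ?(ltW X0).
  - by rewrite ler_wpM2l ?(ltW X0)// lerDr.
have rn : (0 <= r ^+ n)%R by rewrite exprn_ge0 ?ltW.
set Y := ((X * (1 + _)) `^ q)%R in h1 h2 *; move: Y h1 h2 => Y h1 h2.
rewrite [leRHS]mulrDl; apply: lerD.
  by rewrite -mulrA; apply: ler_wpM2l; [exact: ltW|apply: ler_wpM2l].
rewrite exprMn mulrC -!mulrA; apply: ler_wpM2l; first by rewrite exprn_ge0.
by rewrite mulrCA; apply: ler_wpM2l.
Qed.

(** The outer potential at x, over the scales below r0: if the integral of h over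
B(x,r) grows like r^(n+g), the annulus of radius r contributes r^(alpha+g). *)
Lemma outer_small (g : R) : (0 < al + g)%R ->
  exists2 C : R, (0 < C)%R &
  forall (h : Rn -> \bar R) (x : Rn) (B r0 : R),
  (forall y, 0 <= h y) -> (0 < B)%R -> (0 < r0)%R ->
  (forall r, (0 < r <= r0)%R -> ballint h x r <= (B * r ^+ n * r `^ g)%:E) ->
  near_sum a h r0 x <= (C * B * r0 `^ (al + g))%:E.
Proof.
move=> ag0; have z01 := powR2_lt1 ag0; set z := (2 `^ _)%R in z01.
have z1 : (0 < (1 - z)^-1)%R by rewrite invr_gt0 subr_gt0; case/andP: z01.
exists (2 `^ a / (1 - z))%R; first by rewrite mulr_gt0 ?powR_gt0.
move=> h x B r h0 B0 r0 H.
have -> : (2 `^ a / (1 - z) * B * r `^ (al + g))%:E =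
   \sum_(j <oo) ((2 `^ a * B * r `^ (al + g)) * z ^+ j)%:E.
  by rewrite nneseries_geometric//; congr EFin; ring.
apply: lee_nneseries => j _.
  by move=> _; rewrite mule_ge0 ?ballint_ge0// lee_fin powR_ge0.
have rj : (0 < r / 2 ^+ j <= r)%R.
  rewrite divr_gt0 ?exprn_gt0//= ler_pdivrMr ?exprn_gt0//.
  by rewrite ler_peMr ?(ltW r0)// exprn_ege1// ler1n.
apply: (@le_trans _ _ (((r / 2 ^+ j.+1) `^ (- a))%:E *
   (B * (r / 2 ^+ j) ^+ n * (r / 2 ^+ j) `^ g)%:E)).
  by apply: lee_wpmul2l; [rewrite lee_fin powR_ge0|exact: H].
rewrite -EFinM lee_fin le_eqVlt; apply/orP; left; apply/eqP.
have [lr er] := pos_expR r0; have [lb eb] := pos_expR B0.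
have [l2 e2] := @pos_expR R 2 ltac:(done).
rewrite /z eb er e2 !expE; congr expR; rewrite /a -!natr1; ring.
Qed.

Lemma outer_large (g k : R) : (0 <= k <= K)%R -> (al + g < k)%R ->
  exists2 C : R, (0 < C)%R &
  forall (h : Rn -> \bar R) (x : Rn) (B r0 : R),
  (forall y, 0 <= h y) -> (0 < B)%R -> (0 < r0)%R ->
  (forall r, (r0 <= r)%R -> ballint h x r <= (B * r ^+ n * r `^ g)%:E) ->
  far_sum a K h r0 x <= (C * B * r0 `^ (al + g - k))%:E.
Proof.
move=> kK agk; have := agk; rewrite -subr_gt0 => ag0.
have z01 := powR2_lt1 ag0; set z := (2 `^ _)%R in z01.
have z1 : (0 < (1 - z)^-1)%R by rewrite invr_gt0 subr_gt0; case/andP: z01.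
exists (2 ^+ n * 2 `^ g / (1 - z))%R; first by rewrite !mulr_gt0 ?powR_gt0 ?exprn_gt0.
move=> h x B r h0 B0 r0 H.
have -> : (2 ^+ n * 2 `^ g / (1 - z) * B * r `^ (al + g - k))%:E =
   \sum_(j <oo) ((2 ^+ n * 2 `^ g * B * r `^ (al + g - k)) * z ^+ j)%:E.
  by rewrite nneseries_geometric//; congr EFin; ring.
apply: lee_nneseries => j _.
  by move=> _; rewrite mule_ge0 ?ballint_ge0// lee_fin mulr_ge0 ?powR_ge0.
have rj0 : (0 < r * 2 ^+ j)%R by rewrite mulr_gt0 ?exprn_gt0.
apply: (@le_trans _ _ (((r * 2 ^+ j) `^ (- a) * (r * 2 ^+ j) `^ (- k))%:E *
   (B * (r * 2 ^+ j.+1) ^+ n * (r * 2 ^+ j.+1) `^ g)%:E)).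
  apply: lee_pmul.
  - by rewrite lee_fin mulr_ge0 ?powR_ge0.
  - exact: ballint_ge0.
  - rewrite lee_fin; apply: ler_wpM2l; first exact: powR_ge0.
    exact: decay_le_powR.
  - by apply: H; rewrite ler_peMr ?(ltW r0)// exprn_ege1// ler1n.
rewrite -EFinM lee_fin le_eqVlt; apply/orP; left; apply/eqP.
have [lr er] := pos_expR r0; have [lb eb] := pos_expR B0.
have [l2 e2] := @pos_expR R 2 ltac:(done).
rewrite /z eb er e2 !expE; congr expR; rewrite /a -!natr1; ring.
Qed.

(** At the critical growth g = -alpha the annuli contribute equally, and only the
damping makes the sum finite. *)
Lemma outer_log : exists2 C : R, (0 < C)%R &
  forall (h : Rn -> \bar R) (x : Rn) (B r0 : R),
  (forall y, 0 <= h y) -> (0 < B)%R -> (0 < r0)%R ->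
  (forall r, (r0 <= r)%R -> ballint h x r <= (B * r ^+ n * r `^ (- al))%:E) ->
  far_sum a K h r0 x <= (C * B)%:E * \sum_(j <oo) (decay K (r0 * 2 ^+ j))%:E.
Proof.
exists (2 ^+ n * 2 `^ (- al))%R; first by rewrite !mulr_gt0 ?powR_gt0 ?exprn_gt0.
move=> h x B r h0 B0 r0 H; rewrite -nneseriesZl; last first.
  by move=> j _; rewrite lee_fin powR_ge0.
apply: lee_nneseries => j _.
  by move=> _; rewrite mule_ge0 ?ballint_ge0// lee_fin mulr_ge0 ?powR_ge0.
have rj0 : (0 < r * 2 ^+ j)%R by rewrite mulr_gt0 ?exprn_gt0.
apply: (@le_trans _ _ (((r * 2 ^+ j) `^ (- a) * decay K (r * 2 ^+ j))%:E *
   (B * (r * 2 ^+ j.+1) ^+ n * (r * 2 ^+ j.+1) `^ (- al))%:E)).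
  apply: lee_wpmul2l; first by rewrite lee_fin mulr_ge0 ?powR_ge0.
  by apply: H; rewrite ler_peMr ?(ltW r0)// exprn_ege1// ler1n.
rewrite -!EFinM lee_fin le_eqVlt; apply/orP; left; apply/eqP.
rewrite mulrAC; congr (_ * _)%R.
have [lr er] := pos_expR r0; have [lb eb] := pos_expR B0.
have [l2 e2] := @pos_expR R 2 ltac:(done).
rewrite eb er e2 !expE; congr expR; rewrite /a -!natr1; ring.
Qed.

End engine.

(** * Bounds on masses and near sums from M and the L^s norm *)
Section truncation.
Context {R : realType}.
Local Open Scope ereal_scope.

(** Either y <= lam, or y <= lam (y/lam)^s.  With a suitable lam this elementary
inequality replaces Hoelder's inequality between L^1 and L^s. *)
Lemma le_affine_poweR (s lam : R) (y : \bar R) : (1 <= s)%R -> (0 < lam)%R ->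
  0 <= y -> y <= lam%:E + (lam `^ (1 - s))%:E * y `^ s.
Proof.
move=> s1 lam0; have s0 : (0 < s)%R by lra.
case: y => [y y0|_|//]; last first.
  by rewrite poweRyr ?gt_eqF// gt0_muley ?lte_fin ?powR_gt0// addey ?leey.
rewrite lee_fin in y0; rewrite poweR_EFin -EFinM -EFinD lee_fin.
have [yl|ly] := leP y lam; first by rewrite (le_trans yl)// lerDl mulr_ge0 ?powR_ge0.
apply: (@le_trans _ _ (lam `^ (1 - s) * y `^ s)%R); last by rewrite lerDr ltW.
rewrite -(mulr_powRB1 y0 s0) mulrCA ler_peMr// -opprB powRN.
rewrite mulrC ler_pdivlMr ?powR_gt0// mul1r.
by apply: ge0_ler_powR; rewrite ?subr_ge0// ?nnegrE ?(ltW lam0) ?(ltW ly).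
Qed.

Lemma powR_ratio_le (d t e sg : R) : (0 <= e <= sg)%R -> (0 < d)%R -> (0 < t)%R ->
  (d <= t)%R -> ((d / t) `^ sg <= (d / t) `^ e)%R.
Proof.
move=> /andP[e0 esg] d0 t0 dt; apply: ger_powR => //.
by rewrite divr_gt0// ler_pdivrMr// mul1r.
Qed.

Lemma powR_ratio_ge1 (d t e : R) : (0 <= e)%R -> (0 < t)%R ->
  (t <= d)%R -> (1 <= (d / t) `^ e)%R.
Proof.
move=> e0 t0 td; rewrite -[leLHS](@powRr0 _ (d / t)); apply: ler_powR => //.
by rewrite ler_pdivlMr// mul1r.
Qed.

End truncation.

Section mass.
Context {R : realType} (n : nat).
Local Notation Rn := (n.-tuple R).
Local Notation mu := (@lebn R n).
Local Open Scope ereal_scope.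
Variables (al q s : R) (n0 : (0 < n)%N).
Hypotheses (al0 : (0 < al)%R) (aln : (al < n%:R)%R) (q0 : (0 < q)%R) (s1 : (1 <= s)%R).
Let a := (n%:R - al)%R.
Let a0 : (0 < a)%R. Proof. by rewrite subr_gt0. Qed.
Let s0 : (0 < s)%R. Proof. exact: lt_le_trans s1. Qed.
Let nR0 : (0 < n%:R :> R)%R. Proof. by rewrite ltr0n. Qed.

Variables (f : Rn -> \bar R) (M delta : R).
Hypotheses (f0 : forall y, 0 <= f y) (mf : measurable_fun setT f).
Hypotheses (M0 : (0 < M)%R) (d0 : (0 < delta)%R).
Hypothesis fs : \int[mu]_y (f y `^ s) <= (M `^ s * delta ^+ n)%:E.

Let mfs : measurable_fun setT (fun y => f y `^ s).
Proof. exact: (measurableT_comp (measurable_poweR s)). Qed.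

Lemma ballint_poweR x t : ballint (fun y => f y `^ s) x t <= (M `^ s * delta ^+ n)%:E.
Proof.
apply: le_trans fs; apply: ge0_subset_integral => //; first exact: measurable_eball.
by move=> y _; exact: poweR_ge0.
Qed.

(** Below the scale delta the bound by M is the better one; above it, f is truncated
at the height M (delta/t)^(n/s), which balances the two terms of
[le_affine_poweR]. *)
Lemma mass_bound_from_norm C0 e x : (0 < C0)%R -> (0 <= e <= n%:R / s)%R ->
  (forall t, (0 < t)%R -> ballint f x t <= (C0 * t ^+ n * M)%:E) ->
  mass_bound (C0 + 2 ^+ n + 1) M delta e f x.
Proof.
move=> C00 esg H t t0; have [dt|td] := leP delta t; last first.
  apply: le_trans (H _ t0) _; rewrite lee_fin; apply: ler_pM.
  - by rewrite mulr_ge0 ?(ltW C00) ?exprn_ge0 ?(ltW t0).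
  - exact: ltW.
  - apply: ler_wpM2r; first by rewrite exprn_ge0 ?(ltW t0).
    by rewrite -addrA lerDl addr_ge0 ?exprn_ge0.
  - rewrite ler_peMr ?(ltW M0)//; apply: powR_ratio_ge1 (ltW td) => //.
    by case/andP: esg.
pose lam := (M * (delta / t) `^ (n%:R / s))%R.
have lam0 : (0 < lam)%R by rewrite mulr_gt0 ?powR_gt0 ?divr_gt0.
apply: le_trans (ballint_affine _ (ltW lam0) (powR_ge0 lam (1 - s)) (ltW t0)
  f0 _ mfs _) _.
- by move=> y; exact: poweR_ge0.
- by move=> y; exact: le_affine_poweR.
apply: (@le_trans _ _ ((lam * (2 * t) ^+ n)%:E +
    (lam `^ (1 - s))%:E * (M `^ s * delta ^+ n)%:E)).
  by rewrite leeD2l// lee_wpmul2l ?lee_fin ?powR_ge0//; exact: ballint_poweR.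
have -> : (lam `^ (1 - s))%:E * (M `^ s * delta ^+ n)%:E = (lam * t ^+ n)%:E.
  rewrite -EFinM; congr EFin.
  have [lt et] := pos_expR t0; have [ld ed] := pos_expR d0.
  have [lm em] := pos_expR M0.
  rewrite /lam em ed et !expE; congr expR; field.
  by rewrite gt_eqF.
rewrite -EFinD lee_fin exprMn.
apply: (@le_trans _ _ (lam * ((2 ^+ n + 1) * t ^+ n))%R).
  by rewrite le_eqVlt; apply/orP; left; apply/eqP; ring.
rewrite mulrC; apply: ler_pM.
- by rewrite mulr_ge0 ?addr_ge0 ?exprn_ge0 ?(ltW t0).
- exact: ltW.
- apply: ler_wpM2r; first by rewrite exprn_ge0 ?(ltW t0).
  by rewrite -addrA lerDr ltW.
- apply: ler_wpM2l; first exact: ltW.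
  exact: powR_ratio_le.
Qed.

End mass.

Section near_bounds.
Context {R : realType} (n : nat).
Local Notation Rn := (n.-tuple R).
Local Notation mu := (@lebn R n).
Local Open Scope ereal_scope.
Variables (al q : R) (n0 : (0 < n)%N).
Hypotheses (al0 : (0 < al)%R) (aln : (al < n%:R)%R) (q0 : (0 < q)%R).
Let a := (n%:R - al)%R.
Let a0 : (0 < a)%R. Proof. by rewrite subr_gt0. Qed.
Let nR0 : (0 < n%:R :> R)%R. Proof. by rewrite ltr0n. Qed.

(** For q (n - alpha) < n the mass bound alone suffices. *)
Lemma near_bound_mass (C1 e : R) : (0 < C1)%R -> (q * a < n%:R)%R ->
  exists2 C2 : R, (0 < C2)%R & forall (f : Rn -> \bar R) x (M delta : R),
    (forall y, 0 <= f y) -> measurable_fun setT f ->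
    (0 < M)%R -> (0 < delta)%R ->
    mass_bound C1 M delta e f x -> near_bound al q C2 M delta e f x.
Proof.
move=> C10 qan.
have [|C C0 H] := @near_sum_Lq R n a q a0 q0 _ qan; first by rewrite /a ltrBlDr ltrDl.
exists (C * (C1 * 2 ^+ n * 2 `^ (- e)) `^ q)%R.
  by rewrite !mulr_gt0 ?powR_gt0 ?mulr_gt0 ?exprn_gt0 ?powR_gt0.
move=> f x M d f0 mf M0 d0 H1 t t0.
apply: le_trans (H f x t f0 mf t0) _.
have t20 : (0 < 2 * t)%R by rewrite mulr_gt0.
apply: (@le_trans _ _ ((C * t ^+ n * (t `^ (- a)) `^ q)%:E *
   (C1 * (2 * t) ^+ n * (M * (d / (2 * t)) `^ e))%:E `^ q)).
  apply: lee_wpmul2l.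
    by rewrite lee_fin !mulr_ge0 ?powR_ge0 ?exprn_ge0 ?(ltW C0) ?(ltW t0).
  apply: lee_poweR; [exact: ltW|exact: ballint_ge0|exact: H1].
rewrite poweR_EFin -EFinM lee_fin le_eqVlt; apply/orP; left; apply/eqP.
have [lt et] := pos_expR t0; have [ld ed] := pos_expR d0.
have [lm em] := pos_expR M0; have [lc ec] := pos_expR C0.
have [l1 e1] := pos_expR C10.
have [l2 e2] := @pos_expR R 2 ltac:(done).
rewrite em ed et ec e1 e2 !expE; congr expR; rewrite /a; ring.
Qed.

Let near_sum_cst : exists2 C : R, (0 < C)%R & forall (f : Rn -> \bar R) (M t : R) y,
    (forall y, 0 <= f y) -> measurable_fun setT f ->
    (0 < M)%R -> (0 < t)%R -> {ae mu, forall y, f y <= M%:E} ->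
    near_sum a f t y <= (C * (t `^ al * M))%:E.
Proof.
have z01 := powR2_lt1 al0; set z := (2 `^ _)%R in z01.
have z1 : (0 < (1 - z)^-1)%R by rewrite invr_gt0 subr_gt0; case/andP: z01.
exists (2 `^ a * 2 ^+ n / (1 - z))%R; first by rewrite !mulr_gt0 ?powR_gt0 ?exprn_gt0.
move=> f M t y f0 mf M0 t0 fM.
have -> : (2 `^ a * 2 ^+ n / (1 - z) * (t `^ al * M))%:E =
   \sum_(j <oo) ((2 `^ a * 2 ^+ n * (t `^ al * M)) * z ^+ j)%:E.
  by rewrite nneseries_geometric//; congr EFin; ring.
apply: lee_nneseries => j _.
  by move=> _; rewrite mule_ge0 ?ballint_ge0// lee_fin powR_ge0.
have tj : (0 < t / 2 ^+ j)%R by rewrite divr_gt0 ?exprn_gt0.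
apply: (@le_trans _ _ (((t / 2 ^+ j.+1) `^ (- a))%:E *
    (M * (2 * (t / 2 ^+ j)) ^+ n)%:E)).
  apply: lee_wpmul2l; first by rewrite lee_fin powR_ge0.
  by apply: ballint_le_cst; rewrite ?(ltW M0) ?(ltW tj).
rewrite -EFinM lee_fin le_eqVlt; apply/orP; left; apply/eqP.
have [lt et] := pos_expR t0; have [lm em] := pos_expR M0.
have [l2 e2] := @pos_expR R 2 ltac:(done).
rewrite /z em et e2 !expE; congr expR; rewrite /a -!natr1; ring.
Qed.

Variables (s tau : R).
Hypotheses (s1 : (1 <= s)%R) (tau0 : (0 <= tau)%R) (taual : (tau < al)%R).
Let b := (al + tau * (s - 1))%R.
Hypotheses (bn : (b < n%:R)%R) (qbn : (q * (n%:R - b) < n%:R)%R).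
Let s0 : (0 < s)%R. Proof. exact: lt_le_trans s1. Qed.

(** At the scale t 2^(-j), f is truncated at the height Lam 2^(j tau).  As tau < alpha,
the bounded parts still add up; and the parts with f^s carry the additional factor
2^(- j tau (s-1)), which turns the kernel |x|^(alpha-n) into the less singular kernel
|x|^(b-n), where b = alpha + tau (s-1). *)
Let near_sum_split : exists2 C : R, (0 < C)%R &
  forall (f : Rn -> \bar R) (Lam t : R) y,
    (forall y, 0 <= f y) -> measurable_fun setT f -> (0 < Lam)%R -> (0 < t)%R ->
    near_sum a f t y <= (C * (t `^ al * Lam))%:E +
      (C * (Lam `^ (1 - s) * t `^ (al - b)))%:E *
      near_sum (n%:R - b)%R (fun y => f y `^ s) t y.
Proof.
have altau0 : (0 < al - tau)%R by rewrite subr_gt0.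
have z01 := powR2_lt1 altau0; set z := (2 `^ _)%R in z01.
have z1 : (0 < (1 - z)^-1)%R by rewrite invr_gt0 subr_gt0; case/andP: z01.
pose Ca := (2 `^ a * 2 ^+ n / (1 - z))%R.
have Ca0 : (0 < Ca)%R by rewrite !mulr_gt0 ?powR_gt0 ?exprn_gt0.
pose Cb := (2 `^ (b - al))%R.
have Cb0 : (0 < Cb)%R by rewrite powR_gt0.
exists (Ca + Cb)%R; first by rewrite addr_gt0.
move=> f Lam t y f0 mf L0 t0.
have mfs : measurable_fun setT (fun y => f y `^ s).
  exact: (measurableT_comp (measurable_poweR s)).
have ns0 : 0 <= near_sum (n%:R - b)%R (fun y => f y `^ s) t y.
  by apply: near_sum_ge0 => u; exact: poweR_ge0.
apply: (@le_trans _ _ ((Ca * (t `^ al * Lam))%:E +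
      (Cb * (Lam `^ (1 - s) * t `^ (al - b)))%:E *
      near_sum (n%:R - b)%R (fun y => f y `^ s) t y)); last first.
  apply: leeD.
    rewrite lee_fin; apply: ler_wpM2r; last by rewrite lerDl ltW.
    by rewrite mulr_ge0 ?powR_ge0 ?(ltW L0).
  apply: lee_wpmul2r => //.
  by rewrite lee_fin; apply: ler_wpM2r; rewrite ?mulr_ge0 ?powR_ge0// lerDr ltW.
have -> : (Ca * (t `^ al * Lam))%:E =
   \sum_(j <oo) ((2 `^ a * 2 ^+ n * (t `^ al * Lam)) * z ^+ j)%:E.
  by rewrite nneseries_geometric// /Ca; congr EFin; ring.
have bi0 j : 0 <= ((t / 2 ^+ j.+1) `^ (- (n%:R - b)))%:E *
    ballint (fun y => f y `^ s) y (t / 2 ^+ j).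
  by rewrite mule_ge0 ?lee_fin ?powR_ge0 ?ballint_ge0// => u; exact: poweR_ge0.
rewrite -nneseriesZl// -nneseriesD//; last 2 first.
- by move=> j _ _; rewrite lee_fin !mulr_ge0 ?powR_ge0 ?exprn_ge0 ?powR_ge0 ?(ltW L0).
- by move=> j _ _; rewrite mule_ge0// lee_fin !mulr_ge0 ?powR_ge0.
apply: lee_nneseries => j _.
  by move=> _; rewrite mule_ge0 ?ballint_ge0// lee_fin powR_ge0.
have tj : (0 < t / 2 ^+ j)%R by rewrite divr_gt0 ?exprn_gt0.
(* the truncation height at the scale t / 2 ^+ j *)
pose lam := (Lam * (2 `^ tau) ^+ j)%R.
have lam0 : (0 < lam)%R by rewrite mulr_gt0 ?exprn_gt0 ?powR_gt0.
apply: (@le_trans _ _ (((t / 2 ^+ j.+1) `^ (- a))%:E *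
   ((lam * (2 * (t / 2 ^+ j)) ^+ n)%:E +
   (lam `^ (1 - s))%:E * ballint (fun y => f y `^ s) y (t / 2 ^+ j)))).
  apply: lee_wpmul2l; first by rewrite lee_fin powR_ge0.
  apply: ballint_affine; rewrite ?powR_ge0 ?(ltW lam0) ?(ltW tj)//.
  - by move=> u; exact: poweR_ge0.
  - by move=> u; exact: le_affine_poweR.
rewrite ge0_muleDr; last 2 first.
- rewrite lee_fin; apply: mulr_ge0; first exact: ltW.
  by apply: exprn_ge0; apply: mulr_ge0 => //; exact: ltW.
- by rewrite mule_ge0 ?lee_fin ?powR_ge0 ?ballint_ge0// => u; exact: poweR_ge0.
have [lt et] := pos_expR t0; have [lm em] := pos_expR L0.
have [l2 e2] := @pos_expR R 2 ltac:(done).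
apply: leeD.
  rewrite -EFinM lee_fin le_eqVlt; apply/orP; left; apply/eqP.
  rewrite /z /lam em et e2 !expE; congr expR; rewrite /a -!natr1; ring.
rewrite !muleA -!EFinM; apply: lee_wpmul2r.
  by apply: ballint_ge0 => u; exact: poweR_ge0.
rewrite lee_fin le_eqVlt; apply/orP; left; apply/eqP.
rewrite /Cb /lam em et e2 !expE; congr expR; rewrite /a /b -!natr1; ring.
Qed.

(** For bounded f: below delta the bound f <= M suffices, and above delta the near sums
of f^s with kernel |x|^(b-n) are estimated by [near_sum_Lq], which asks for
q (n - b) < n instead of q (n - alpha) < n. *)
Lemma near_bound_bounded (e : R) : (0 <= e <= n%:R / s)%R ->
  exists2 C2 : R, (0 < C2)%R & forall (f : Rn -> \bar R) x (M delta : R),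
    (forall y, 0 <= f y) -> measurable_fun setT f ->
    (0 < M)%R -> (0 < delta)%R ->
    {ae mu, forall y, f y <= M%:E} ->
    \int[mu]_y (f y `^ s) <= (M `^ s * delta ^+ n)%:E ->
    near_bound al q C2 M delta e f x.
Proof.
move=> esg; have /andP[e0 _] := esg.
have [Cs Cs0 Hs] := near_sum_split.
have [Cc Cc0 Hc] := near_sum_cst.
have b0 : (0 < n%:R - b)%R by rewrite subr_gt0.
have nbn : (n%:R - b < n%:R)%R.
  have : (0 <= tau * (s - 1))%R by rewrite mulr_ge0 ?subr_ge0.
  by move=> ht; rewrite /b ltrBlDr ltrDl; exact: ltr_wpDr.
have [Cg Cg0 Hg] := @near_sum_Lq R n _ q b0 q0 nbn qbn.
pose C1 := (2 `^ q * (Cs `^ q * 2 ^+ n + Cs `^ q * Cg))%R.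
pose C2 := (Cc `^ q * 2 ^+ n)%R.
have C10 : (0 < C1)%R.
  by rewrite mulr_gt0 ?powR_gt0// addr_gt0// mulr_gt0 ?powR_gt0 ?exprn_gt0.
have C20 : (0 < C2)%R by rewrite mulr_gt0 ?powR_gt0 ?exprn_gt0.
exists (C1 + C2)%R; first by rewrite addr_gt0.
move=> f x M d f0 mf M0 d0 fM fs t t0.
have mB := measurable_eball x t.
have mfs : measurable_fun setT (fun y => f y `^ s).
  exact: (measurableT_comp (measurable_poweR s)).
have fs0 u : 0 <= f u `^ s by exact: poweR_ge0.
set X := (t `^ al * M)%R.
have X0 : (0 < X)%R by rewrite mulr_gt0 ?powR_gt0.
have tn0 : (0 <= t ^+ n)%R by rewrite exprn_ge0 ?ltW.
have [dt|td] := leP d t; last first.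
  apply: (@le_trans _ _ (\int[mu]_(y in eball x t) ((Cc * X) `^ q)%:E)).
    apply: ge0_le_integral_on => y _; first exact: poweR_ge0.
    rewrite -poweR_EFin; apply: lee_poweR; [exact: ltW|exact: near_sum_ge0|exact: Hc].
  rewrite (integral_cst mu mB).
  apply: (@le_trans _ _ (((Cc * X) `^ q)%:E * ((2 * t) ^+ n)%:E)).
    by apply: lee_wpmul2l; [rewrite lee_fin powR_ge0|exact: lebn_eball (ltW t0)].
  rewrite -EFinM lee_fin.
  have -> : ((Cc * X) `^ q * (2 * t) ^+ n = C2 * t ^+ n * X `^ q)%R.
    by rewrite powRM ?(ltW Cc0) ?(ltW X0)// exprMn /C2; ring.
  apply: ler_pM.
  - by rewrite mulr_ge0 ?(ltW C20).
  - exact: powR_ge0.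
  - by apply: ler_wpM2r => //; rewrite lerDr ltW.
  - rewrite mulrA; apply: ge0_ler_powR; rewrite ?nnegrE ?(ltW q0) ?(ltW X0)//.
      by rewrite mulr_ge0 ?powR_ge0 ?(ltW X0).
    rewrite ler_peMr ?(ltW X0)//; apply: powR_ratio_ge1 (ltW td) => //.
pose Lam := (M * (d / t) `^ (n%:R / s))%R.
have L0 : (0 < Lam)%R by rewrite mulr_gt0 ?powR_gt0 ?divr_gt0.
set Y := (t `^ al * Lam)%R.
have Y0 : (0 < Y)%R by rewrite mulr_gt0 ?powR_gt0.
set W := (Lam `^ (1 - s) * t `^ (al - b))%R.
have W0 : (0 < W)%R by rewrite mulr_gt0 ?powR_gt0.
set L := near_sum (n%:R - b) (fun y => f y `^ s) t.
have mL : measurable_fun setT L by exact: measurable_near_sum.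
have mLq : measurable_fun (eball x t) (fun y => L y `^ q).
  by apply: measurable_funTS; apply: (measurableT_comp (measurable_poweR q)).
have L_ge0 y : 0 <= L y by exact: near_sum_ge0.
apply: (@le_trans _ _ (\int[mu]_(y in eball x t) ((2 `^ q)%:E *
   (((Cs * Y) `^ q)%:E + ((Cs * W) `^ q)%:E * L y `^ q)))).
  apply: ge0_le_integral_on => y _; first exact: poweR_ge0.
  apply: (@le_trans _ _ (((Cs * Y)%:E + (Cs * W)%:E * L y) `^ q)).
    by apply: lee_poweR; [exact: ltW|exact: near_sum_ge0|exact: Hs].
  have CY : 0 <= (Cs * Y)%:E by rewrite lee_fin mulr_ge0 ?(ltW Cs0) ?(ltW Y0).
  have CW : 0 <= (Cs * W)%:E by rewrite lee_fin mulr_ge0 ?(ltW Cs0) ?(ltW W0).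
  apply: le_trans (poweR_add_le q0 CY (mule_ge0 CW (L_ge0 y))) _.
  by rewrite poweRM// !poweR_EFin.
rewrite ge0_integralZl_EFin ?powR_ge0//; last 2 first.
- by move=> y _; rewrite adde_ge0 ?mule_ge0 ?poweR_ge0 ?lee_fin ?powR_ge0.
- by apply: emeasurable_funD => //; exact: measurable_funeM.
rewrite ge0_integralD//; last 3 first.
- by move=> y _; rewrite lee_fin powR_ge0.
- by move=> y _; rewrite mule_ge0 ?poweR_ge0 ?lee_fin ?powR_ge0.
- exact: measurable_funeM.
rewrite ge0_integralZl_EFin ?powR_ge0//; last by move=> y _; exact: poweR_ge0.
rewrite (integral_cst mu mB).
apply: (@le_trans _ _ ((2 `^ q)%:E * (((Cs * Y) `^ q)%:E * ((2 * t) ^+ n)%:E +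
   ((Cs * W) `^ q)%:E * ((Cg * t ^+ n * (t `^ (- (n%:R - b))) `^ q)%:E *
      ((M `^ s * d ^+ n) `^ q)%:E)))).
  apply: lee_wpmul2l; first by rewrite lee_fin powR_ge0.
  apply: leeD; apply: lee_wpmul2l; rewrite ?lee_fin ?powR_ge0//.
    exact: lebn_eball (ltW t0).
  apply: le_trans (Hg _ x t fs0 mfs t0) _; apply: lee_wpmul2l.
    by rewrite lee_fin !mulr_ge0 ?powR_ge0 ?(ltW Cg0).
  rewrite -poweR_EFin; apply: lee_poweR; [exact: ltW|exact: ballint_ge0|].
  exact: ballint_poweR.
rewrite -[X in _ * (X + _)]EFinM -[X in _ * (_ + _ * X)]EFinM.
rewrite -[X in _ * (_ + X)]EFinM -EFinD -EFinM lee_fin.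
have -> : ((Cs * W) `^ q *
      (Cg * t ^+ n * (t `^ (- (n%:R - b))) `^ q * (M `^ s * d ^+ n) `^ q) =
    Cs `^ q * Cg * t ^+ n * Y `^ q)%R.
  have [lt et] := pos_expR t0; have [ld ed] := pos_expR d0.
  have [lm em] := pos_expR M0; have [lc ec] := pos_expR Cs0.
  have [lg eg] := pos_expR Cg0.
  rewrite /Y /W /Lam em ed et ec eg !expE; congr expR; field.
  by rewrite gt_eqF.
have -> : ((Cs * Y) `^ q * (2 * t) ^+ n = Cs `^ q * 2 ^+ n * t ^+ n * Y `^ q)%R.
  by rewrite powRM ?(ltW Cs0) ?(ltW Y0)// exprMn; ring.
apply: (@le_trans _ _ (C1 * t ^+ n * Y `^ q)%R).
  by rewrite /C1 le_eqVlt; apply/orP; left; apply/eqP; ring.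
apply: ler_pM.
- by rewrite mulr_ge0 ?(ltW C10).
- exact: powR_ge0.
- by apply: ler_wpM2r => //; rewrite lerDl ltW.
- apply: ge0_ler_powR; rewrite ?nnegrE ?(ltW q0) ?(ltW Y0)//.
    by rewrite !mulr_ge0 ?powR_ge0 ?(ltW M0).
  apply: ler_wpM2l; first exact: powR_ge0.
  by apply: ler_wpM2l; [exact: ltW|exact: powR_ratio_le].
Qed.

End near_bounds.

(** * The iterated potential *)
Section iterated.
Context {R : realType} (n : nat).
Local Notation Rn := (n.-tuple R).
Local Notation mu := (@lebn R n).
Local Open Scope ereal_scope.
Variables (al K q : R) (n0 : (0 < n)%N).
Hypotheses (al0 : (0 < al)%R) (aln : (al < n%:R)%R) (K0 : (0 <= K)%R) (q0 : (0 < q)%R).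
Let a := (n%:R - al)%R.
Let a0 : (0 < a)%R. Proof. by rewrite subr_gt0. Qed.

Definition kpot2 (f : Rn -> \bar R) (x : Rn) : \bar R :=
  kpot a K (fun y => kpot a K f y `^ q) x.

Let h0 (f : Rn -> \bar R) y : 0 <= kpot a K f y `^ q.
Proof. exact: poweR_ge0. Qed.

Lemma kpot2_dyadic (f : Rn -> \bar R) x r : (forall y, 0 <= f y) ->
  measurable_fun setT f -> (0 < r)%R ->
  kpot2 f x <= near_sum a (fun y => kpot a K f y `^ q) r x +
               far_sum a K (fun y => kpot a K f y `^ q) r x.
Proof.
move=> f0 mf r0; apply: kpot_dyadic => //.
apply: (measurableT_comp (measurable_poweR q)); exact: measurable_kpot.
Qed.

Lemma ball_bound_undamped (e C1 C2 : R) : (al < e)%R -> (0 < C1)%R -> (0 < C2)%R ->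
  exists2 C : R, (0 < C)%R &
  forall (f : Rn -> \bar R) (x : Rn) (M delta : R),
  (forall y, 0 <= f y) -> measurable_fun setT f -> (0 < M)%R -> (0 < delta)%R ->
  mass_bound C1 M delta e f x -> near_bound al q C2 M delta e f x ->
  forall r, (0 < r)%R -> ballint (fun y => kpot a K f y `^ q) x r <=
   (C * M `^ q * delta `^ (q * e) * r ^+ n * r `^ (q * (al - e)))%:E.
Proof.
move=> ale C10 C20.
have [||C C0 H] := @ball_bound R n al K q n0 aln K0 q0 e 0 C1 C2 _ _ C10 C20.
- by rewrite lexx.
- by rewrite add0r.
exists (C * 2 `^ q)%R; first by rewrite mulr_gt0 ?powR_gt0.
move=> f x M d f0 mf M0 d0 H1 H2 r r0.
apply: le_trans (H f x M d f0 mf M0 d0 H1 H2 r r0) _.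
rewrite oppr0 powRr0 -[(1 + 1)%R]/(2%:R).
rewrite lee_fin le_eqVlt; apply/orP; left; apply/eqP.
have [lr er] := pos_expR r0; have [ld ed] := pos_expR d0.
have [lm em] := pos_expR M0; have [lc ec] := pos_expR C0.
have [l2 e2] := @pos_expR R 2 ltac:(done).
rewrite em er ed ec e2 !expE; congr expR; ring.
Qed.

(** An exponent e slightly above alpha makes the far sums converge, at the price of a
singularity (delta/r)^e that the outer sum over the scales r < delta still
tolerates. *)
Lemma near_part (e C1 C2 : R) : (al < e)%R -> (q * e < al * (1 + q))%R ->
  (0 < C1)%R -> (0 < C2)%R ->
  exists2 C : R, (0 < C)%R &
  forall (f : Rn -> \bar R) (x : Rn) (M delta : R),
  (forall y, 0 <= f y) -> measurable_fun setT f -> (0 < M)%R -> (0 < delta)%R ->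
  mass_bound C1 M delta e f x -> near_bound al q C2 M delta e f x ->
  near_sum a (fun y => kpot a K f y `^ q) delta x <=
  (C * (M `^ q * delta `^ (al * (1 + q))))%:E.
Proof.
move=> ale qe C10 C20; have [C C0 H] := ball_bound_undamped ale C10 C20.
have [|D D0 HD] := @outer_small R n al (q * (al - e))%R; first by nra.
exists (D * C)%R; first by rewrite mulr_gt0.
move=> f x M d f0 mf M0 d0 H1 H2.
apply: le_trans (HD _ x (C * M `^ q * d `^ (q * e))%R d _ _ d0 _) _ => //.
- by rewrite !mulr_gt0 ?powR_gt0.
- by move=> r /andP[r0 _]; exact: H f0 mf M0 d0 H1 H2 r r0.
rewrite lee_fin le_eqVlt; apply/orP; left; apply/eqP.
have [ld ed] := pos_expR d0; have [lD eD] := pos_expR D0.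
have [lm em] := pos_expR M0; have [lc ec] := pos_expR C0.
rewrite em ed ec eD !expE; congr expR; ring.
Qed.

(** Here sg stands for n/s; the hypothesis on it says that s < n/(alpha p). *)
Lemma iterated_subcritical (e sg C1 C2 C3 : R) :
  (al < e)%R -> (q * e < al * (1 + q))%R -> (al * (1 + q) < q * sg)%R ->
  (0 < C1)%R -> (0 < C2)%R -> (0 < C3)%R ->
  exists2 C : R, (0 < C)%R &
  forall (f : Rn -> \bar R) (x : Rn) (M delta : R),
  (forall y, 0 <= f y) -> measurable_fun setT f -> (0 < M)%R -> (0 < delta)%R ->
  mass_bound C1 M delta e f x -> near_bound al q C2 M delta e f x ->
  mass_bound C1 M delta sg f x -> near_bound al q C3 M delta sg f x ->
  kpot2 f x <= (C * (M `^ q * delta `^ (al * (1 + q))))%:E.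
Proof.
move=> ale qe qsg C10 C20 C30.
have [C C0 H] := near_part ale qe C10 C20.
have alsg : (al < sg)%R.
  rewrite -(ltr_pM2l q0); apply: lt_trans qsg.
  by rewrite mulrDr mulr1 mulrC ltrDr.
have [D D0 HD] := ball_bound_undamped alsg C10 C30.
have [||E E0 HE] := @outer_large R n al K (q * (al - sg))%R 0.
- by rewrite lexx.
- by nra.
exists (C + E * D)%R; first by rewrite addr_gt0 ?mulr_gt0.
move=> f x M d f0 mf M0 d0 H1 H2 H3 H4.
apply: le_trans (kpot2_dyadic x f0 mf d0) _.
rewrite mulrDl EFinD; apply: leeD; first exact: H.
apply: le_trans (HE _ x (D * M `^ q * d `^ (q * sg))%R d _ _ d0 _) _ => //.
- by rewrite !mulr_gt0 ?powR_gt0.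
- move=> r dr; apply: (HD _ _ _ _ f0 mf M0 d0 H3 H4); exact: lt_le_trans dr.
rewrite lee_fin le_eqVlt; apply/orP; left; apply/eqP.
have [ld ed] := pos_expR d0; have [lD eD] := pos_expR D0.
have [lm em] := pos_expR M0; have [lc ec] := pos_expR E0.
rewrite em ed ec eD !expE; congr expR; ring.
Qed.

(** For s = n/(alpha p), the exponent sg = n/s makes the growth of the ball integrals
critical above the scale delta. *)
Lemma iterated_critical (e sg C1 C2 C3 : R) :
  (al < e)%R -> (q * e < al * (1 + q))%R -> (al * (1 + q) = q * sg)%R ->
  (0 < C1)%R -> (0 < C2)%R -> (0 < C3)%R ->
  exists2 C : R, (0 < C)%R &
  forall (f : Rn -> \bar R) (x : Rn) (M delta : R),
  (forall y, 0 <= f y) -> measurable_fun setT f -> (0 < M)%R -> (0 < delta)%R ->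
  mass_bound C1 M delta e f x -> near_bound al q C2 M delta e f x ->
  mass_bound C1 M delta sg f x -> near_bound al q C3 M delta sg f x ->
  kpot2 f x <= (C * (M `^ q * delta `^ (q * sg)))%:E *
     (1 + \sum_(j <oo) (decay K (delta * 2 ^+ j))%:E).
Proof.
move=> ale qe qsg C10 C20 C30.
have [C C0 H] := near_part ale qe C10 C20.
have alsg : (al < sg)%R by rewrite -(ltr_pM2l q0) -qsg mulrDr mulr1 mulrC ltrDr.
have [D D0 HD] := ball_bound_undamped alsg C10 C30.
have [E E0 HE] := @outer_log R n al K.
exists (C + E * D)%R; first by rewrite addr_gt0 ?mulr_gt0.
move=> f x M d f0 mf M0 d0 H1 H2 H3 H4.
have S0 : 0 <= \sum_(j <oo) (decay K (d * 2 ^+ j))%:E.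
  by apply: nneseries_ge0 => j _ _; rewrite lee_fin powR_ge0.
have X0 : (0 <= M `^ q * d `^ (q * sg))%R by rewrite mulr_ge0 ?powR_ge0.
apply: le_trans (kpot2_dyadic x f0 mf d0) _.
rewrite ge0_muleDr ?mule1//; apply: leeD.
  apply: le_trans (H _ x M d f0 mf M0 d0 H1 H2) _; rewrite qsg lee_fin.
  by apply: ler_wpM2r => //; rewrite lerDl mulr_ge0 ?(ltW E0) ?(ltW D0).
apply: le_trans (HE _ x (D * M `^ q * d `^ (q * sg))%R d _ _ d0 _) _ => //.
- by rewrite !mulr_gt0 ?powR_gt0.
- move=> r dr; have r0 := lt_le_trans d0 dr.
  apply: le_trans (HD _ _ _ _ f0 mf M0 d0 H3 H4 r r0) _.
  by rewrite (_ : (q * (al - sg) = - al)%R)//; nra.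
apply: lee_wpmul2r => //; rewrite lee_fin.
rewrite -[(D * _ * _)%R]mulrA mulrA; apply: ler_wpM2r => //.
by rewrite lerDr ltW.
Qed.

(** When delta > 1 the bound by M is the better one up to the unit scale, beyond which
the damping takes over.  This is the case e = 0 of the hypotheses. *)
Lemma iterated_unit_scale (k C1 C2 : R) :
  (al < k)%R -> (q * k < al * (1 + q))%R -> (k <= K)%R -> (al * (1 + q) < K)%R ->
  (0 < C1)%R -> (0 < C2)%R ->
  exists2 C : R, (0 < C)%R &
  forall (f : Rn -> \bar R) (x : Rn) (M delta : R),
  (forall y, 0 <= f y) -> measurable_fun setT f -> (0 < M)%R -> (0 < delta)%R ->
  mass_bound C1 M delta 0 f x -> near_bound al q C2 M delta 0 f x ->
  kpot2 f x <= (C * M `^ q)%:E.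
Proof.
move=> alk qk kK alK C10 C20.
have k0 : (0 < k)%R by exact: lt_trans alk.
have [||B B0 HB] := @ball_bound R n al K q n0 aln K0 q0 0 k C1 C2 _ _ C10 C20.
- by rewrite (ltW k0).
- by rewrite addr0.
have [|C C0 HC] := @outer_small R n al (q * (al - k))%R; first by nra.
have [||D D0 HD] := @outer_large R n al K (q * al)%R K.
- by rewrite K0 lexx.
- by nra.
exists (C * (B * 2 `^ q) + D * (B * 2 `^ q))%R.
  by rewrite addr_gt0 ?mulr_gt0 ?powR_gt0.
move=> f x M d f0 mf M0 d0 H1 H2.
apply: le_trans (kpot2_dyadic x f0 mf ltr01) _.
have HB' r : (0 < r)%R -> ballint (fun y => kpot a K f y `^ q) x r <=
   (B * r ^+ n * (r `^ al * M * (1 + r `^ (- k))) `^ q)%:E.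
  move=> r0; have := HB f x M d f0 mf M0 d0 H1 H2 r r0.
  by rewrite powRr0 mulr1.
have BM0 : (0 < B * 2 `^ q * M `^ q)%R by rewrite !mulr_gt0 ?powR_gt0.
rewrite mulrDl EFinD; apply: leeD.
  apply: le_trans (HC _ x (B * 2 `^ q * M `^ q)%R 1%R _ _ ltr01 _) _ => //.
    move=> r /andP[r0 r1]; apply: le_trans (HB' r r0) _.
    have -> : (B * 2 `^ q * M `^ q * r ^+ n * r `^ (q * (al - k)) =
       B * r ^+ n * (r `^ al * M * (2 * r `^ (- k))) `^ q)%R.
      have [lr er] := pos_expR r0.
      have [lm em] := pos_expR M0; have [lc ec] := pos_expR B0.
      have [l2 e2] := @pos_expR R 2 ltac:(done).
      rewrite em er ec e2 !expE; congr expR; ring.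
    rewrite lee_fin; apply: ler_wpM2l; first by rewrite mulr_ge0 ?exprn_ge0 ?ltW.
    apply: ge0_ler_powR; rewrite ?nnegrE ?(ltW q0)//.
    - by rewrite !mulr_ge0 ?addr_ge0 ?powR_ge0 ?(ltW M0).
    - by rewrite !mulr_ge0 ?powR_ge0 ?(ltW M0).
    - apply: ler_wpM2l; first by rewrite mulr_ge0 ?powR_ge0 ?(ltW M0).
      rewrite mulr_natl mulr2n lerD2r -[leLHS](@powRr0 _ r).
      by apply: ger_powR; rewrite ?r0// oppr_le0 ltW.
  by rewrite powR1 mulr1 !mulrA.
apply: le_trans (HD _ x (B * 2 `^ q * M `^ q)%R 1%R _ _ ltr01 _) _ => //.
  move=> r r1; have r0 := lt_le_trans ltr01 r1; apply: le_trans (HB' r r0) _.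
  have -> : (B * 2 `^ q * M `^ q * r ^+ n * r `^ (q * al) =
     B * r ^+ n * (r `^ al * M * 2) `^ q)%R.
    have [lr er] := pos_expR r0.
    have [lm em] := pos_expR M0; have [lc ec] := pos_expR B0.
    have [l2 e2] := @pos_expR R 2 ltac:(done).
    rewrite em er ec e2 !expE; congr expR; ring.
  rewrite lee_fin; apply: ler_wpM2l; first by rewrite mulr_ge0 ?exprn_ge0 ?ltW.
  apply: ge0_ler_powR; rewrite ?nnegrE ?(ltW q0)//.
  - by rewrite !mulr_ge0 ?addr_ge0 ?powR_ge0 ?(ltW M0).
  - by rewrite !mulr_ge0 ?powR_ge0 ?(ltW M0).
  - apply: ler_wpM2l; first by rewrite mulr_ge0 ?powR_ge0 ?(ltW M0).
    rewrite -[leRHS]/(1 + 1)%R lerD2l -[leRHS](@powRr0 _ r).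
    by apply: ler_powR; rewrite ?r1// oppr_le0 ltW.
by rewrite powR1 mulr1 !mulrA.
Qed.

End iterated.

Section weight_sum.
Context {R : realType}.
Local Open Scope ereal_scope.

(** Up to a geometric tail, the sum counts the dyadic scales between d and 1. *)
Lemma decay_series_le (K : R) : (0 < K)%R -> exists2 C : R, (0 < C)%R &
  forall d : R, (0 < d <= 1)%R ->
  \sum_(j <oo) (decay K (d * 2 ^+ j))%:E <= (C * (1 + ln (d^-1)))%:E.
Proof.
move=> K0.
have z01 := powR2_lt1 K0; set z := (2 `^ _)%R in z01.
have z1 : (0 < (1 - z)^-1)%R by rewrite invr_gt0 subr_gt0; case/andP: z01.
have l20 : (0 < ln 2 :> R)%R by rewrite ln_gt0// ltr1n.
exists ((ln 2)^-1 + 1 + (1 - z)^-1)%R.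
  by rewrite addr_gt0// addr_gt0// invr_gt0.
move=> d /andP[d0 d1].
have L0 : (0 <= ln d^-1)%R by apply: ln_ge0; rewrite invf_ge1.
have [m [dm1 dm2]] : exists m : nat,
    (1 <= d * 2 ^+ m)%R /\ (m%:R <= 1 + ln d^-1 / ln 2)%R.
  have [->|d1'] := eqVneq d 1%R.
    by exists 0%N; rewrite expr0 mulr1 invr1 ln1 mul0r addr0.
  have dlt : (d < 1)%R by rewrite lt_neqAle d1' d1.
  have [m /andP[m1 m2]] := dyadic_up d0 d1.
  exists m.+1; split; first exact: ltW.
  rewrite -natr1 addrC lerD2l ler_pdivlMr// -ln_powR powR_mulrn//.
  rewrite ler_ln ?posrE ?exprn_gt0 ?invr_gt0//.
  by rewrite -(ler_pM2l d0) divff ?gt_eqF.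
have w0 j : 0 <= (decay K (d * 2 ^+ j))%:E by rewrite lee_fin powR_ge0.
rewrite (nneseries_split 0 m)// add0n.
apply: (@le_trans _ _ (m%:R%:E + ((1 - z)^-1)%:E)); last first.
  rewrite -EFinD lee_fin.
  have : (0 <= (ln 2)^-1 :> R)%R by rewrite invr_ge0 ltW.
  move: dm2 z1 L0; set l := (ln 2)^-1%R; set w := (1 - z)^-1%R; nra.
apply: leeD.
  apply: (@le_trans _ _ (\sum_(0 <= j < m) 1%:E)).
    by apply: lee_sum => j _; rewrite lee_fin decay_le1 ?ltW.
  by rewrite big_mkord sumEFin sumr_const card_ord.
rewrite -[(_^-1)%R]mul1r -nneseries_geometric//.
rewrite -(nneseries_addn m w0).
apply: lee_nneseries => j _; first by move=> _; rewrite lee_fin powR_ge0.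
rewrite lee_fin mul1r.
have dj0 : (0 < d * 2 ^+ (j + m))%R by rewrite mulr_gt0 ?exprn_gt0.
apply: (@le_trans _ _ ((d * 2 ^+ (j + m)) `^ (- K))%R).
  by apply: decay_le_powR; rewrite ?lexx ?(ltW K0).
rewrite /z -powR_exp//; apply: ler_powRN; rewrite ?(ltW K0) ?exprn_gt0//.
by rewrite exprD mulrCA ler_peMr ?exprn_ge0.
Qed.
End weight_sum.

(** * Integrals over the half line by dyadic intervals *)
Section cover.
Context d (T : measurableType d) (R : realType).
Variable m : {measure set T -> \bar R}.
Local Open Scope ereal_scope.

Lemma integral_le_steps (D : set T) (G : T -> \bar R) (c1 c2 : nat -> R)
    (A1 A2 : nat -> set T) :
  (forall j, (0 <= c1 j)%R) -> (forall j, (0 <= c2 j)%R) ->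
  (forall j, measurable (A1 j)) -> (forall j, measurable (A2 j)) ->
  (forall x, D x -> 0 <= G x) ->
  (forall x, D x -> (exists2 j, A1 j x & G x <= (c1 j)%:E) \/
                    (exists2 j, A2 j x & G x <= (c2 j)%:E)) ->
  \int[m]_(x in D) G x <=
  \sum_(j <oo) ((c1 j)%:E * m (A1 j)) + \sum_(j <oo) ((c2 j)%:E * m (A2 j)).
Proof.
move=> c10 c20 mA1 mA2 G0 GD.
have ind0 (c : R) (A : set T) x : (0 <= c)%R -> 0 <= c%:E * (\1_A x)%:E.
  by move=> c0; rewrite mule_ge0// lee_fin.
have mind (A : set T) : measurable A ->
    measurable_fun setT (fun x => (\1_A x)%:E : \bar R).
  by move=> mA; apply/measurable_EFinP; exact: measurable_indic.
have mcind (c : R) (A : set T) : measurable A ->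
    measurable_fun setT (fun x => c%:E * (\1_A x)%:E).
  by move=> mA; apply: measurable_funeM => //; apply: mind.
have intI (c : R) (A : set T) : measurable A -> (0 <= c)%R ->
    \int[m]_x (c%:E * (\1_A x)%:E) = c%:E * m A.
  move=> mA c0; rewrite ge0_integralZl_EFin//; last exact: mind.
    by rewrite integral_indic// setIT.
pose S1 x := \sum_(j <oo) ((c1 j)%:E * (\1_(A1 j) x)%:E).
pose S2 x := \sum_(j <oo) ((c2 j)%:E * (\1_(A2 j) x)%:E).
have S10 x : 0 <= S1 x by apply: nneseries_ge0 => j _ _; exact: ind0.
have S20 x : 0 <= S2 x by apply: nneseries_ge0 => j _ _; exact: ind0.
apply: (@le_trans _ _ (\int[m]_x (S1 x + S2 x))).
  rewrite integral_mkcond; apply: ge0_le_integralT => x; first exact: erestrict_ge0.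
  rewrite /patch; case: ifPn => [|_]; last exact: adde_ge0.
  rewrite inE => /GD[[j Ax Gx]|[j Ax Gx]].
    apply: (@le_trans _ _ (S1 x)); last by rewrite leeDl.
    apply: le_trans (nneseries_ge_term j _); last by move=> i; exact: ind0.
    by rewrite indicE mem_set// mule1.
  apply: (@le_trans _ _ (S2 x)); last by rewrite leeDr.
  apply: le_trans (nneseries_ge_term j _); last by move=> i; exact: ind0.
  by rewrite indicE mem_set// mule1.
rewrite ge0_integralD//; last 2 first.
- by apply: ge0_emeasurable_sum => [j x _ _|j _]; [exact: ind0|exact: mcind].
- by apply: ge0_emeasurable_sum => [j x _ _|j _]; [exact: ind0|exact: mcind].
rewrite /S1 /S2 !integral_nneseries//; last 4 first.
- by move=> j; exact: mcind.
- by move=> j x _; exact: ind0.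
- by move=> j; exact: mcind.
- by move=> j x _; exact: ind0.
under eq_eseriesr => j _ do rewrite intI//.
by under [X in _ + X <= _]eq_eseriesr => j _ do rewrite intI//.
Qed.

End cover.

Section half_line.
Context {R : realType}.
Local Notation leb := (@lebesgue_measure R).

Lemma powR_doubling (u s k : R) : 0 < u -> u <= s < 2 * u ->
  s `^ k <= 2 `^ `|k| * u `^ k.
Proof.
move=> u0 /andP[us su]; have s0 := lt_le_trans u0 us.
have [k0|k0] := leP 0 k.
  rewrite ger0_norm// -powRM ?(ltW u0)//.
  by apply: ge0_ler_powR; rewrite ?nnegrE ?mulr_ge0 ?(ltW u0) ?(ltW s0) ?(ltW su).
apply: (@le_trans _ _ (u `^ k)).
  by rewrite -(opprK k); apply: ler_powRN; rewrite // oppr_ge0 ltW.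
rewrite ler_peMl ?powR_ge0// -[leLHS](@powRr0 _ 2); apply: ler_powR => //.
by rewrite ler1n.
Qed.

Lemma lebesgue_dyadic_itv (u : R) : 0 < u -> leb `[u, 2 * u[%classic = u%:E.
Proof.
move=> u0; rewrite lebesgue_measure_itv/= lte_fin ifT; last by lra.
by rewrite -EFinD; congr EFin; ring.
Qed.

Local Open Scope ereal_scope.

(** Upper bounds for integrals of powers on (0,T) and (T,+oo) from the same dyadic
decomposition that was used in R^n. *)
Lemma integral_half_line_le (th1 th2 : R) : (0 < th1)%R -> (0 < th2)%R ->
  exists2 C : R, (0 < C)%R & forall (F : R -> R) (A1 A2 T : R),
    (0 < A1)%R -> (0 < A2)%R -> (0 < T)%R ->
    (forall s, 0 < s -> 0 <= F s)%R ->
    (forall s, 0 < s < T -> F s <= A1 * s `^ (th1 - 1))%R ->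
    (forall s, T <= s -> F s <= A2 * s `^ (- th2 - 1))%R ->
    \int[leb]_(s in `]0%R, +oo[) (F s)%:E <=
    (C * (A1 * T `^ th1 + A2 * T `^ (- th2)))%:E.
Proof.
move=> th10 th20.
have z01 := powR2_lt1 th10; set z := (2 `^ _)%R in z01.
have z1 : (0 < (1 - z)^-1)%R by rewrite invr_gt0 subr_gt0; case/andP: z01.
have w01 := powR2_lt1 th20; set w := (2 `^ _)%R in w01.
have w1 : (0 < (1 - w)^-1)%R by rewrite invr_gt0 subr_gt0; case/andP: w01.
pose C1 := (2 `^ `|th1 - 1| * 2 `^ (- th1) / (1 - z))%R.
pose C2 := (2 `^ `|- th2 - 1| / (1 - w))%R.
have C10 : (0 < C1)%R by rewrite !mulr_gt0 ?powR_gt0.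
have C20 : (0 < C2)%R by rewrite mulr_gt0 ?powR_gt0.
exists (C1 + C2)%R; first by rewrite addr_gt0.
move=> F A1 A2 T A10 A20 T0 F0 F1 F2.
pose u1 j := (T / 2 ^+ j.+1)%R; pose u2 j := (T * 2 ^+ j)%R.
have u10 j : (0 < u1 j)%R by rewrite divr_gt0 ?exprn_gt0.
have u20 j : (0 < u2 j)%R by rewrite mulr_gt0 ?exprn_gt0.
pose c1 j := (A1 * (2 `^ `|th1 - 1| * u1 j `^ (th1 - 1)))%R.
pose c2 j := (A2 * (2 `^ `|- th2 - 1| * u2 j `^ (- th2 - 1)))%R.
have c10 j : (0 <= c1 j)%R by rewrite !mulr_ge0 ?powR_ge0 ?(ltW A10).
have c20 j : (0 <= c2 j)%R by rewrite !mulr_ge0 ?powR_ge0 ?(ltW A20).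
pose I (u : R) : set R := `[u, (2 * u)%R[%classic.
have mI u : measurable (I u) by exact: measurable_itv.
have u1E j : (2 * u1 j = T / 2 ^+ j)%R.
  by rewrite /u1 exprS invfM mulrCA mulVKf// pnatr_eq0.
have sumE c u : (forall j, 0 < u j)%R -> \sum_(j <oo) ((c j)%:E * leb (I (u j))) =
    \sum_(j <oo) (c j * u j)%:E.
  by move=> u0; apply: eq_eseriesr => j _; rewrite /I lebesgue_dyadic_itv.
apply: le_trans (@integral_le_steps _ _ _ leb _ _ c1 c2 (fun j => I (u1 j))
    (fun j => I (u2 j)) c10 c20 (fun j => mI _) (fun j => mI _) _ _) _.
- by move=> s; rewrite /= in_itv/= andbT => s0; rewrite lee_fin F0.
- move=> s; rewrite /= in_itv/= andbT => s0.
  have [sT|Ts] := ltP s T.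
    have [j /andP[j1 j2]] := dyadic_dn s0 sT; left; exists j.
      rewrite /I/= in_itv/= j1/= (lt_le_trans j2)//.
      by rewrite u1E.
    rewrite lee_fin; apply: le_trans (F1 _ _) _; first by rewrite s0.
    apply: ler_wpM2l; [exact: ltW|apply: powR_doubling => //].
    rewrite j1/= (lt_le_trans j2)//.
    by rewrite u1E.
  have [j /andP[j1 j2]] := dyadic_up T0 Ts; right; exists j.
    by rewrite /I/= in_itv/= j1/= (lt_le_trans j2)// /u2 exprS mulrCA.
  rewrite lee_fin; apply: le_trans (F2 _ Ts) _.
  apply: ler_wpM2l; [exact: ltW|apply: powR_doubling => //].
  by rewrite j1/= (lt_le_trans j2)// /u2 exprS mulrCA.
rewrite !sumE//.
have [l2 e2] := @pos_expR R 2 ltac:(done).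
have [lT eT] := pos_expR T0.
have c1E j : (c1 j * u1 j =
    A1 * (2 `^ `|th1 - 1| * 2 `^ (- th1)) * T `^ th1 * z ^+ j)%R.
  have [lA eA] := pos_expR A10.
  rewrite /c1 /u1 /z eA e2 eT !expE; congr expR; rewrite -!natr1; ring.
have c2E j : (c2 j * u2 j = A2 * 2 `^ `|- th2 - 1| * T `^ (- th2) * w ^+ j)%R.
  have [lA eA] := pos_expR A20.
  rewrite /c2 /u2 /w eA e2 eT !expE; congr expR; rewrite -?natr1; ring.
under eq_eseriesr => j _ do rewrite c1E.
under [X in _ + X]eq_eseriesr => j _ do rewrite c2E.
rewrite !nneseries_geometric// -EFinD lee_fin.
apply: (@le_trans _ _ (C1 * (A1 * T `^ th1) + C2 * (A2 * T `^ (- th2)))%R).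
  by rewrite le_eqVlt /C1 /C2; apply/orP; left; apply/eqP; ring.
have X1 : (0 <= A1 * T `^ th1)%R by rewrite mulr_ge0 ?powR_ge0 ?ltW.
have X2 : (0 <= A2 * T `^ (- th2))%R by rewrite mulr_ge0 ?powR_ge0 ?ltW.
nra.
Qed.

Lemma expR_decay (m : R) : (0 < m)%R -> exists2 D : R, (0 < D)%R &
  forall u : R, (0 < u)%R -> (expR (- u) <= D * u `^ (- m))%R.
Proof.
move=> m0; exists (m `^ m)%R; first exact: powR_gt0.
move=> u u0; rewrite expRN powRN -ler_pdivrMr ?invr_gt0 ?powR_gt0// invrK.
rewrite mulrC ler_pdivrMr ?expR_gt0//.
have -> : (u `^ m = m `^ m * (u / m) `^ m)%R.
  by rewrite -powRM ?divr_ge0 ?ltW// mulrC divfK// gt_eqF.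
apply: ler_wpM2l; first exact: powR_ge0.
have -> : (expR u = expR (u / m) `^ m)%R.
  by rewrite expR_powR mulrC divfK// gt_eqF.
apply: ge0_ler_powR; rewrite ?nnegrE ?divr_ge0 ?expR_ge0 ?(ltW m0) ?(ltW u0)//.
by apply: le_trans (expR_ge1Dx _); rewrite lerDr.
Qed.

End half_line.

(** * The Bessel kernel is dominated by a damped Riesz kernel *)
Section bessel_bound.
Context {R : realType} (n : nat).
Local Notation Rn := (n.-tuple R).
Local Open Scope ereal_scope.

Lemma bessel_kernel_ge0 (al : R) (x : Rn) : 0 <= bessel_kernel al x.
Proof.
rewrite /bessel_kernel mule_ge0//.
  rewrite lee_fin invr_ge0 /gamma_fun /Rintegral fine_ge0//.
  by apply: integral_ge0 => s _; rewrite lee_fin mulr_ge0 ?powR_ge0 ?expR_ge0.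
apply: integral_ge0 => s _; rewrite lee_fin /heat_kernel.
by rewrite !mulr_ge0 ?powR_ge0 ?expR_ge0.
Qed.

(** In the heat kernel representation the integrand is
s^(-a/2-1) e^(-s) e^(-rho^2/(4s)) up to a constant, where a = n - alpha and rho = |x|.
Cutting at s = rho^2, and using the second exponential below, gives rho^(-a).  Bounding
the second exponential by (s/rho^2)^((a+K)/2) everywhere, cutting at s = 1 and using
e^(-s) above, gives rho^(-a-K). *)
Lemma bessel_kernel_le (al K : R) :
  (0 < n)%N -> (0 < al)%R -> (al < n%:R)%R -> (0 < K)%R ->
  exists2 C : R, (0 < C)%R & forall x : Rn, (0 < enorm x)%R ->
  bessel_kernel al x <= (C * rkern (n%:R - al) K (enorm x))%:E.
Proof.
move=> n0 al0 aln K0; set a := (n%:R - al)%R.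
have a0 : (0 < a)%R by rewrite subr_gt0.
have a20 : (0 < a / 2)%R by rewrite divr_gt0.
have K20 : (0 < K / 2)%R by rewrite divr_gt0.
have aK0 : (0 < (a + K) / 2)%R by rewrite divr_gt0// addr_gt0.
have [C1 C10 H1] := integral_half_line_le a20 a20.
have [C2 C20 H2] := integral_half_line_le K20 K20.
have [D1 D10 HD1] := expR_decay a0.
have [D2 D20 HD2] := expR_decay aK0.
have [D3 D30 HD3] := expR_decay K0.
pose c := ((4 * pi) `^ (- (n%:R / 2)) : R)%R.
have pi4 : (0 < 4 * pi :> R)%R by rewrite mulr_gt0 ?pi_gt0.
have c0 : (0 < c)%R by rewrite powR_gt0.
pose G := ((gamma_fun (al / 2))^-1)%R : R.
have G0 : (0 <= G)%R.
  rewrite invr_ge0 /gamma_fun /Rintegral fine_ge0//.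
  by apply: integral_ge0 => s _; rewrite lee_fin mulr_ge0 ?powR_ge0 ?expR_ge0.
pose B1 := (C1 * (c * D1 * 4 `^ a + c))%R.
pose B2 := (C2 * (c * D2 * 4 `^ ((a + K) / 2) + c * D2 * 4 `^ ((a + K) / 2) * D3))%R.
have B10 : (0 < B1)%R by rewrite mulr_gt0// addr_gt0// !mulr_gt0 ?powR_gt0.
have B20 : (0 < B2)%R by rewrite mulr_gt0// addr_gt0// !mulr_gt0 ?powR_gt0.
exists ((G + 1) * (B1 + B2))%R.
  by apply: mulr_gt0; [exact: ltr_wpDl|exact: addr_gt0].
move=> x; set rho := enorm x => rho0.
pose F (s : R) := (s `^ (al / 2 - 1) * expR (- s) * heat_kernel s x)%R.
have F0 s : (0 < s)%R -> (0 <= F s)%R.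
  by move=> _; rewrite /F /heat_kernel !mulr_ge0 ?powR_ge0 ?expR_ge0.
have FE s : (0 < s)%R -> F s = (c * s `^ (- (a / 2) - 1) *
    (expR (- s) * expR (- (rho ^+ 2 / (4 * s)))))%R.
  move=> s0; rewrite /F /heat_kernel powRM ?(ltW pi4) ?(ltW s0)// -/c -/rho.
  have -> : (s `^ (- (a / 2) - 1) = s `^ (al / 2 - 1) * s `^ (- (n%:R / 2)))%R.
    rewrite -powRD; last by rewrite (gt_eqF s0) implybT.
    by congr (_ `^ _)%R; rewrite /a; field.
  by ring.
have el1 (s : R) : (0 < s)%R -> (expR (- s) <= 1)%R.
  by move=> s0; rewrite -[leRHS]expR0 ler_expR oppr_le0 ltW.
have rs0 (s : R) : (0 < s)%R -> (0 < rho ^+ 2 / (4 * s))%R.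
  by move=> s0; rewrite divr_gt0 ?exprn_gt0 ?mulr_gt0.
have e4 := @pos_expR R 4 ltac:(done); case: e4 => l4 e4.
have [lr er] := pos_expR rho0.
have I1 : \int[lebesgue_measure]_(s in `]0%R, +oo[) (F s)%:E <= (B1 * rho `^ (- a))%:E.
  apply: le_trans (H1 F (c * D1 * 4 `^ a * rho `^ (- (2 * a)))%R c
    (rho ^+ 2)%R _ c0 _ F0 _ _) _.
  - by rewrite !mulr_gt0 ?powR_gt0.
  - by rewrite exprn_gt0.
  - move=> s /andP[s0 sT]; rewrite FE//.
    apply: (@le_trans _ _ (c * s `^ (- (a / 2) - 1) *
        (1 * (D1 * (rho ^+ 2 / (4 * s)) `^ (- a))))%R).
      apply: ler_wpM2l; first by rewrite mulr_ge0 ?powR_ge0 ?ltW.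
      by apply: ler_pM; rewrite ?expR_ge0 ?el1 ?HD1 ?rs0.
    rewrite le_eqVlt; apply/orP; left; apply/eqP.
    have [ls es] := pos_expR s0; have [lc ec] := pos_expR c0; have [ld ed] := pos_expR D10.
    by rewrite mul1r ec ed es er e4 !expE; congr expR; field.
  - move=> s Ts; have s0 : (0 < s)%R by apply: lt_le_trans Ts; rewrite exprn_gt0.
    rewrite FE// ler_piMr ?mulr_ge0 ?powR_ge0 ?(ltW c0)//.
    by rewrite -[leRHS]mulr1; apply: ler_pM; rewrite ?expR_ge0 ?el1 ?rs0.
  - rewrite lee_fin le_eqVlt; apply/orP; left; apply/eqP.
    have -> : ((rho ^+ 2) `^ (- (a / 2)) = rho `^ (- a))%R.
      by rewrite er !expE; congr expR; field.
    have -> : (c * D1 * 4 `^ a * rho `^ (- (2 * a)) * (rho ^+ 2) `^ (a / 2) =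
        c * D1 * 4 `^ a * rho `^ (- a))%R.
      rewrite -[LHS]mulrA; congr (_ * _)%R.
      by rewrite er !expE; congr expR; field.
    by rewrite /B1; ring.
have I2 : \int[lebesgue_measure]_(s in `]0%R, +oo[) (F s)%:E <=
    (B2 * (rho `^ (- a) * rho `^ (- K)))%:E.
  have A0 : (0 < c * D2 * 4 `^ ((a + K) / 2) * rho `^ (- (a + K)))%R.
    by rewrite !mulr_gt0 ?powR_gt0.
  have key s : (0 < s)%R -> (F s <= c * D2 * 4 `^ ((a + K) / 2) *
      rho `^ (- (a + K)) * (s `^ (K / 2 - 1) * expR (- s)))%R.
    move=> s0; rewrite FE//.
    apply: (@le_trans _ _ (c * s `^ (- (a / 2) - 1) *
        (expR (- s) * (D2 * (rho ^+ 2 / (4 * s)) `^ (- ((a + K) / 2)))))%R).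
      apply: ler_wpM2l; first by rewrite mulr_ge0 ?powR_ge0 ?ltW.
      by apply: ler_wpM2l; rewrite ?expR_ge0 ?HD2 ?rs0.
    rewrite le_eqVlt; apply/orP; left; apply/eqP.
    have [ls es] := pos_expR s0; have [lc ec] := pos_expR c0; have [ld ed] := pos_expR D20.
    by rewrite ec ed es er e4 !expE; congr expR; field.
  apply: le_trans (H2 F (c * D2 * 4 `^ ((a + K) / 2) * rho `^ (- (a + K)))%R
     (c * D2 * 4 `^ ((a + K) / 2) * rho `^ (- (a + K)) * D3)%R 1%R A0 _ ltr01 F0 _ _) _.
  - by rewrite mulr_gt0.
  - move=> s /andP[s0 sT]; apply: le_trans (key s s0) _.
    apply: ler_wpM2l; first exact: ltW.
    by rewrite ler_piMr ?powR_ge0 ?el1.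
  - move=> s Ts; have s0 : (0 < s)%R by apply: lt_le_trans Ts.
    apply: le_trans (key s s0) _; rewrite -[leRHS]mulrA.
    apply: ler_wpM2l; first exact: ltW.
    apply: (@le_trans _ _ (s `^ (K / 2 - 1) * (D3 * s `^ (- K)))%R).
      by apply: ler_wpM2l; rewrite ?powR_ge0 ?HD3.
    rewrite le_eqVlt; apply/orP; left; apply/eqP.
    have [ls es] := pos_expR s0; have [ld ed] := pos_expR D30.
    by rewrite ed es !expE; congr expR; field.
  - rewrite lee_fin le_eqVlt; apply/orP; left; apply/eqP.
    rewrite !powR1 opprD powRD; last by rewrite (gt_eqF rho0) implybT.
    by rewrite /B2; ring.
rewrite /bessel_kernel -/G.
have Gm : (B1 * rho `^ (- a) <= (B1 + B2) * rho `^ (- a))%R.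
  by apply: ler_wpM2r; rewrite ?powR_ge0// lerDl ltW.
have int0 : 0 <= \int[lebesgue_measure]_(s in `]0%R, +oo[) (F s)%:E.
  by apply: integral_ge0 => s; rewrite /= in_itv/= andbT => s0; rewrite lee_fin F0.
rewrite -[in leRHS]mulrA EFinM.
apply: lee_pmul => //; first by rewrite lee_fin lerDl.
rewrite /rkern.
have [r1|/ltW r1] := leP rho 1%R.
  by rewrite decay_small// mulr1; apply: le_trans I1 _; rewrite lee_fin.
rewrite decay_large//; apply: le_trans I2 _; rewrite lee_fin.
by apply: ler_wpM2r; [rewrite mulr_ge0 ?powR_ge0|rewrite lerDr ltW].
Qed.

End bessel_bound.

(** * Reduction to Borel functions *)
Section borel_version.
Context {R : realType} (n : nat).
Local Notation Rn := (n.-tuple R).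
Local Notation mu := (@lebn R n).
Local Open Scope ereal_scope.

Lemma ereal_rat_between (y : R) (u : \bar R) : y%:E < u ->
  exists q : rat, (y < ratr q)%R /\ (ratr q)%:E < u.
Proof.
case: u => [u|_|//].
  rewrite lte_fin => /rat_in_itvoo[q]; rewrite in_itv/= => /andP[yq qu].
  by exists q; rewrite lte_fin.
have /rat_in_itvoo[q] : (y < y + 1)%R by rewrite ltrDl.
by rewrite in_itv/= => /andP[yq _]; exists q; rewrite ltry.
Qed.

(** The superlevel sets of f at rational heights are Borel up to countably many null
sets.  Setting f to zero on a Borel null set that covers these gives a Borel
function. *)
Lemma borel_version (f : Rn -> \bar R) : lebesgue_measurable_fun f ->
  (forall y, 0 <= f y) ->
  exists g N, [/\ measurable_fun setT g, measurable N /\ mu N = 0,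
    (forall y, 0 <= g y), (forall y, g y <= f y) &
    forall y, ~ N y -> f y = g y].
Proof.
move=> mf f0.
have /choice[A /choice[E AE]] : forall q : rat, exists A, exists E : set Rn,
    [/\ measurable A, mu.-negligible E &
        f @^-1` `](ratr q)%:E, +oo[ = A `|` E].
  move=> q.
  have [A mA [E nE AE]] := mf _ (emeasurable_itv `](ratr q)%:E, +oo[).
  by exists A, E.
(* an enumeration of the rationals; 0 is repeated at the unused codes *)
pose r k : rat := odflt 0%R (unpickle k).
have /negligible_bigcup[N [mN N0 EN]] : forall k, mu.-negligible (E (r k)).
  by move=> k; have [] := AE (r k).
have EqN q : E q `<=` N.
  apply: subset_trans EN => y Ey; exists (pickle q) => //.
  by rewrite /r pickleK.
exists (f \_ (~` N)), N; split => //.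
- apply: (measurability _ (ErealGenOInfty.measurableE R)) => _ [_ [y ->] <-].
  rewrite setTI.
  have [y0|y0] := ltP y 0%R.
    rewrite (_ : _ @^-1` _ = setT)//; apply/seteqP; split => // u _ /=.
    rewrite in_itv/= andbT (@lt_le_trans _ _ 0)// erestrict_ge0//.
  rewrite (_ : _ @^-1` _ =
      \bigcup_q (if (y < ratr q)%R then A q `\` N else set0)).
    apply: bigcupT_measurable_rat => q; case: ifPn => // _.
    by apply: measurableD => //; have [] := AE q.
  apply/seteqP; split => u /=.
    rewrite in_itv/= andbT /patch; case: ifPn => [|_]; last first.
      by rewrite lte_fin ltNge y0.
    rewrite inE => Nu /ereal_rat_between[q [yq qu]].
    exists q => //; rewrite yq; split => //.
    have [_ _ fE] := AE q.
    have : (f @^-1` `](ratr q)%:E, +oo[) u by rewrite /= in_itv/= qu.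
    by rewrite fE => -[//|/EqN/Nu].
  move=> [q _]; case: ifPn => // yq [Au Nu].
  have [_ _ fE] := AE q.
  have : (f @^-1` `](ratr q)%:E, +oo[) u by rewrite fE; left.
  rewrite /= !in_itv/= !andbT /patch mem_set// => qf.
  by apply: lt_trans qf; rewrite lte_fin.
- by move=> y; exact: erestrict_ge0.
- by move=> y; rewrite /patch; case: ifPn.
- by move=> y Ny; rewrite /patch mem_set.
Qed.

End borel_version.

(** * Comparison of the Havin-Maz'ya potentials with the iterated potential *)
Section comparison.
Context {R : realType} (n : nat).
Local Notation Rn := (n.-tuple R).
Local Notation mu := (@lebn R n).
Local Open Scope ereal_scope.
Variables (al K p : R) (n0 : (0 < n)%N).
Hypotheses (al0 : (0 < al)%R) (aln : (al < n%:R)%R) (K0 : (0 <= K)%R) (p1 : (1 < p)%R).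
Let a := (n%:R - al)%R.
Let a0 : (0 < a)%R. Proof. by rewrite subr_gt0. Qed.
Let q := ((p - 1)^-1)%R.
Let q0 : (0 < q)%R. Proof. by rewrite invr_gt0 subr_gt0. Qed.

Lemma riesz_ge0 (f : Rn -> \bar R) x : (forall y, 0 <= f y) -> 0 <= riesz al f x.
Proof.
move=> f0; rewrite /riesz mule_ge0 ?lee_fin ?invr_ge0 ?(ltW a0)//.
by apply: integral_ge0 => y _; rewrite mule_ge0// inve_ge0 lee_fin powR_ge0.
Qed.

Lemma bessel_ge0 (f : Rn -> \bar R) x : (forall y, 0 <= f y) -> 0 <= bessel al f x.
Proof.
by move=> f0; apply: integral_ge0 => y _; rewrite mule_ge0// bessel_kernel_ge0.
Qed.

Lemma le_riesz_off_null (f g : Rn -> \bar R) N x :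
  (forall y, 0 <= f y) -> (forall y, 0 <= g y) ->
  measurable N -> mu N = 0 -> (forall y, ~ N y -> f y <= g y) ->
  riesz al f x <= riesz al g x.
Proof.
move=> f0 g0 mN N0 fg.
apply: lee_wpmul2l; first by rewrite lee_fin invr_ge0 (ltW a0).
apply: (le_integral_off_null _ _ mN N0) => y.
- by rewrite mule_ge0// inve_ge0 lee_fin powR_ge0.
- by rewrite mule_ge0// inve_ge0 lee_fin powR_ge0.
- by move=> Ny; apply: lee_wpmul2r; [rewrite inve_ge0 lee_fin powR_ge0|exact: fg].
Qed.

Lemma le_bessel_off_null (f g : Rn -> \bar R) N x :
  (forall y, 0 <= f y) -> (forall y, 0 <= g y) ->
  measurable N -> mu N = 0 -> (forall y, ~ N y -> f y <= g y) ->
  bessel al f x <= bessel al g x.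
Proof.
move=> f0 g0 mN N0 fg; apply: (le_integral_off_null _ _ mN N0) => y.
- by rewrite mule_ge0// bessel_kernel_ge0.
- by rewrite mule_ge0// bessel_kernel_ge0.
- by move=> Ny; apply: lee_wpmul2l; [exact: bessel_kernel_ge0|exact: fg].
Qed.

Lemma riesz_le_kpot (f : Rn -> \bar R) x : (forall y, 0 <= f y) ->
  riesz al f x <= (a^-1)%:E * kpot a 0 f x.
Proof.
move=> f0; apply: lee_wpmul2l; first by rewrite lee_fin invr_ge0 (ltW a0).
have [N [mN N0 Npos]] := lebn_null_center x n0.
apply: (le_integral_off_null _ _ mN N0) => y.
- by rewrite mule_ge0// inve_ge0 lee_fin powR_ge0.
- by rewrite mule_ge0// lee_fin rkern_ge0.
move=> /Npos rho0; rewrite /rkern decay0 mulr1 powRN inver ifF//.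
by apply/negbTE; rewrite gt_eqF// powR_gt0.
Qed.

Lemma bessel_le_kpot : (0 < K)%R -> exists2 C : R, (0 < C)%R &
  forall (f : Rn -> \bar R) x, (forall y, 0 <= f y) -> measurable_fun setT f ->
  bessel al f x <= C%:E * kpot a K f x.
Proof.
move=> K0'; have [C C0 H] := bessel_kernel_le n0 al0 aln K0'.
exists C => // f x f0 mf; rewrite -kpotZ//; last exact: ltW.
have [N [mN N0 Npos]] := lebn_null_center x n0.
apply: (le_integral_off_null _ _ mN N0) => y.
- by rewrite mule_ge0// bessel_kernel_ge0.
- by rewrite !mule_ge0// lee_fin ?rkern_ge0 ?(ltW C0).
by move=> /Npos /H Hy; rewrite [leRHS]muleAC -EFinM; apply: lee_wpmul2r.
Qed.

(** [T] stands for the Riesz or the Bessel potential.  The inner potential of f need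
not be measurable; it is bounded by a measurable potential before the outer one is
estimated. *)
Lemma iterate_le_kpot2 (T : (Rn -> \bar R) -> Rn -> \bar R) (C : R)
    (f g : Rn -> \bar R) N x :
  (0 < C)%R ->
  (forall h y, (forall u, 0 <= h u) -> 0 <= T h y) ->
  (forall h k N y, (forall u, 0 <= h u) -> (forall u, 0 <= k u) ->
     measurable N -> mu N = 0 -> (forall u, ~ N u -> h u <= k u) -> T h y <= T k y) ->
  (forall h y, (forall u, 0 <= h u) -> measurable_fun setT h ->
     T h y <= C%:E * kpot a K h y) ->
  (forall y, 0 <= f y) -> (forall y, 0 <= g y) -> measurable_fun setT g ->
  measurable N -> mu N = 0 -> (forall y, ~ N y -> f y <= g y) ->
  T (fun y => T f y `^ q) x <= (C * C `^ q)%:E * kpot2 al K q g x.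
Proof.
move=> C0 T0 Tmono TC f0 g0 mg mN N0 fg.
have k0 y : 0 <= kpot a K g y by exact: kpot_ge0.
have mk : measurable_fun setT (fun y => kpot a K g y `^ q).
  by apply: (measurableT_comp (measurable_poweR q)); exact: measurable_kpot.
have Cq0 : (0 <= C `^ q)%R by exact: powR_ge0.
apply: (@le_trans _ _ (T (fun y => (C `^ q)%:E * kpot a K g y `^ q) x)).
  apply: (Tmono _ _ set0) => //.
  - by move=> u; exact: poweR_ge0.
  - by move=> u; rewrite mule_ge0 ?lee_fin ?poweR_ge0.
  move=> u _; rewrite -poweR_EFin -poweRM ?lee_fin ?(ltW C0)//.
  apply: lee_poweR; [exact: ltW|exact: T0|].
  by apply: le_trans (TC _ _ g0 mg); exact: (Tmono _ _ N).
apply: le_trans (TC _ _ _ _) _.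
- by move=> u; rewrite mule_ge0 ?lee_fin ?poweR_ge0.
- exact: measurable_funeM.
- by rewrite kpotZ// ?muleA// => y; exact: poweR_ge0.
Qed.

Lemma kpot2_eq0 (g : Rn -> \bar R) x : (forall y, 0 <= g y) -> measurable_fun setT g ->
  (forall t, (0 < t)%R -> ballint g x t = 0) -> kpot2 al K q g x = 0.
Proof.
move=> g0 mg gx.
have gy y t : (0 < t)%R -> ballint g y t = 0.
  move=> t0; pose r := (Num.max t (enorm (esub x y) + 1))%R.
  have r0 : (0 < r)%R by rewrite lt_max t0.
  apply/eqP; rewrite eq_le ballint_ge0// andbT -(gx (2 * r)%R) ?mulr_gt0//.
  apply: le_ballint => // u yu; apply: (@eball_trans _ _ x y).
    by rewrite /eball/= lt_max ltrDl ltr01 orbT.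
  by apply: sub_eball yu; rewrite le_max lexx.
have kg y : kpot a K g y = 0.
  apply/eqP; rewrite eq_le kpot_ge0// andbT.
  apply: le_trans (kpot_dyadic a0 K0 g0 mg y n0 ltr01) _.
  rewrite /near_sum /far_sum !eseries0 ?adde0// => j _ _.
    by rewrite gy ?mule0// mulr_gt0// exprn_gt0.
  by rewrite gy ?mule0// divr_gt0// exprn_gt0.
rewrite /kpot2 (_ : (fun y => _) = cst 0); last first.
  by apply/funext => y; rewrite -/a kg poweR0r// gt_eqF.
by rewrite /kpot integral0_eq// => y _; rewrite mul0e.
Qed.

End comparison.

Section havin_mazya_comparison.
Context {R : realType} (n : nat).
Local Notation Rn := (n.-tuple R).
Local Notation mu := (@lebn R n).
Local Open Scope ereal_scope.
Variables (al p : R) (n0 : (0 < n)%N).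
Hypotheses (al0 : (0 < al)%R) (aln : (al < n%:R)%R) (p1 : (1 < p)%R).
Let q := ((p - 1)^-1)%R.

Lemma havin_mazya_le_kpot2 : exists2 C : R, (0 < C)%R &
  forall (f g : Rn -> \bar R) N x,
  (forall y, 0 <= f y) -> (forall y, 0 <= g y) -> measurable_fun setT g ->
  measurable N -> mu N = 0 -> (forall y, ~ N y -> f y <= g y) ->
  havin_mazya al p f x <= C%:E * kpot2 al 0 q g x.
Proof.
pose a := (n%:R - al)%R.
have C0 : (0 < a^-1)%R by rewrite invr_gt0 subr_gt0.
exists (a^-1 * (a^-1) `^ q)%R; first by rewrite mulr_gt0 ?powR_gt0.
move=> f g N x f0 g0 mg mN N0 fg.
apply: (@iterate_le_kpot2 R n al 0%R p p1 (@riesz R n al) a^-1 f g N x) => //.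
- by move=> h y h0; exact: riesz_ge0.
- by move=> h k N' y h0 k0 mN' N'0 hk; exact: le_riesz_off_null mN' N'0 hk.
- by move=> h y h0 _; exact: riesz_le_kpot.
Qed.

Lemma havin_mazya_nonhom_le_kpot2 (K : R) : (0 < K)%R -> exists2 C : R, (0 < C)%R &
  forall (f g : Rn -> \bar R) N x,
  (forall y, 0 <= f y) -> (forall y, 0 <= g y) -> measurable_fun setT g ->
  measurable N -> mu N = 0 -> (forall y, ~ N y -> f y <= g y) ->
  havin_mazya_nonhom al p f x <= C%:E * kpot2 al K q g x.
Proof.
move=> K0; have [C C0 H] := bessel_le_kpot n0 al0 aln K0.
exists (C * C `^ q)%R; first by rewrite mulr_gt0 ?powR_gt0.
move=> f g N x f0 g0 mg mN N0 fg.
apply: (@iterate_le_kpot2 R n al K p p1 (@bessel R n al) C f g N x) => //.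
- by move=> h y h0; exact: bessel_ge0.
- by move=> h k N' y h0 k0 mN' N'0 hk; exact: le_bessel_off_null mN' N'0 hk.
Qed.

End havin_mazya_comparison.

(** * The maximal function *)
Section maximal.
Context {R : realType} (n : nat).
Local Notation Rn := (n.-tuple R).
Local Notation mu := (@lebn R n).
Local Open Scope ereal_scope.

Lemma maximal_ge0 (f : Rn -> \bar R) x : 0 <= maximal f x.
Proof.
apply: le_trans (ereal_sup_ubound _); last first.
  by exists 1%R => //=; rewrite in_itv/= ltr01.
by rewrite mule_ge0 ?inve_ge0// integral_ge0.
Qed.

Lemma ballint_le_maximal (f g : Rn -> \bar R) x t : (0 < t)%R ->
  (forall y, 0 <= g y) -> measurable_fun setT g -> (forall y, g y <= f y) ->
  ballint g x t <= ((2 * t) ^+ n)%:E * maximal f x.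
Proof.
move=> t0 g0 mg gf.
have mB := measurable_eball x t.
have Bt := lebn_eball x (ltW t0).
have gf' : ballint g x t <= \int[mu]_(y in eball x t) `|f y|.
  apply: ge0_le_integral_on => y _ //.
  by apply: le_trans (gf y) _; exact: lee_abs.
have [B0|B0] := eqVneq (mu (eball x t)) 0.
  rewrite /ballint (_ : \int[mu]_(y in _) _ = 0); last first.
    under eq_integral => y _ do rewrite -(gee0_abs (g0 y)).
    by apply: integral_abs_eq0 => //; exact: measurable_funTS.
  by rewrite mule_ge0 ?maximal_ge0// lee_fin exprn_ge0 ?mulr_ge0 ?ltW.
have Bpos : 0 < mu (eball x t) by rewrite lt_neqAle eq_sym B0 measure_ge0.
have Bfin : mu (eball x t) \is a fin_num.
  by rewrite ge0_fin_numE// (le_lt_trans Bt)// ltry.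
apply: (@le_trans _ _ (mu (eball x t) * maximal f x)); last first.
  by apply: lee_wpmul2r => //; exact: maximal_ge0.
apply: le_trans gf' _.
have H : (mu (eball x t))^-1 * \int[mu]_(y in eball x t) `|f y| <= maximal f x.
  by apply: ereal_sup_ubound; exists t => //=; rewrite in_itv/= t0.
apply: le_trans (lee_wpmul2l (measure_ge0 mu (eball x t)) H).
by rewrite muleA divee// mul1e.
Qed.

End maximal.

(** * Choice of exponents *)
Section exponents.
Context {R : realType}.
Implicit Types al p q s d sg : R.

Lemma exponent_between al q sg : 0 < al -> 0 < q -> al * (1 + q) <= q * sg ->
  exists e, [/\ al < e, q * e < al * (1 + q) & e <= sg].
Proof.
(* the midpoint between al and al * (1 + q) / q *)
move=> al0 q0 h; exists (al + al / (2 * q)).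
have X0 : 0 < al / (2 * q) by rewrite divr_gt0// mulr_gt0.
have E : q * (al + al / (2 * q)) = q * al + al / 2.
  by field; rewrite gt_eqF.
have E2 : q * (al + al / (2 * q)) < al * (1 + q) by rewrite E; nra.
split => //; first by rewrite ltrDl.
by rewrite -(ler_pM2l q0); apply: le_trans h; exact: ltW.
Qed.

(** The parameter [tau] of [near_bound_bounded]; [d] is the dimension.  At tau = alpha
the exponent b would be alpha s, and (d - alpha s)/(p - 1) < d is the hypothesis
d (2 - p) < alpha s; so a value close to alpha works. *)
Lemma truncation_exponent d al p s : 1 < p -> 0 < al -> al < d -> 1 <= s ->
  al * s < d -> d * (2 - p) < al * s ->
  exists tau, [/\ 0 <= tau, tau < al, al + tau * (s - 1) < d &
    (p - 1)^-1 * (d - (al + tau * (s - 1))) < d].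
Proof.
move=> p1 al0 ald s1 sd gap.
pose eta := Num.min al ((al * s - d * (2 - p)) / (2 * s)).
have eta0 : 0 < eta by rewrite lt_min al0 divr_gt0 ?subr_gt0 ?mulr_gt0//; lra.
have eta1 : eta <= al by rewrite ge_min lexx.
have eta2 : eta * (2 * s) <= al * s - d * (2 - p).
  by rewrite -ler_pdivlMr ?mulr_gt0// ?ge_min ?lexx ?orbT//; lra.
have etas : 0 <= eta * (s - 1) by rewrite mulr_ge0 ?subr_ge0 ?(ltW eta0).
exists (al - eta); split; [lra|lra|nra|].
rewrite mulrC ltr_pdivrMr ?subr_gt0//; nra.
Qed.

(** As s' tends to d/(alpha p), alpha s' tends to d/p, which exceeds d (2 - p) because
(p - 1)^2 > 0. *)
Lemma bounded_exponent d al p s : 1 < p -> 0 < al -> 0 < d -> al * p < d ->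
  s < d / (al * p) ->
  exists s', [/\ s <= s', 1 <= s', s' < d / (al * p) & d * (2 - p) < al * s'].
Proof.
move=> p1 al0 d0 alp sU; set U := d / (al * p).
have alp0 : 0 < al * p by rewrite mulr_gt0//; lra.
have UE : al * U * p = d by rewrite /U; field; rewrite !gt_eqF//; lra.
have U1 : 1 < U by rewrite /U ltr_pdivlMr// mul1r.
have UL : d * (2 - p) / al < U.
  rewrite ltr_pdivrMr// -UE; have : 0 < al * U by rewrite mulr_gt0//; lra.
  have : 0 < (p - 1) ^+ 2 by rewrite exprn_gt0// subr_gt0.
  rewrite expr2; nra.
pose s' := Num.max (Num.max 1 s) ((d * (2 - p) / al + U) / 2).
have s'U : s' < U by rewrite !gt_max U1 sU/=; lra.
exists s'; split => //.
- by rewrite !le_max lexx orbT.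
- by rewrite !le_max lexx.
- have : (d * (2 - p) / al + U) / 2 <= s' by rewrite le_max lexx orbT.
  move=> h; have : d * (2 - p) / al < s' by lra.
  by rewrite ltr_pdivrMr// [X in _ < X]mulrC.
Qed.

End exponents.

(** * Estimates of the iterated potential of a Borel function *)
Section cores.
Context {R : realType} (n : nat).
Local Notation Rn := (n.-tuple R).
Local Notation mu := (@lebn R n).
Local Open Scope ereal_scope.
Variables (al p : R) (n0 : (0 < n)%N).
Hypotheses (al0 : (0 < al)%R) (aln : (al < n%:R)%R) (p1 : (1 < p)%R).
Let q := ((p - 1)^-1)%R.
Let q0 : (0 < q)%R. Proof. by rewrite invr_gt0 subr_gt0. Qed.
Let nR0 : (0 < n%:R :> R)%R. Proof. by rewrite ltr0n. Qed.
Let p0 : (0 < p)%R. Proof. exact: lt_trans p1. Qed.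
Let alp0 : (0 < al * p)%R. Proof. by rewrite mulr_gt0. Qed.
Let qp : (q * p = 1 + q)%R.
Proof. by rewrite /q; field; rewrite subr_eq0 gt_eqF. Qed.

Let C1 : R := (2 ^+ n + 2 ^+ n + 1)%R.
Let C10 : (0 < C1)%R.
Proof. by rewrite !addr_gt0 ?exprn_gt0. Qed.

Let growth_sub s : (0 < s)%R -> (s < n%:R / (al * p))%R ->
  (al * (1 + q) < q * (n%:R / s))%R.
Proof.
move=> s0; rewrite ltr_pdivlMr// => h.
by rewrite -qp mulrCA ltr_pM2l// ltr_pdivlMr// mulrC.
Qed.

Let growth_crit s : (0 < s)%R -> s = (n%:R / (al * p))%R ->
  (al * (1 + q) = q * (n%:R / s))%R.
Proof.
move=> s0 ->; rewrite -qp; field.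
by rewrite !gt_eqF.
Qed.

Let q_mass : (2 - al / n%:R < p)%R -> (q * (n%:R - al) < n%:R)%R.
Proof.
move=> h; rewrite /q mulrC ltr_pdivrMr ?subr_gt0//.
move: h; rewrite ltrBlDr -(ltr_pM2r nR0) [X in (_ < X)%R]mulrDl divfK ?gt_eqF//; nra.
Qed.

Let mass_of (g : Rn -> \bar R) x (M delta s e : R) :
  (1 <= s)%R -> (forall y, 0 <= g y) -> measurable_fun setT g ->
  (0 < M)%R -> (0 < delta)%R ->
  (forall t, (0 < t)%R -> ballint g x t <= (2 ^+ n * t ^+ n * M)%:E) ->
  \int[mu]_y (g y `^ s) <= (M `^ s * delta ^+ n)%:E ->
  (0 <= e <= n%:R / s)%R -> mass_bound C1 M delta e g x.
Proof.
move=> s1 g0 mg M0 d0 gM gs esg.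
by apply: (@mass_bound_from_norm R n s) => //; rewrite exprn_gt0.
Qed.

Lemma kpot2_maximal s : (2 - al / n%:R < p)%R -> (1 <= s)%R ->
  (s < n%:R / (al * p))%R ->
  exists2 C : R, (0 < C)%R & forall (g : Rn -> \bar R) x (M delta : R),
    (forall y, 0 <= g y) -> measurable_fun setT g ->
    (0 < M)%R -> (0 < delta)%R ->
    (forall t, (0 < t)%R -> ballint g x t <= (2 ^+ n * t ^+ n * M)%:E) ->
    \int[mu]_y (g y `^ s) <= (M `^ s * delta ^+ n)%:E ->
    kpot2 al 0 q g x <= (C * (M `^ q * delta `^ (al * (1 + q))))%:E.
Proof.
move=> /q_mass qan s1 sU; have s0 := lt_le_trans ltr01 s1.
have qsg := growth_sub s0 sU.
have [e [ale qe esg]] := exponent_between al0 q0 (ltW qsg).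
have [C2 C20 H2] := near_bound_mass al0 aln q0 e C10 qan.
have [C3 C30 H3] := near_bound_mass al0 aln q0 (n%:R / s)%R C10 qan.
have [C C0 H] := iterated_subcritical n0 al0 aln (lexx 0%R) q0 ale qe qsg C10 C20 C30.
exists C => // g x M d g0 mg M0 d0 gM gs.
have sg0 : (0 <= n%:R / s)%R by rewrite divr_ge0 ?ltW.
have me : mass_bound C1 M d e g x.
  by apply: (mass_of s1 g0 mg M0 d0 gM gs); rewrite esg (le_trans _ (ltW ale))// ltW.
have msg : mass_bound C1 M d (n%:R / s) g x.
  by apply: (mass_of s1 g0 mg M0 d0 gM gs); rewrite sg0 lexx.
by apply: H => //; [exact: H2|exact: H3].
Qed.

(** The exponent s can be raised without changing M and delta, because f <= M turns the
bound M^s delta^n on the integral of f^s into the bound M^s' delta^n on that of f^s'.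
This provides s' >= 1, close enough to n/(alpha p) for [truncation_exponent]. *)
Lemma kpot2_bounded s : (al < n%:R / p)%R -> (0 < s)%R ->
  (s < n%:R / (al * p))%R ->
  exists2 C : R, (0 < C)%R & forall (g : Rn -> \bar R) x (M delta : R),
    (forall y, 0 <= g y) -> measurable_fun setT g ->
    (0 < M)%R -> (0 < delta)%R -> {ae mu, forall y, g y <= M%:E} ->
    \int[mu]_y (g y `^ s) <= (M `^ s * delta ^+ n)%:E ->
    kpot2 al 0 q g x <= (C * (M `^ q * delta `^ (al * (1 + q))))%:E.
Proof.
move=> alU s0' sU'.
have alpn : (al * p < n%:R)%R by rewrite -ltr_pdivlMr.
have [s' [ss' s1 sU gap]] := bounded_exponent p1 al0 nR0 alpn sU'.
have s0 := lt_le_trans ltr01 s1.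
have alsn : (al * s' < n%:R)%R.
  move: sU; rewrite ltr_pdivlMr// => sU; apply: lt_trans sU.
  by rewrite mulrCA mulrA ltr_pMr// mulr_gt0.
have [tau [tau0 taual bn qbn]] := truncation_exponent p1 al0 aln s1 alsn gap.
have qsg := growth_sub s0 sU.
have [e [ale qe esg]] := exponent_between al0 q0 (ltW qsg).
have sg0 : (0 <= n%:R / s')%R by rewrite divr_ge0 ?ltW.
have e01 : (0 <= e <= n%:R / s')%R by rewrite esg (le_trans _ (ltW ale))// ltW.
have sg01 : (0 <= n%:R / s' <= n%:R / s')%R by rewrite sg0 lexx.
have [C2 C20 H2] := near_bound_bounded al0 q0 s1 tau0 taual bn qbn e01.
have [C3 C30 H3] := near_bound_bounded al0 q0 s1 tau0 taual bn qbn sg01.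
have [C C0 H] := iterated_subcritical n0 al0 aln (lexx 0%R) q0 ale qe qsg C10 C20 C30.
exists C => // g x M d g0 mg M0 d0 gM gs'.
have gs : \int[mu]_y (g y `^ s') <= (M `^ s' * d ^+ n)%:E.
  have mgs : measurable_fun setT (fun y => g y `^ s).
    exact: (measurableT_comp (measurable_poweR s)).
  have mgs' : measurable_fun setT (fun y => g y `^ s').
    exact: (measurableT_comp (measurable_poweR s')).
  apply: (@le_trans _ _ (\int[mu]_y ((M `^ (s' - s))%:E * g y `^ s))).
    apply: ae_ge0_le_integral => //.
    - by move=> y _; exact: poweR_ge0.
    - by move=> y _; rewrite mule_ge0 ?poweR_ge0// lee_fin powR_ge0.
    - exact: measurable_funeM.
    apply: filterS gM => y gyM _; move: (g0 y) gyM.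
    case: (g y) => [r r0 rM| |] //; rewrite lee_fin in r0; rewrite lee_fin in rM.
    rewrite !poweR_EFin -EFinM lee_fin.
    have [->|r0'] := eqVneq r 0%R.
      by rewrite powR0 ?mulr_ge0 ?powR_ge0// gt_eqF.
    have -> : (r `^ s' = r `^ (s' - s) * r `^ s)%R.
      by rewrite -powRD ?subrK// r0' implybT.
    apply: ler_wpM2r; first exact: powR_ge0.
    by apply: ge0_ler_powR; rewrite ?subr_ge0 ?nnegrE ?(ltW M0).
  rewrite ge0_integralZl_EFin ?powR_ge0//; last by move=> y _; exact: poweR_ge0.
  apply: (@le_trans _ _ ((M `^ (s' - s))%:E * (M `^ s * d ^+ n)%:E)).
    by apply: lee_wpmul2l; rewrite // lee_fin powR_ge0.
  rewrite -EFinM lee_fin mulrA -powRD ?subrK//.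
  by rewrite (gt_eqF M0) implybT.
have gB t : (0 < t)%R -> ballint g x t <= (2 ^+ n * t ^+ n * M)%:E.
  move=> t0; rewrite -exprMn mulrC.
  by apply: ballint_le_cst; rewrite ?(ltW M0) ?(ltW t0).
have me : mass_bound C1 M d e g x by exact: (mass_of s1 g0 mg M0 d0 gB gs).
have msg : mass_bound C1 M d (n%:R / s') g x by exact: (mass_of s1 g0 mg M0 d0 gB gs).
by apply: H => //; [exact: H2|exact: H3].
Qed.

Definition log_growth (M N : R) : R :=
  (N `^ q * (M `^ q / (M `^ q + N `^ q) + Num.max 0 (ln (M / N))))%R.

(** With N = M delta^sg one has log (M/N) = sg log (1/delta).  If delta <= 1 then N <= M
and the quotient in [log_growth] is at least 1/2; if delta > 1 then M^q is at most
twice N^q times this quotient. *)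
Let critical_sum (K e sg C2 C3 C4 : R) : (0 < K)%R -> (e <= K)%R ->
  (al * (1 + q) < K)%R -> (0 < sg)%R ->
  (al < e)%R -> (q * e < al * (1 + q))%R -> (al * (1 + q) = q * sg)%R ->
  (0 < C2)%R -> (0 < C3)%R -> (0 < C4)%R ->
  exists2 C : R, (0 < C)%R &
  forall (f : Rn -> \bar R) (x : Rn) (M delta : R),
  (forall y, 0 <= f y) -> measurable_fun setT f -> (0 < M)%R -> (0 < delta)%R ->
  mass_bound C1 M delta e f x -> near_bound al q C2 M delta e f x ->
  mass_bound C1 M delta sg f x -> near_bound al q C3 M delta sg f x ->
  mass_bound C1 M delta 0 f x -> near_bound al q C4 M delta 0 f x ->
  kpot2 al K q f x <= (C * log_growth M (M * delta `^ sg))%:E.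
Proof.
move=> K0 eK alK sg0 ale qe qsg C20 C30 C40.
have [C C0 H] := iterated_critical n0 al0 aln (ltW K0) q0 ale qe qsg C10 C20 C30.
have [D D0 HD] := iterated_unit_scale n0 al0 aln (ltW K0) q0 ale qe eK alK C10 C40.
have [E E0 HE] := decay_series_le K0.
pose F := (2 * (1 + E) + E / sg)%R.
have F0 : (0 < F)%R by rewrite addr_gt0 ?mulr_gt0 ?addr_gt0 ?invr_gt0.
exists (C * F + 2 * D)%R; first by rewrite addr_gt0 ?mulr_gt0.
move=> f x M d f0 mf M0 d0 h1 h2 h3 h4 h5 h6.
set N := (M * d `^ sg)%R.
have N0 : (0 < N)%R by rewrite mulr_gt0 ?powR_gt0.
have MN : (M / N = d^-1 `^ sg)%R.
  have [lm em] := pos_expR M0; have [ld ed] := pos_expR d0.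
  by rewrite /N em ed !expE; congr expR; ring.
set r := (M `^ q / (M `^ q + N `^ q))%R; set l := Num.max 0%R (ln (M / N)).
have Mq0 : (0 < M `^ q)%R by rewrite powR_gt0.
have Nq0 : (0 < N `^ q)%R by rewrite powR_gt0.
have r0 : (0 < r)%R by rewrite divr_gt0// addr_gt0.
have l0 : (0 <= l)%R by rewrite le_max lexx.
have [d1|d1] := leP d 1%R.
  apply: le_trans (H f x M d f0 mf M0 d0 h1 h2 h3 h4) _.
  have d01 : (0 < d <= 1)%R by rewrite d0.
  have NqE : (M `^ q * d `^ (q * sg) = N `^ q)%R.
    have [lm em] := pos_expR M0; have [ld ed] := pos_expR d0.
    by rewrite /N em ed !expE; congr expR; ring.
  have L0 : (0 <= ln d^-1)%R by rewrite ln_ge0// invf_ge1.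
  have lE : (ln d^-1 = l / sg)%R.
    have -> : l = (sg * ln d^-1)%R.
      by rewrite /l MN ln_powR; apply/max_idPr; rewrite mulr_ge0 ?(ltW sg0).
    by rewrite mulrC mulKf// gt_eqF.
  have r2 : (1 / 2 <= r)%R.
    rewrite /r ler_pdivlMr ?addr_gt0//.
    have : (N `^ q <= M `^ q)%R.
      apply: ge0_ler_powR; rewrite ?nnegrE ?(ltW q0) ?(ltW M0) ?(ltW N0)//.
      rewrite /N ler_piMr ?(ltW M0)// -[leRHS](@powRr0 _ d).
      by apply: ger_powR; rewrite ?d0 ?d1// ltW.
    lra.
  apply: (@le_trans _ _ ((C * N `^ q)%:E * (1 + (E * (1 + ln d^-1))%:E))).
    rewrite NqE; apply: lee_wpmul2l; first by rewrite lee_fin mulr_ge0 ?ltW.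
    by rewrite leeD2l//; exact: HE.
  rewrite -EFinD -EFinM lee_fin /log_growth -/r -/l.
  apply: (@le_trans _ _ (C * N `^ q * (F * (r + l)))%R).
    apply: ler_wpM2l; first by rewrite mulr_ge0 ?ltW.
    rewrite lE /F; have : (0 <= l / sg)%R by rewrite divr_ge0 ?(ltW sg0).
    have -> : ((2 * (1 + E) + E / sg) * (r + l) =
      2 * (1 + E) * (r + l) + E / sg * r + E * (l / sg))%R by ring.
    have : (0 <= E / sg * r)%R by apply: mulr_ge0; [apply: divr_ge0|]; exact: ltW.
    move: (l / sg)%R => u; nra.
  have NqS : (0 <= N `^ q * (r + l))%R.
    by apply: mulr_ge0; [exact: ltW|apply: addr_ge0 => //; exact: ltW].
  have : (0 <= D * (N `^ q * (r + l)))%R by apply: mulr_ge0 => //; exact: ltW.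
  lra.
apply: le_trans (HD f x M d f0 mf M0 d0 h5 h6) _.
rewrite lee_fin /log_growth -/r -/l.
have MNq : (M `^ q <= N `^ q)%R.
  apply: ge0_ler_powR; rewrite ?nnegrE ?(ltW q0) ?(ltW M0) ?(ltW N0)//.
  rewrite /N ler_peMr ?(ltW M0)// -[leLHS](@powRr0 _ d).
  by apply: ler_powR; rewrite ltW.
have key : (M `^ q <= 2 * (N `^ q * r))%R.
  have S0 : (0 < M `^ q + N `^ q)%R by rewrite addr_gt0.
  have -> : (2 * (N `^ q * r) = M `^ q * ((2 * N `^ q) / (M `^ q + N `^ q)))%R.
    by rewrite /r; ring.
  rewrite -[leLHS]mulr1.
  apply: ler_wpM2l; first exact: ltW.
  by rewrite ler_pdivlMr// mul1r; lra.
have : (D * M `^ q <= D * (2 * (N `^ q * r)))%R by apply: ler_wpM2l; rewrite // ltW.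
have NqS : (0 <= N `^ q * (r + l))%R.
  by apply: mulr_ge0; [exact: ltW|apply: addr_ge0 => //; exact: ltW].
have : (0 <= D * (N `^ q * l))%R.
  by apply: mulr_ge0; [exact: ltW|apply: mulr_ge0 => //; exact: ltW].
have : (0 <= C * F * (N `^ q * (r + l)))%R.
  by apply: mulr_ge0 => //; apply: mulr_ge0; exact: ltW.
lra.
Qed.

Lemma kpot2_maximal_critical s : (2 - al / n%:R < p)%R -> (al <= n%:R / p)%R ->
  s = (n%:R / (al * p))%R ->
  exists K, (0 < K)%R /\
  exists2 C : R, (0 < C)%R & forall (g : Rn -> \bar R) x (M delta : R),
    (forall y, 0 <= g y) -> measurable_fun setT g ->
    (0 < M)%R -> (0 < delta)%R ->
    (forall t, (0 < t)%R -> ballint g x t <= (2 ^+ n * t ^+ n * M)%:E) ->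
    \int[mu]_y (g y `^ s) <= (M `^ s * delta ^+ n)%:E ->
    kpot2 al K q g x <= (C * log_growth M (M * delta `^ (n%:R / s)))%:E.
Proof.
move=> /q_mass qan alU sE.
have s1 : (1 <= s)%R by rewrite sE ler_pdivlMr// mul1r -ler_pdivlMr.
have s0 := lt_le_trans ltr01 s1.
have qsg := growth_crit s0 sE.
have sg0 : (0 < n%:R / s)%R by rewrite divr_gt0.
have [|e [ale qe esg]] := @exponent_between R al q (n%:R / s)%R al0 q0.
  by rewrite qsg.
have e0 : (0 < e)%R by exact: lt_trans ale.
have X0 : (0 < al * (1 + q))%R by rewrite mulr_gt0 ?addr_gt0.
(* any K larger than e and al * (1 + q) would do *)
pose K := (e + al * (1 + q) + 1)%R.
have K0 : (0 < K)%R by rewrite !addr_gt0.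
exists K; split => //.
have [C2 C20 H2] := near_bound_mass al0 aln q0 e C10 qan.
have [C3 C30 H3] := near_bound_mass al0 aln q0 (n%:R / s)%R C10 qan.
have [C4 C40 H4] := near_bound_mass al0 aln q0 0%R C10 qan.
have [||C C0 H] := @critical_sum K e (n%:R / s)%R C2 C3 C4 K0 _ _ sg0 ale qe qsg
  C20 C30 C40.
- by rewrite /K; lra.
- by rewrite /K; lra.
exists C => // g x M d g0 mg M0 d0 gM gs.
have me : mass_bound C1 M d e g x.
  by apply: (mass_of s1 g0 mg M0 d0 gM gs); rewrite esg ltW.
have msg : mass_bound C1 M d (n%:R / s) g x.
  by apply: (mass_of s1 g0 mg M0 d0 gM gs); rewrite lexx ltW.
have m0 : mass_bound C1 M d 0 g x.
  by apply: (mass_of s1 g0 mg M0 d0 gM gs); rewrite lexx ltW.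
by apply: H => //; [exact: H2|exact: H3|exact: H4].
Qed.

Lemma kpot2_bounded_critical s : (al <= n%:R / p)%R ->
  s = (n%:R / (al * p))%R ->
  exists K, (0 < K)%R /\
  exists2 C : R, (0 < C)%R & forall (g : Rn -> \bar R) x (M delta : R),
    (forall y, 0 <= g y) -> measurable_fun setT g ->
    (0 < M)%R -> (0 < delta)%R -> {ae mu, forall y, g y <= M%:E} ->
    \int[mu]_y (g y `^ s) <= (M `^ s * delta ^+ n)%:E ->
    kpot2 al K q g x <= (C * log_growth M (M * delta `^ (n%:R / s)))%:E.
Proof.
move=> alU sE.
have s1 : (1 <= s)%R by rewrite sE ler_pdivlMr// mul1r -ler_pdivlMr.
have s0 := lt_le_trans ltr01 s1.
have qsg := growth_crit s0 sE.
have sg0 : (0 < n%:R / s)%R by rewrite divr_gt0.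
have [|e [ale qe esg]] := @exponent_between R al q (n%:R / s)%R al0 q0.
  by rewrite qsg.
have e0 : (0 < e)%R by exact: lt_trans ale.
have X0 : (0 < al * (1 + q))%R by rewrite mulr_gt0 ?addr_gt0.
have alsp : (al * s * p = n%:R)%R by rewrite sE; field; rewrite !gt_eqF.
have als0 : (0 < al * s)%R by rewrite mulr_gt0.
have alsn : (al * s < n%:R)%R by rewrite -alsp ltr_pMr.
have gap : (n%:R * (2 - p) < al * s)%R.
  rewrite -alsp; have : (0 < (p - 1) ^+ 2)%R by rewrite exprn_gt0// subr_gt0.
  rewrite expr2; nra.
have [tau [tau0 taual bn qbn]] := truncation_exponent p1 al0 aln s1 alsn gap.
(* any K larger than e and al * (1 + q) would do *)
pose K := (e + al * (1 + q) + 1)%R.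
have K0 : (0 < K)%R by rewrite !addr_gt0.
exists K; split => //.
have e01 : (0 <= e <= n%:R / s)%R by rewrite esg ltW.
have sg01 : (0 <= n%:R / s <= n%:R / s)%R by rewrite lexx ltW.
have z01 : ((0 : R) <= 0 <= n%:R / s)%R by rewrite lexx ltW.
have [C2 C20 H2] := near_bound_bounded al0 q0 s1 tau0 taual bn qbn e01.
have [C3 C30 H3] := near_bound_bounded al0 q0 s1 tau0 taual bn qbn sg01.
have [C4 C40 H4] := near_bound_bounded al0 q0 s1 tau0 taual bn qbn z01.
have [||C C0 H] := @critical_sum K e (n%:R / s)%R C2 C3 C4 K0 _ _ sg0 ale qe qsg
  C20 C30 C40.
- by rewrite /K; lra.
- by rewrite /K; lra.
exists C => // g x M d g0 mg M0 d0 gM gs.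
have gB t : (0 < t)%R -> ballint g x t <= (2 ^+ n * t ^+ n * M)%:E.
  move=> t0; rewrite -exprMn mulrC.
  by apply: ballint_le_cst; rewrite ?(ltW M0) ?(ltW t0).
have me : mass_bound C1 M d e g x by exact: (mass_of s1 g0 mg M0 d0 gB gs).
have msg : mass_bound C1 M d (n%:R / s) g x by exact: (mass_of s1 g0 mg M0 d0 gB gs).
have m0 : mass_bound C1 M d 0 g x by exact: (mass_of s1 g0 mg M0 d0 gB gs).
by apply: H => //; [exact: H2|exact: H3|exact: H4].
Qed.

End cores.

(** * Norms *)
Section norms.
Context {R : realType} (n : nat).
Local Notation Rn := (n.-tuple R).
Local Notation mu := (@lebn R n).
Local Open Scope ereal_scope.

Lemma lebn_setT_gt0 : 0 < mu setT.
Proof.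
have -> : mu setT = \prod_(i < n) (lebesgue_measure [set: R] : \bar R).
  rewrite -(@lebn_box R n (fun=> setT))//; congr (lebn n _).
  by apply/seteqP; split.
elim/big_ind: _ => [|x y x0 y0|i _]; first exact: lte01.
  exact: mule_gt0.
apply: (@lt_le_trans _ _ (lebesgue_measure (`[0%R, 1%R]%classic : set R))).
  by rewrite lebesgue_measure_itv/= lte01 oppr0 adde0 lte01.
by apply: le_measure => //; rewrite ?inE//; exact: measurable_itv.
Qed.

Lemma ae_le_Lnormy (f g : Rn -> \bar R) : (forall y, 0 <= g y) ->
  (forall y, g y <= f y) -> {ae mu, forall y, g y <= 'N[mu]_+oo[f]}.
Proof.
move=> g0 gf; rewrite unlock lebn_setT_gt0.
apply: filterS (ess_sup_ge mu (abse \o f)) => y /=; apply: le_trans.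
by apply: le_trans (gf y) _; exact: lee_abs.
Qed.

Lemma integral_poweR_le_Lnorm (s : R) (f g : Rn -> \bar R) : (0 < s)%R ->
  (forall y, 0 <= g y) -> (forall y, g y <= f y) ->
  \int[mu]_y (g y `^ s) <= 'N[mu]_s%:E[f] `^ s.
Proof.
move=> s0 g0 gf; rewrite poweR_Lnorm ?gt_eqF//.
apply: ge0_le_integralT => y; first exact: poweR_ge0.
apply: lee_poweR; [exact: ltW|exact: g0|].
by apply: le_trans (gf y) _; exact: lee_abs.
Qed.

Lemma ballint_eq0 (s : R) (g : Rn -> \bar R) x t : (0 < s)%R -> (0 < t)%R ->
  (forall y, 0 <= g y) -> measurable_fun setT g ->
  \int[mu]_y (g y `^ s) <= 0 -> ballint g x t = 0.
Proof.
move=> s0 t0 g0 mg gs.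
have mgs : measurable_fun setT (fun y => g y `^ s).
  exact: (measurableT_comp (measurable_poweR s)).
have gs0 : \int[mu]_y `|g y `^ s| = 0.
  under eq_integral => y _ do rewrite gee0_abs ?poweR_ge0//.
  by apply/eqP; rewrite eq_le gs integral_ge0// => y _; exact: poweR_ge0.
have /(ae_eq_integral_abs mu measurableT mgs) H := gs0.
apply/eqP; rewrite eq_le ballint_ge0// andbT.
have := @ballint_le_cst R n g 0%R x t (lexx _) (ltW t0) g0 mg.
rewrite mul0r; apply.
apply: filterS H => y /(_ Logic.I) /poweR_eq0_eq0 -> //.
Qed.

End norms.

(** * The four estimates *)
Section conclusion.
Context {R : realType} (n : nat).
Local Notation Rn := (n.-tuple R).
Local Notation mu := (@lebn R n).
Local Open Scope ereal_scope.
Variables (al K p : R) (n0 : (0 < n)%N).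
Hypotheses (al0 : (0 < al)%R) (aln : (al < n%:R)%R) (K0 : (0 <= K)%R) (p1 : (1 < p)%R).
Let q := ((p - 1)^-1)%R.
Let q0 : (0 < q)%R. Proof. by rewrite invr_gt0 subr_gt0. Qed.
Let nR0 : (0 < n%:R :> R)%R. Proof. by rewrite ltr0n. Qed.
Let p0 : (0 < p)%R. Proof. exact: lt_trans p1. Qed.

Variables (g : Rn -> \bar R) (x : Rn) (s C C' : R) (A N L : \bar R).
Hypotheses (g0 : forall y, 0 <= g y) (mg : measurable_fun setT g).
Hypotheses (s0 : (0 < s)%R) (C0 : (0 < C)%R) (C'0 : (0 < C')%R).
Hypotheses (A0 : 0 <= A) (N0 : 0 <= N) (Noo : N < +oo).
Hypothesis LC : L <= C'%:E * kpot2 al K q g x.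
Hypothesis gN : \int[mu]_y (g y `^ s) <= N `^ s.
Hypothesis gA : A = 0 -> forall t, (0 < t)%R -> ballint g x t = 0.

(** If A or N vanishes then so does the potential; if A is infinite then so is the
right-hand side.  Otherwise delta is defined by N = M delta^(n/s). *)
Lemma estimate_cases (B : \bar R) : 0 <= B -> (A = +oo -> 0 < N -> B = +oo) ->
  (forall M delta Nr : R, (0 < M)%R -> (0 < delta)%R -> A = M%:E -> N = Nr%:E ->
    (Nr = M * delta `^ (n%:R / s))%R ->
    \int[mu]_y (g y `^ s) <= (M `^ s * delta ^+ n)%:E ->
    C'%:E * kpot2 al K q g x <= B) ->
  L <= B.
Proof.
move=> B0 Boo H; apply: le_trans LC _.
have zero : (forall t, (0 < t)%R -> ballint g x t = 0) -> C'%:E * kpot2 al K q g x <= B.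
  by move=> g00; rewrite (kpot2_eq0 n0 aln K0 p1 g0 mg g00) mule0.
have [NE|Nn] := eqVneq N 0.
  apply: zero => t t0; apply: (@ballint_eq0 R n s g x t s0 t0 g0 mg).
  by apply: le_trans gN _; rewrite NE poweR0r// gt_eqF.
have Npos : 0 < N by rewrite lt_neqAle eq_sym Nn.
case: A A0 gA Boo H => [M M0 g00 _ H|_ _ Boo _|//]; last by rewrite Boo// leey.
move: M0; rewrite lee_fin le_eqVlt => /predU1P[ME|M0].
  by apply: zero => t; apply: g00; rewrite -ME.
case: N Npos Noo gN H => [Nr Nr0 _ gNr H|//|//].
rewrite lte_fin in Nr0.
pose d := ((Nr / M) `^ (s / n%:R))%R.
have d0 : (0 < d)%R by rewrite powR_gt0// divr_gt0.
have [lm em] := pos_expR M0; have [ln en] := pos_expR Nr0.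
apply: (H M d Nr M0 d0) => //.
- rewrite /d en em !expE; congr expR; field.
  by rewrite !gt_eqF.
- apply: le_trans gNr _; rewrite poweR_EFin lee_fin le_eqVlt.
  apply/orP; left; apply/eqP.
  rewrite /d en em !expE; congr expR; field.
  by rewrite !gt_eqF.
Qed.

Lemma subcritical_conclusion : (s < n%:R / (al * p))%R ->
  (forall M delta : R, (0 < M)%R -> (0 < delta)%R -> A = M%:E ->
    \int[mu]_y (g y `^ s) <= (M `^ s * delta ^+ n)%:E ->
    kpot2 al K q g x <= (C * (M `^ q * delta `^ (al * (1 + q))))%:E) ->
  L <= (C' * C)%:E * A `^ ((n%:R - al * p * s) / ((p - 1) * n%:R)) *
     N `^ (al * p * s / ((p - 1) * n%:R)).
Proof.
move=> sU H.
have alp0 : (0 < al * p)%R by rewrite mulr_gt0.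
have d0 : (0 < (p - 1) * n%:R)%R by rewrite mulr_gt0 ?subr_gt0.
have e1 : (0 < (n%:R - al * p * s) / ((p - 1) * n%:R))%R.
  rewrite divr_gt0// subr_gt0 mulrC; move: sU; rewrite ltr_pdivlMr//.
have CC0 : 0 < (C' * C)%:E by rewrite lte_fin mulr_gt0.
apply: estimate_cases.
- by rewrite !mule_ge0 ?poweR_ge0// ltW.
- move=> -> Npos; rewrite poweRyr ?gt_eqF// gt0_muley// gt0_mulye//.
  exact: poweR_gt0.
move=> M d Nr M0 dl0 AE NE NrE gs.
apply: le_trans (lee_wpmul2l _ (H M d M0 dl0 AE gs)) _.
  by rewrite lee_fin ltW.
rewrite AE NE NrE !poweR_EFin -!EFinM lee_fin le_eqVlt; apply/orP; left; apply/eqP.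
rewrite -[RHS]mulrA [LHS]mulrA; congr (_ * _)%R.
have [lm em] := pos_expR M0; have [ld ed] := pos_expR dl0.
rewrite em ed !expE; congr expR; rewrite /q; field.
by rewrite !gt_eqF ?subr_gt0.
Qed.

Lemma lne_plus_ge0 (u : \bar R) : 0 <= lne_plus u.
Proof. by rewrite /lne_plus; case: ifPn => // u1; rewrite lne_ge0 ltW. Qed.

Lemma log_bound_ge0 (a b : \bar R) : 0 <= a -> 0 <= b -> 0 <= log_bound p a b.
Proof.
move=> a0 b0; rewrite /log_bound mule_ge0 ?poweR_ge0// adde_ge0 ?lne_plus_ge0//.
by rewrite mule_ge0 ?poweR_ge0// inve_ge0 adde_ge0 ?poweR_ge0.
Qed.

Lemma log_bound_EFin (a b : R) : (0 < a)%R -> (0 < b)%R ->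
  log_bound p a%:E b%:E = (log_growth p a b)%:E.
Proof.
move=> a0 b0; rewrite /log_bound /log_growth -/q !poweR_EFin -EFinD.
rewrite !inver !gt_eqF//; last by rewrite addr_gt0 ?powR_gt0.
rewrite -!EFinM.
have -> : lne_plus (a / b)%:E = (Num.max 0 (ln (a / b)))%:E.
  have ab0 : (0 < a / b)%R by rewrite divr_gt0.
  rewrite /lne_plus lte_fin; case: ifPn => [ab1|].
    rewrite lne_EFin//; congr EFin; apply/esym/max_idPr.
    by apply: ln_ge0; exact: ltW.
  rewrite -leNgt => ab1; congr EFin; apply/esym/max_idPl.
  exact: ln_le0.
by rewrite -EFinD -EFinM.
Qed.

Lemma critical_conclusion :
  (forall M delta : R, (0 < M)%R -> (0 < delta)%R -> A = M%:E ->
    \int[mu]_y (g y `^ s) <= (M `^ s * delta ^+ n)%:E ->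
    kpot2 al K q g x <= (C * log_growth p M (M * delta `^ (n%:R / s)))%:E) ->
  L <= (C' * C)%:E * log_bound p A N.
Proof.
move=> H.
have CC0 : 0 < (C' * C)%:E by rewrite lte_fin mulr_gt0.
apply: estimate_cases.
- by rewrite mule_ge0 ?(ltW CC0)// log_bound_ge0.
- move=> -> Npos; rewrite /log_bound.
  have lny : lne_plus (+oo / N) = +oo.
    case: N Npos Noo => [b b0 _|//|//]; rewrite lte_fin in b0.
    rewrite inver gt_eqF// gt0_mulye ?lte_fin ?invr_gt0//.
    by rewrite /lne_plus ltry.
  rewrite lny addey ?gt0_muley ?poweR_gt0//.
  rewrite gt_eqF// (lt_le_trans ltNy0)//.
  by rewrite mule_ge0 ?poweR_ge0// inve_ge0 adde_ge0 ?poweR_ge0.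
move=> M d Nr M0 dl0 AE NE NrE gs.
apply: le_trans (lee_wpmul2l _ (H M d M0 dl0 AE gs)) _.
  by rewrite lee_fin ltW.
rewrite AE NE log_bound_EFin//; last by rewrite NrE mulr_gt0 ?powR_gt0.
by rewrite -!EFinM lee_fin NrE mulrA.
Qed.

End conclusion.

Theorem theorem4p4 (R : realType) (n : nat) (alpha p : R)
    (p_gt1 : 1 < p) (alpha_gt0 : 0 < alpha) (alpha_ltn : alpha < n%:R) :
  [/\ (* (a) *)
      2 - alpha / n%:R < p -> alpha < n%:R / p ->
      forall s : R, 1 <= s -> s < n%:R / (alpha * p) ->
      exists2 c : R, 0 < c &
      forall f : n.-tuple R -> \bar R,
        lebesgue_measurable_fun f -> (forall y, 0 <= f y)%E ->
        ('N[lebn n]_s%:E[f] < +oo)%E ->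
      forall x : n.-tuple R,
        (havin_mazya alpha p f x <=
          c%:E
          * maximal f x `^ ((n%:R - alpha * p * s) / ((p - 1) * n%:R))
          * 'N[lebn n]_s%:E[f] `^ (alpha * p * s / ((p - 1) * n%:R)))%E,
      (* (b) *)
      alpha < n%:R / p ->
      forall s : R, 0 < s -> s < n%:R / (alpha * p) ->
      exists2 c : R, 0 < c &
      forall f : n.-tuple R -> \bar R,
        lebesgue_measurable_fun f -> (forall y, 0 <= f y)%E ->
        ('N[lebn n]_s%:E[f] < +oo)%E -> ('N[lebn n]_+oo[f] < +oo)%E ->
      forall x : n.-tuple R,
        (havin_mazya alpha p f x <=
          c%:E
          * 'N[lebn n]_+oo[f] `^ ((n%:R - alpha * p * s) / ((p - 1) * n%:R))
          * 'N[lebn n]_s%:E[f] `^ (alpha * p * s / ((p - 1) * n%:R)))%E,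
      (* (c) *)
      2 - alpha / n%:R < p -> alpha <= n%:R / p ->
      let s := n%:R / (alpha * p) in
      exists2 c : R, 0 < c &
      forall f : n.-tuple R -> \bar R,
        lebesgue_measurable_fun f -> (forall y, 0 <= f y)%E ->
        ('N[lebn n]_s%:E[f] < +oo)%E ->
      forall x : n.-tuple R,
        (havin_mazya_nonhom alpha p f x <=
          c%:E * log_bound p (maximal f x) 'N[lebn n]_s%:E[f])%E
    & (* (d) *)
      alpha <= n%:R / p ->
      let s := n%:R / (alpha * p) in
      exists2 c : R, 0 < c &
      forall f : n.-tuple R -> \bar R,
        lebesgue_measurable_fun f -> (forall y, 0 <= f y)%E ->
        ('N[lebn n]_s%:E[f] < +oo)%E -> ('N[lebn n]_+oo[f] < +oo)%E ->
      forall x : n.-tuple R,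
        (havin_mazya_nonhom alpha p f x <=
          c%:E * log_bound p 'N[lebn n]_+oo[f] 'N[lebn n]_s%:E[f])%E].
Proof.
have nR0 : 0 < n%:R :> R by exact: lt_trans alpha_ltn.
have n0 : (0 < n)%N by rewrite -(ltr0n R).
have p0 : 0 < p by exact: lt_trans p_gt1.
have sc0 : 0 < n%:R / (alpha * p) by rewrite divr_gt0// mulr_gt0.
have ballM (f g : n.-tuple R -> \bar R) x M : (forall y, 0 <= g y)%E ->
    measurable_fun setT g -> (forall y, g y <= f y)%E -> maximal f x = M%:E ->
    forall t, 0 < t -> (ballint g x t <= (2 ^+ n * t ^+ n * M)%:E)%E.
  move=> g0 mg gf ME t t0; rewrite -exprMn EFinM -ME.
  exact: ballint_le_maximal.
have ball0 (f g : n.-tuple R -> \bar R) x : (forall y, 0 <= g y)%E ->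
    measurable_fun setT g -> (forall y, g y <= f y)%E -> maximal f x = 0%E ->
    forall t, 0 < t -> ballint g x t = 0%E.
  move=> g0 mg gf ME t t0; apply/eqP; rewrite eq_le ballint_ge0// andbT.
  by apply: le_trans (ballint_le_maximal x t0 g0 mg gf) _; rewrite ME mule0.
have aeM (f g : n.-tuple R -> \bar R) M : (forall y, 0 <= g y)%E ->
    (forall y, g y <= f y)%E -> 'N[lebn n]_+oo[f]%E = M%:E ->
    {ae lebn n, forall y, (g y <= M%:E)%E}.
  by move=> g0 gf <-; exact: ae_le_Lnormy.
have ae0 (f g : n.-tuple R -> \bar R) x : (forall y, 0 <= g y)%E ->
    measurable_fun setT g -> (forall y, g y <= f y)%E -> 'N[lebn n]_+oo[f]%E = 0%E ->
    forall t, 0 < t -> ballint g x t = 0%E.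
  move=> g0 mg gf ME t t0; apply/eqP; rewrite eq_le ballint_ge0// andbT.
  have := ballint_le_cst x (lexx 0) (ltW t0) g0 mg (aeM _ _ 0 g0 gf ME).
  by rewrite mul0r.
split.
- move=> pn _ s s1 sU; have s0 := lt_le_trans ltr01 s1.
  have [C C0 H] := kpot2_maximal n0 alpha_gt0 alpha_ltn p_gt1 pn s1 sU.
  have [C' C'0 H'] := havin_mazya_le_kpot2 n0 alpha_ltn p_gt1.
  exists (C' * C); first by rewrite mulr_gt0.
  move=> f mf f0 fs x; have [g [N [mg [mN N0] g0 gf fg]]] := borel_version mf f0.
  apply: (subcritical_conclusion n0 alpha_gt0 alpha_ltn (lexx 0) p_gt1 g0 mg s0
    C0 C'0) => //.
  + exact: maximal_ge0.
  + exact: Lnorm_ge0.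
  + by apply: (H' f g N) => // y /fg ->.
  + exact: integral_poweR_le_Lnorm.
  + by move=> ME; apply: ball0 ME.
  + move=> M d M0 d0 ME gs; apply: H => //; exact: ballM ME.
- move=> pn s s0 sU.
  have [C C0 H] := kpot2_bounded n0 alpha_gt0 alpha_ltn p_gt1 pn s0 sU.
  have [C' C'0 H'] := havin_mazya_le_kpot2 n0 alpha_ltn p_gt1.
  exists (C' * C); first by rewrite mulr_gt0.
  move=> f mf f0 fs fy x; have [g [N [mg [mN N0] g0 gf fg]]] := borel_version mf f0.
  apply: (subcritical_conclusion n0 alpha_gt0 alpha_ltn (lexx 0) p_gt1 g0 mg s0
    C0 C'0) => //.
  + exact: Lnorm_ge0.
  + exact: Lnorm_ge0.
  + by apply: (H' f g N) => // y /fg ->.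
  + exact: integral_poweR_le_Lnorm.
  + by move=> ME; apply: ae0 ME.
  + move=> M d M0 d0 ME gs; apply: H => //; exact: aeM ME.
- move=> pn alU s.
  have [K [K0 [C C0 H]]] :=
    kpot2_maximal_critical n0 alpha_gt0 alpha_ltn p_gt1 pn alU erefl.
  have [C' C'0 H'] := havin_mazya_nonhom_le_kpot2 n0 alpha_gt0 alpha_ltn p_gt1 K0.
  exists (C' * C); first by rewrite mulr_gt0.
  move=> f mf f0 fs x; have [g [N [mg [mN N0] g0 gf fg]]] := borel_version mf f0.
  apply: (critical_conclusion n0 alpha_ltn (ltW K0) p_gt1 g0 mg sc0 C0 C'0) => //.
  + exact: maximal_ge0.
  + exact: Lnorm_ge0.
  + by apply: (H' f g N) => // y /fg ->.
  + exact: integral_poweR_le_Lnorm.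
  + by move=> ME; apply: ball0 ME.
  + move=> M d M0 d0 ME gs; apply: H => //; exact: ballM ME.
- move=> alU s.
  have [K [K0 [C C0 H]]] :=
    kpot2_bounded_critical n0 alpha_gt0 alpha_ltn p_gt1 alU erefl.
  have [C' C'0 H'] := havin_mazya_nonhom_le_kpot2 n0 alpha_gt0 alpha_ltn p_gt1 K0.
  exists (C' * C); first by rewrite mulr_gt0.
  move=> f mf f0 fs fy x; have [g [N [mg [mN N0] g0 gf fg]]] := borel_version mf f0.
  apply: (critical_conclusion n0 alpha_ltn (ltW K0) p_gt1 g0 mg sc0 C0 C'0) => //.
  + exact: Lnorm_ge0.
  + exact: Lnorm_ge0.
  + by apply: (H' f g N) => // y /fg ->.
  + exact: integral_poweR_le_Lnorm.
  + by move=> ME; apply: ae0 ME.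
  + move=> M d M0 d0 ME gs; apply: H => //; exact: aeM ME.
Qed.
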